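(* There exist a diffeomorphism $f$ of the 2-torus $\mathbb{T}^2$ admitting a dominated splitting $T\mathbb{T}^2 = E \oplus F$ into one-dimensional sub-bundles, and an open neighborhood $\mathcal{U}$ of $f$ in the space of $C^1$ diffeomorphisms of $\mathbb{T}^2$ with the $C^1$ topology, such that every $g \in \mathcal{U}$ has a dominated splitting $T\mathbb{T}^2 = E_g \oplus F_g$ into one-dimensional sub-bundles for which neither $E_g$ nor $F_g$ is integrable; and hence neither $E_g$ nor $F_g$ is Lipschitz.
   Context: $\mathbb{T}^2$ is the 2-torus with its flat Riemannian metric; $|\cdot|$ denotes the induced norm on tangent vectors. Dominated splitting: for a diffeomorphism $g$ of $\mathbb{T}^2$, a $Dg$-invariant splitting $T\mathbb{T}^2 = E \oplus F$ into one-dimensional sub-bundles is a dominated splitting if for every $x \in \mathbb{T}^2$, every unit vector $u \in E_x$ and every unit vector $v \in F_x$ one has $|Dg(u)| < |Dg(v)|$. The two bundles of a dominated splitting are continuous and uniquely determined by $g$, and dominated splittings are robust: every diffeomorphism $g$ sufficiently $C^1$-close to a diffeomorphism $f$ with a dominated splitting $E\oplus F$ has a dominated splitting, denoted $E_g \oplus F_g$. Integrability: a one-dimensional continuous sub-bundle $E$ of $T\mathbb{T}^2$ is integrable if there exists a 1-foliation of $\mathbb{T}^2$, that is, a continuous partition of $\mathbb{T}^2$ consisting of immersed one-dimensional submanifolds, which is tangent to $E$ (the tangent line at each point $x$ of the submanifold through $x$ is $E_x$). Lipschitz: a one-dimensional sub-bundle $E$ is Lipschitz if it is Lipschitz as a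 line field, i.e. the map $x \mapsto E_x$ is Lipschitz (equivalently, $E$ is locally spanned by Lipschitz unit vector fields). *)

(* Defs.v *)
From HB Require Import structures.
From mathcomp Require Import all_boot all_order all_algebra.
From mathcomp Require Import all_classical all_reals all_analysis.

Set Implicit Arguments.
Unset Strict Implicit.
Unset Printing Implicit Defensive.

Import Order.TTheory GRing.Theory Num.Theory.
Import numFieldNormedType.Exports.

Local Open Scope classical_set_scope.
Local Open Scope ring_scope.
Local Open Scope quotient_scope.

Section Torus.
Variable R : realType.

(* The norm `|v| that the library puts on row vectors is the sup norm; the flat
   metric needs the Euclidean one. *)
Definition enorm (v : 'rV[R]_2) : R := Num.sqrt (\sum_i v 0 i ^+ 2).

Definition torus_rel_op (x y : 'rV[R]_2) : bool :=
  [forall i, x 0 i - y 0 i \in Num.int].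

Lemma torus_rel_refl : reflexive torus_rel_op.
Proof. by move=> x; apply/forallP => i; rewrite subrr rpred0. Qed.

Lemma torus_rel_sym : symmetric torus_rel_op.
Proof. by move=> x y; apply: eq_forallb => i; rewrite -opprB rpredN. Qed.

Lemma torus_rel_trans : transitive torus_rel_op.
Proof.
move=> y x z /forallP xy /forallP yz; apply/forallP => i.
by rewrite -(subrK (y 0 i) (x 0 i)) -addrA rpredD.
Qed.

Definition torus_rel :=
  EquivRel _ torus_rel_refl torus_rel_sym torus_rel_trans.

(* R^2 / Z^2 *)
Definition torus := {eq_quot torus_rel}.

HB.instance Definition _ := Topological.copy torus (quotient_topology torus).
HB.instance Definition _ := Quotient.on torus.

Definition tproj (x : 'rV[R]_2) : torus := \pi_torus x.

(* The distance of the flat Riemannian metric. *)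
Definition tdist (p q : torus) : R :=
  inf [set d | exists x y, [/\ tproj x = p, tproj y = q & d = enorm (x - y)]].

(* The charts of the torus are the local inverses of tproj, and they identify
   every tangent space with R^2. Hence h is C^1 with differential dh when h has,
   near each point, a local lift H to R^2 with differential dh, and dh is
   continuous (V will be R or R^2, so pointwise continuity of dh is continuity
   for the operator norm). *)
Definition C1_with_diff (V : normedModType R)
    (h : V -> torus) (dh : V -> V -> 'rV[R]_2) : Prop :=
  (forall x : V, exists H : V -> 'rV[R]_2,
     \forall y \near x, tproj (H y) = h y /\ is_diff y H (dh y)) /\
  (forall w : V, continuous (fun x => dh x w)).

(* As for the library's Jacobian, matrices act on row vectors on the right. *)
Definition torus_C1_with_diff (g : torus -> torus) (D : torus -> 'M[R]_2) :=
  C1_with_diff (fun x : 'rV[R]_2 => g (tproj x))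
               (fun x w => w *m D (tproj x)).

(* The differential is determined by the map; carrying it as a field only gives
   it a name. *)
Record diffeo := Diffeo {
  diffeo_fun :> torus -> torus ;
  diffeo_inv : torus -> torus ;
  diffeo_diff : torus -> 'M[R]_2 ;
  diffeo_funK : cancel diffeo_fun diffeo_inv ;
  diffeo_invK : cancel diffeo_inv diffeo_fun ;
  diffeo_C1 : torus_C1_with_diff diffeo_fun diffeo_diff ;
  diffeo_inv_C1 : exists D', torus_C1_with_diff diffeo_inv D' }.

Definition C1_close (e : R) (f g : diffeo) : Prop :=
  forall p, tdist (f p) (g p) < e /\ `|diffeo_diff f p - diffeo_diff g p| < e.

Definition C1_open (U : set diffeo) : Prop :=
  forall f, U f -> exists2 e : R, 0 < e & forall g, C1_close e f g -> U g.

(* The distance on the projective line between two lines, min(|u - v|, |u + v|)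
   for unit vectors u and v spanning them. *)
Definition line_dist (l m : {vspace 'rV[R]_2}) : R :=
  inf [set d | exists u v, [/\ u \in l, v \in m,
                               enorm u = 1, enorm v = 1 & d = enorm (u - v)]].

Definition subbundle1 (E : torus -> {vspace 'rV[R]_2}) : Prop :=
  (forall p, \dim (E p) = 1%N) /\
  (forall (p : torus) (e : R), 0 < e ->
     \forall q \near p, line_dist (E p) (E q) < e).

Definition invariant_bundle (g : diffeo) (E : torus -> {vspace 'rV[R]_2}) : Prop :=
  forall p, (linfun (mulmxr (diffeo_diff g p)) @: E p)%VS = E (g p).

Definition dominated_splitting (g : diffeo)
    (E F : torus -> {vspace 'rV[R]_2}) : Prop :=
  [/\ subbundle1 E /\ subbundle1 F,
      forall p, directv (E p + F p) /\ (E p + F p)%VS = fullv,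
      invariant_bundle g E /\ invariant_bundle g F &
      forall p u v, u \in E p -> v \in F p -> enorm u = 1 -> enorm v = 1 ->
        enorm (u *m diffeo_diff g p) < enorm (v *m diffeo_diff g p)].

(* L is the image of an injective C^1 immersion c, with velocity c', of the line
   or of the circle R / T Z, and it is tangent to E at each of its points. *)
Definition integral_submanifold (E : torus -> {vspace 'rV[R]_2})
    (L : set torus) : Prop :=
  exists (c : R -> torus) (c' : R -> 'rV[R]_2),
    [/\ C1_with_diff c (fun t s => s *: c' t) /\ (forall t, c' t != 0),
        injective c \/
          (exists2 T : R, 0 < T & forall s t,
             c s = c t <-> exists k : int, s - t = k%:~R * T),
        range c = L &
        forall t, <[c' t]>%VS = E (c t)].

(* The set P of leaves is a continuous partition: around every point there is a
   homeomorphism phi from R^2 onto an open set which sends each horizontal line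
   into a single leaf. *)
Definition continuous_partition (P : set (set torus)) : Prop :=
  (forall L, P L -> L !=set0) /\
  (forall p, exists! L, P L /\ L p) /\
  (forall p, exists phi : R * R -> torus,
     [/\ phi (0, 0) = p, injective phi, continuous phi,
         forall A : set (R * R), open A -> open (phi @` A) &
         forall t, exists2 L, P L & forall s, L (phi (s, t))]).

Definition integrable_bundle (E : torus -> {vspace 'rV[R]_2}) : Prop :=
  exists P : set (set torus), continuous_partition P /\
    forall L, P L -> integral_submanifold E L.

Definition lipschitz_bundle (E : torus -> {vspace 'rV[R]_2}) : Prop :=
  exists k : R, forall p q, line_dist (E p) (E q) <= k * tdist p q.

End Torus.

(* Main.v *)
(** The lift of [f] is [F (x, t) = (x + a sin 2 pi x + c cos 4 pi N t, t + c sin 4 pi N t)]. In the frame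
    rotated by the angle [2 pi N t] its differential is nearly diagonal, so every [g] which is C^1-close
    to [f] has a dominated splitting whose lines turn with [t].

    Near the origin [g] is expanding and [E_g] is almost horizontal, inclined in such a way that
    curves tangent to [E_g] and running to the left approach the axis [t = 0]. Let such a curve [C]
    start on the right side of a suitable box and leave the box. Its images under [g^n] are again
    tangent to [E_g], and trapping them one after the other yields times [t_n], increasing to some
    [T], such that [g^n (C t_n)] lies on the right side of the box and [g^j (C t_n)] in the box for
    all [j <= n]. As [g] is expanding in the box, [C T] does not depend on the curve: all these
    curves merge. If [E_g] were Lipschitz this would contradict the uniqueness of solutions of
    ordinary differential equations. If it were integrable, distinct leaves would meet; here one
    needs that a leaf cannot stay in the box forever. For [F_g] one argues in the same way with
    [g^-1] near the point [(1/2, 1/(4N))], where [f] is contracting and [F_g] almost horizontal. *)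

Require Import Defs.
From HB Require Import structures.
From mathcomp Require Import all_boot all_order all_algebra.
From mathcomp Require Import all_classical all_reals all_analysis.
From mathcomp Require Import ring lra zify.

Set Implicit Arguments.
Unset Strict Implicit.
Unset Printing Implicit Defensive.

Import Order.TTheory GRing.Theory Num.Theory.
Import numFieldNormedType.Exports.

Local Open Scope classical_set_scope.
Local Open Scope ring_scope.

(** * Calculus on the line and in the plane *)

(** The drift in [x] has to meet two demands: at the sides of the box it must dominate
    [cc * cos (2 * fr * t)], yet its derivative must be negligible against the gap 1/100 on which
    the splitting rests. Both hold because its frequency is lower by the factor [2 * KN]: the
    amplitude is [16 * cc], the derivative at most [16 / 10 ^+ 6]. This is why [KN] is large; the
    price is a very weak horizontal expansion of the box. For a perturbation neither line field is
    explicit. What survives is its invariance and a cone of slopes at most 1/20 around the rotated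
    frame. The trapping argument is therefore stated for an abstract relation [K] between points and
    vectors, and serves for [g] as well as for a translate of its inverse. The failure of the
    Lipschitz property is not deduced from that of integrability, which would require building a
    foliation from solution curves; both are read off from the merging of curves. *)

Section RealTools.
Variable R : realType.

(** The infimum of the counterexamples satisfies [P] by the closure hypothesis; the extension
    hypothesis then leaves a gap above it, so that it cannot be their infimum. *)
Lemma real_induction (P : R -> Prop) (a b : R) :
  P a ->
  (forall s, a <= s < b -> (forall u, a <= u <= s -> P u) ->
     exists2 d, 0 < d & forall u, s < u < s + d -> P u) ->
  (forall s, a < s <= b -> (forall u, a <= u < s -> P u) -> P s) ->
  forall s, a <= s <= b -> P s.
Proof.
move=> Pa Pext Pcl s /andP[as_ sb]; apply: contrapT => nPs.
pose S := [set u | a <= u <= b /\ ~ P u].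
have Ss : S s by split => //; rewrite as_ sb.
have hS : has_inf S.
  by split; [exists s | exists a => u [/andP[]]].
have lbS : forall u, S u -> inf S <= u by move=> u; apply: ge_inf; case: hS.
have aS : a <= inf S by apply: lb_le_inf; [exists s|move=> u [/andP[]]].
have Sb : inf S <= b by apply: le_trans (lbS _ Ss) sb.
have below u : a <= u < inf S -> P u.
  move=> /andP[au uS]; apply: contrapT => nPu.
  have : inf S <= u by apply: lbS; split => //; rewrite au /= (le_trans (ltW uS)).
  by rewrite leNgt uS.
have PS : P (inf S).
  have [<-//|neq] := eqVneq a (inf S).
  by apply: Pcl => //; rewrite Sb andbT lt_neqAle neq.
have Sltb : inf S < b.
  rewrite lt_neqAle Sb andbT; apply/eqP => Seq.
  have : inf S <= s by exact: lbS.
  rewrite Seq => bs; apply: nPs; have -> : s = inf S by apply/eqP; rewrite eq_le Seq bs sb.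
  by [].
have [|u /andP[au uS]|d d0 dP] := Pext (inf S).
- by rewrite aS Sltb.
- have [uS'|uS'] := ltP u (inf S); first by apply: below; rewrite au.
  by have -> : u = inf S by apply/eqP; rewrite eq_le uS uS'.
have [u Su uS] := inf_adherent d0 hS.
have [u_eq|u_neq] := eqVneq u (inf S); first by case: Su => _; rewrite u_eq.
have Su' := lbS _ Su; case: Su => ? nPu; apply: nPu; apply: dP.
by rewrite uS andbT lt_neqAle eq_sym u_neq Su'.
Qed.

Lemma near_dist (P : R -> Prop) (s : R) :
  (\forall u \near s, P u) -> exists2 d, 0 < d & forall u, `|u - s| < d -> P u.
Proof.
move=> /nbhs_ballP[d /= d0 dP]; exists d => // u ud; apply: dP => /=.
by rewrite /ball /= distrC.
Qed.

Lemma is_derive_cts (V : normedModType R) (f : R -> V) (t : R) (w : V) :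
  is_derive t 1 f w -> {for t, continuous f}.
Proof.
move=> [df _]; exact/differentiable_continuous/derivable1_diffP.
Qed.

Lemma is_derive_diff (V : normedModType R) (f : R -> V) (t : R) (w : V) :
  is_derive t 1 f w -> is_diff t f (fun s => s *: w).
Proof.
move=> [df <-]; have df' : differentiable f t by exact/derivable1_diffP.
apply: DiffDef => //; rewrite (deriv1E df); apply/funext => s /=.
by rewrite derive1E.
Qed.

Lemma is_diff_derive (V : normedModType R) (f : R -> V) (t : R) (L : R -> V) :
  is_diff t f L -> is_derive t 1 f (L 1).
Proof.
move=> [df <-]; apply: DeriveDef; first exact/derivable1_diffP.
by rewrite deriveE.
Qed.

Lemma chain_curve (V W : normedModType R) (G : V -> W) (L : V -> W) (f : R -> V) (t : R) (w : V) :
  is_derive t 1 f w -> is_diff (f t) G L -> is_derive t 1 (G \o f) (L w).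
Proof.
move=> fw GL; have fd := is_derive_diff fw.
have := is_diff_comp fd GL; move/is_diff_derive => /=; by rewrite scale1r.
Qed.

End RealTools.

Section Antiderivative.
Variable R : realType.

Lemma is_derive_cst0 (f : R -> R) (a b : R) :
  (forall t : R, a < t < b -> is_derive t 1 f 0) ->
  forall x y, a < x < b -> a < y < b -> f x = f y.
Proof.
move=> df; have H x y : a < x -> x < y -> y < b -> f x = f y.
  move=> ax xy yb.
  have dfx (t : R) : t \in `[x, y]%R -> is_derive t 1 f 0.
    by rewrite in_itv /= => /andP[xt ty]; apply: df; rewrite (lt_le_trans ax xt) (le_lt_trans ty yb).
  have fc : {within `[x, y], continuous f}.
    by apply: derivable_within_continuous => t /dfx [].
  have dfo (t : R) : t \in `]x, y[%R -> is_derive t 1 f ((fun=> 0) t).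
    by move=> txy; apply: dfx; move: txy; rewrite !in_itv /= => /andP[/ltW-> /ltW->].
  have [c _] := MVT xy dfo fc.
  by rewrite mul0r => /subr0_eq.
move=> x y /andP[ax xb] /andP[ay yb].
have [xy|yx|->//] := ltgtP x y; first exact: H.
by symmetry; exact: H.
Qed.

Let mu := @lebesgue_measure R.

Lemma antiderivative_itv (f : R -> R) (a b : R) : continuous f -> a < b ->
  exists F : R -> R, forall t : R, a < t < b -> is_derive t 1 F (f t).
Proof.
move=> fc ab.
have intf : mu.-integrable `[a, b] (EFin \o f).
  apply: continuous_compact_integrable; first exact: segment_compact.
  exact: continuous_subspaceT.
exists (fun x => (\int[mu]_(t in `[a, x]) f t)%R) => t /andP[at_ tb].
have [dF F'] := continuous_FTC1_closed tb intf at_ (fc t).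
apply: DeriveDef; first exact: dF.
rewrite -derive1E; exact: F'.
Qed.

(** Antiderivatives on the intervals from [- n.+1%:R] to [n.+1%:R], normalised to vanish at 0, agree
    on common domains; choosing the index by the integral part of [|x|] patches them together. *)
Lemma antiderivative (f : R -> R) : continuous f ->
  exists F : R -> R, F 0 = 0 /\ forall t : R, is_derive t 1 F (f t).
Proof.
move=> fc.
have /choice[F_ HF] : forall n : nat, exists F : R -> R,
    forall t : R, - n.+1%:R < t < n.+1%:R -> is_derive t 1 F (f t).
  by move=> n; apply: antiderivative_itv => //; apply: (@lt_trans _ _ 0); rewrite ?oppr_lt0 ltr0n.
pose m (x : R) := Num.trunc `|x|.
have hm x : - (m x).+1%:R < x < (m x).+1%:R.
  by rewrite -ltr_norml; exact: truncnS_gt.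
have h0 n : - n.+1%:R < (0 : R) < n.+1%:R by rewrite oppr_lt0 ltr0Sn.
have agree x n : - n.+1%:R < x < n.+1%:R -> F_ n x - F_ n 0 = F_ (m x) x - F_ (m x) 0.
  move=> hn; pose k := minn n (m x).
  have hk (t : R) : - k.+1%:R < t < k.+1%:R ->
      (- n.+1%:R < t < n.+1%:R) /\ (- (m x).+1%:R < t < (m x).+1%:R).
    rewrite -!ltr_norml => tk; split; apply: (lt_le_trans tk); rewrite ler_nat ltnS.
      exact: geq_minl.
    exact: geq_minr.
  have hx : - k.+1%:R < x < k.+1%:R.
    by rewrite /k; case: leqP.
  have dk (t : R) : - k.+1%:R < t < k.+1%:R -> is_derive t 1 (F_ n - F_ (m x)) 0.
    move=> /hk[t1 t2]; have d1 := HF _ _ t1; have d2 := HF _ _ t2.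
    by rewrite -(subrr (f t)); exact: is_deriveB.
  have /eqP := is_derive_cst0 dk hx (h0 k).
  rewrite -[_ x]/(F_ n x - F_ (m x) x) -[_ 0]/(F_ n 0 - F_ (m x) 0) => /eqP E.
  by rewrite -[F_ n x](subrK (F_ (m x) x)) E; ring.
exists (fun x => F_ (m x) x - F_ (m x) 0); split; first by rewrite subrr.
move=> t; pose n := (m t).+1.
have nt : \forall x \near t, F_ n x - F_ n 0 = F_ (m x) x - F_ (m x) 0.
  have : `|t| < n.+1%:R by apply: lt_trans (truncnS_gt _) _; rewrite ltr_nat.
  move=> tn; near=> x; apply: agree; rewrite -ltr_norml; near: x.
  exact: (@cvgr_norm_lt _ _ _ _ _ id t cvg_id).
have tn : - n.+1%:R < t < n.+1%:R.
  by rewrite -ltr_norml; apply: lt_trans (truncnS_gt _) _; rewrite ltr_nat.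
have d := HF _ _ tn.
apply: near_eq_is_derive nt _.
by rewrite -[f t]subr0; exact: is_deriveB.
Unshelve. all: by end_near. Qed.

End Antiderivative.

Section Plane.
Variable R : realType.
Notation V := 'rV[R]_2.
Implicit Types (v w : V) (t x y : R).

Definition px v : R := v 0 0.
Definition py v : R := v 0 1.
Definition pt x y : V := \row_j (if j == 0 then x else y).

Lemma px_pt x y : px (pt x y) = x. Proof. by rewrite /px mxE. Qed.
Lemma py_pt x y : py (pt x y) = y. Proof. by rewrite /py mxE. Qed.

Lemma plane_ext v w : px v = px w -> py v = py w -> v = w.
Proof.
move=> e0 e1; apply/rowP => i; case: (unliftP 0 i) => [j ->|-> //].
by rewrite ord1; have -> : lift 0 0 = 1 :> 'I_2 by exact: val_inj.
Qed.

Lemma pt_eta v : pt (px v) (py v) = v.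
Proof. by apply: plane_ext; rewrite ?px_pt ?py_pt. Qed.

Lemma pxD v w : px (v + w) = px v + px w. Proof. by rewrite /px mxE. Qed.
Lemma pyD v w : py (v + w) = py v + py w. Proof. by rewrite /py mxE. Qed.
Lemma pxN v : px (- v) = - px v. Proof. by rewrite /px mxE. Qed.
Lemma pyN v : py (- v) = - py v. Proof. by rewrite /py mxE. Qed.
Lemma pxB v w : px (v - w) = px v - px w. Proof. by rewrite pxD pxN. Qed.
Lemma pyB v w : py (v - w) = py v - py w. Proof. by rewrite pyD pyN. Qed.
Lemma pxZ x v : px (x *: v) = x * px v. Proof. by rewrite /px mxE. Qed.
Lemma pyZ x v : py (x *: v) = x * py v. Proof. by rewrite /py mxE. Qed.
Lemma px0 : px 0 = 0. Proof. by rewrite /px mxE. Qed.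
Lemma py0 : py 0 = 0. Proof. by rewrite /py mxE. Qed.
Definition pE := (pxD, pyD, pxN, pyN, pxZ, pyZ, px0, py0, px_pt, py_pt).

Lemma sum2 (f : 'I_2 -> R) : \sum_i f i = f 0 + f 1.
Proof.
by rewrite big_ord_recl big_ord1; congr (_ + f _); exact: val_inj.
Qed.

Lemma px_mul v (M : 'M[R]_2) : px (v *m M) = px v * M 0 0 + py v * M 1 0.
Proof. by rewrite /px /py mxE sum2. Qed.
Lemma py_mul v (M : 'M[R]_2) : py (v *m M) = px v * M 0 1 + py v * M 1 1.
Proof. by rewrite /px /py mxE sum2. Qed.

Lemma enormE v : enorm v = Num.sqrt (px v ^+ 2 + py v ^+ 2).
Proof. by rewrite /enorm sum2. Qed.

Lemma enorm_ge0 v : 0 <= enorm v.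
Proof. by rewrite sqrtr_ge0. Qed.

Lemma enorm_sqr v : enorm v ^+ 2 = px v ^+ 2 + py v ^+ 2.
Proof. by rewrite enormE sqr_sqrtr // addr_ge0 ?sqr_ge0. Qed.

Lemma px_le_enorm v : `|px v| <= enorm v.
Proof.
by rewrite -(@ler_pXn2r _ 2) ?nnegrE ?enorm_ge0 // enorm_sqr real_normK ?num_real // lerDl sqr_ge0.
Qed.

Lemma py_le_enorm v : `|py v| <= enorm v.
Proof.
by rewrite -(@ler_pXn2r _ 2) ?nnegrE ?enorm_ge0 // enorm_sqr real_normK ?num_real // lerDr sqr_ge0.
Qed.

Lemma enorm_le_add v : enorm v <= `|px v| + `|py v|.
Proof.
rewrite -(@ler_pXn2r _ 2) ?nnegrE ?enorm_ge0 ?addr_ge0 // enorm_sqr.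
rewrite -(real_normK (num_real (px v))) -(real_normK (num_real (py v))).
have := normr_ge0 (px v); have := normr_ge0 (py v); nra.
Qed.

Lemma enorm_triangle v w : enorm (v + w) <= enorm v + enorm w.
Proof.
rewrite -(@ler_pXn2r _ 2) ?nnegrE ?enorm_ge0 ?addr_ge0 ?enorm_ge0 //.
rewrite sqrrD !enorm_sqr !pE.
have H : px v * px w + py v * py w <= enorm v * enorm w.
  apply: le_trans (ler_norm _) _.
  rewrite -(@ler_pXn2r _ 2) ?nnegrE ?normr_ge0 ?mulr_ge0 ?enorm_ge0 //.
  rewrite exprMn !enorm_sqr real_normK ?num_real //.
  have := sqr_ge0 (px v * py w - py v * px w); nra.
by nra.
Qed.

Lemma enorm0 : enorm (0 : V) = 0.
Proof. by rewrite enormE !pE expr0n /= addr0 sqrtr0. Qed.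

Lemma enormZ x v : enorm (x *: v) = `|x| * enorm v.
Proof. by rewrite !enormE !pE !exprMn -mulrDr sqrtrM ?sqr_ge0 // sqrtr_sqr. Qed.

Lemma px_le_norm v : `|px v| <= `|v|.
Proof. rewrite [leRHS]/Num.Def.normr /= mx_normrE; exact: (le_bigmax _ (fun i : 'I_1 * 'I_2 => `|v i.1 i.2|) (0, 0)). Qed.
Lemma py_le_norm v : `|py v| <= `|v|.
Proof. rewrite [leRHS]/Num.Def.normr /= mx_normrE; exact: (le_bigmax _ (fun i : 'I_1 * 'I_2 => `|v i.1 i.2|) (0, 1)). Qed.

Lemma mx_entry_le (M : 'M[R]_2) i j : `|M i j| <= `|M|.
Proof. rewrite [leRHS]/Num.Def.normr /= mx_normrE; exact: (le_bigmax _ (fun k : 'I_2 * 'I_2 => `|M k.1 k.2|) (i, j)). Qed.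

Lemma ord2P (i : 'I_2) : i = 0 \/ i = 1.
Proof.
case: (unliftP 0 i) => [j ->|->]; [right|by left].
by rewrite ord1; exact: val_inj.
Qed.

Lemma norm_lt v (e : R) : 0 < e -> (`|v| < e) = (`|px v| < e) && (`|py v| < e).
Proof.
move=> e0; apply/idP/andP => [ve|[v0 v1]].
  by split; apply: le_lt_trans ve; [exact: px_le_norm|exact: py_le_norm].
rewrite [ltLHS]/Num.Def.normr /= mx_normrE; apply: bigmax_lt => // -[i j] _ /=.
by rewrite (ord1 i); case: (ord2P j) => ->.
Qed.

Lemma norm_le_enorm v : `|v| <= enorm v.
Proof.
rewrite [leLHS]/Num.Def.normr /= mx_normrE; apply: bigmax_le; first exact: enorm_ge0.
move=> [i j] _ /=; rewrite (ord1 i); case: (ord2P j) => ->; [exact: px_le_enorm|exact: py_le_enorm].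
Qed.

Lemma enorm_le_norm v : enorm v <= 2 * `|v|.
Proof.
have := enorm_le_add v; have := px_le_norm v; have := py_le_norm v; lra.
Qed.

Lemma px_continuous : continuous px. Proof. exact: coord_continuous. Qed.
Lemma py_continuous : continuous py. Proof. exact: coord_continuous. Qed.

Lemma pt_cvg (T : Type) (F : set_system T) {FF : Filter F} (f g : T -> R) x y :
  f @ F --> x -> g @ F --> y -> (fun u => pt (f u) (g u)) @ F --> pt x y.
Proof.
move=> fx gy; apply/cvgrPdist_lt => e e0; near=> u.
rewrite norm_lt // !pE; apply/andP; split.
  by near: u; move/cvgrPdist_lt : fx; apply.
by near: u; move/cvgrPdist_lt : gy; apply.
Unshelve. all: by end_near. Qed.

Lemma curve_components (C : R -> V) t w :
  is_derive t 1 C w <->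
  is_derive t 1 (px \o C) (px w) /\ is_derive t 1 (py \o C) (py w).
Proof.
split=> [[dC Cw]|[[d0 e0] [d1 e1]]].
  have := (derivable_mxP _ _ _).1 dC => d; have E := derive_mx dC.
  by split; (apply: DeriveDef; [exact: d|rewrite -Cw E /px /py mxE]).
have dC : derivable C t 1.
  by apply/derivable_mxP => i j; rewrite (ord1 i); case: (ord2P j) => ->; [exact: d0|exact: d1].
apply: DeriveDef; first exact: dC.
rewrite (derive_mx dC); apply: plane_ext; rewrite /px /py mxE; [exact: e0|exact: e1].
Qed.

Lemma norm_pt_continuous (T : topologicalType) (f : T -> V) :
  continuous (px \o f) -> continuous (py \o f) -> continuous f.
Proof.
move=> f0 f1.
have -> : f = (fun u => pt ((px \o f) u) ((py \o f) u)).
  by apply/funext => z /=; rewrite pt_eta.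
by move=> u; apply: pt_cvg; [exact: f0|exact: f1].
Qed.

Lemma segment_derive v w t : is_derive t 1 (fun s : R => v + s *: w) w.
Proof.
have : is_derive t 1 (cst v + (fun s : R => s *: w)) (0 + 1 *: w).
  apply: is_deriveD; apply: is_diff_derive; exact: is_diff_scalel.
by rewrite add0r scale1r.
Qed.

Lemma mvt_plane (H : V -> R) (dx dy : V -> R) v w :
  (forall s, 0 <= s <= 1 -> is_diff (v + s *: (w - v)) H
      (fun u => px u * dx (v + s *: (w - v)) + py u * dy (v + s *: (w - v)))) ->
  exists s, 0 <= s <= 1 /\
   H w - H v = px (w - v) * dx (v + s *: (w - v)) + py (w - v) * dy (v + s *: (w - v)).
Proof.
move=> dH; set u := w - v.
pose f (s : R) := H (v + s *: u).
pose df (s : R) := px u * dx (v + s *: u) + py u * dy (v + s *: u).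
have fd (s : R) : s \in `[0, 1]%R -> is_derive s 1 f (df s).
  rewrite in_itv /= => s01.
  exact: (chain_curve (segment_derive v u s) (dH _ s01)).
have fo (s : R) : s \in `]0, 1[%R -> is_derive s 1 f (df s).
  by move=> s01; apply: fd; move: s01; rewrite !in_itv /= => /andP[/ltW-> /ltW->].
have fc : {within `[0, 1], continuous f}.
  by apply: derivable_within_continuous => s /fd [].
have [s s01] := MVT ltr01 fo fc.
have vu : v + u = w by rewrite /u addrC subrK.
rewrite /f /df scale1r scale0r addr0 subr0 mulr1 vu => ->.
by exists s; split => //; move: s01; rewrite in_itv /= => /andP[/ltW-> /ltW->].
Qed.

End Plane.

Arguments px {R}.
Arguments py {R}.

(** * Trapping curves in a box *)

Section OneSided.
Variable R : realType.
Implicit Types (f : R -> R) (a s d : R).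

Lemma closed_left f a s : a < s -> {for s, continuous f} ->
  (forall u, a <= u < s -> 0 <= f u) -> 0 <= f s.
Proof.
move=> as_ fc fp; rewrite leNgt; apply/negP => fs.
have /near_dist[d d0 dP] : \forall u \near s, f u < 0 by exact: (cvgr_lt _ fc).
pose u := Num.max a (s - d / 2).
have us : u < s by rewrite gt_max as_ /= ltrBlDr ltrDl divr_gt0.
have : f u < 0.
  apply: dP; rewrite distrC gtr0_norm ?subr_gt0 // /u.
  have : s - d / 2 <= Num.max a (s - d / 2) by rewrite le_max lexx orbT.
  move: (Num.max _ _) => m; lra.
by rewrite ltNge fp // us andbT le_max lexx.
Qed.

Lemma open_right f s : {for s, continuous f} -> 0 < f s ->
  exists2 d, 0 < d & forall u, s < u < s + d -> 0 < f u.
Proof.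
move=> fc fs.
have /near_dist[d d0 dP] : \forall u \near s, 0 < f u by exact: (cvgr_gt _ fc).
exists d => // u /andP[su ud]; apply: dP; rewrite gtr0_norm ?subr_gt0 // ltrBlDr addrC //.
Qed.

Lemma deriv_right f s d : is_derive s 1 f d -> 0 < d ->
  exists2 e, 0 < e & forall u, s < u < s + e -> f s < f u.
Proof.
move=> [df fd] d0.
have := df; rewrite /derivable => /cvg_ex[/= l Hl].
have El : l = d by rewrite -fd /derive; symmetry; apply: cvg_lim.
move: Hl; rewrite El => Hl.
have : \forall h \near 0^', 0 < h^-1 *: (f (h *: 1 + s) - f s).
  by move/cvgr_gt : Hl => /(_ 0 d0).
move=> /nbhs_ballP[e /= e0 eP]; exists e => // u /andP[su ue].
have hu : 0 < u - s by rewrite subr_gt0.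
have := eP (u - s); rewrite /ball /= sub0r normrN gtr0_norm // ltrBlDr addrC ue.
move=> /(_ isT); rewrite gt_eqF // => /(_ isT).
by rewrite /GRing.scale /= mulr1 subrK pmulr_rgt0 ?invr_gt0 // subr_gt0.
Qed.

(** The extension step of a barrier argument: where the constraint is active the derivative keeps
    it, elsewhere continuity does. *)
Lemma barrier_right f s d : 0 <= f s -> is_derive s 1 f d -> (f s = 0 -> 0 < d) ->
  exists2 e, 0 < e & forall u, s < u < s + e -> 0 <= f u.
Proof.
move=> fs0 fd fs; case: (eqVneq (f s) 0) => [f0|fn].
  have [e e0 eP] := deriv_right fd (fs f0).
  by exists e => // u /eP; rewrite f0 => /ltW.
have [|e e0 eP] := open_right (is_derive_cts fd).
  by rewrite lt_neqAle eq_sym fn.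
by exists e => // u /eP /ltW.
Qed.

Lemma is_derive_affine (f g : R -> R) (t a b c df dg : R) :
  is_derive t 1 f df -> is_derive t 1 g dg ->
  is_derive t 1 (fun u => a + b * f u + c * g u) (b * df + c * dg).
Proof.
move=> Hf Hg.
have H1 := is_deriveD (is_deriveD (is_derive_cst a t 1) (is_deriveZ b Hf)) (is_deriveZ c Hg).
by rewrite add0r in H1.
Qed.

Lemma nonvanishing_neg f (a b : R) : continuous f -> f a < 0 ->
  (forall u, a <= u <= b -> f u != 0) -> forall u, a <= u <= b -> f u < 0.
Proof.
move=> fc fa fn; apply: real_induction => //.
- move=> s /andP[as_ sb] H.
  have cN : {for s, continuous (fun u => - f u)} by apply: continuousN; exact: fc.
  have [|d d0 dP] := open_right cN; first by rewrite oppr_gt0 H // as_ lexx.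
  by exists d => // u /dP; rewrite oppr_gt0.
- move=> s /andP[as_ sb] H.
  have cN : {for s, continuous (fun u => - f u)} by apply: continuousN; exact: fc.
  rewrite lt_neqAle fn ?(ltW as_) //= -oppr_ge0.
  by apply: (closed_left as_ cN) => u /H; rewrite oppr_ge0 => /ltW.
Qed.

End OneSided.

Section Trap.
Variable R : realType.
Notation V := 'rV[R]_2.
(** [K v w] is to be read as: [w] lies on the given line at [v]. [K_top] and [K_bot] express that
    leftward curves approach the axis with slope above 1/4 near the corners of the right side,
    [G_disp] that [G] carries the strip of width [l] next to that side to the right, and [box_back]
    that points outside the box stay outside. *)
Variables (x0 t0 l : R) (G : V -> V) (DG : V -> 'M[R]_2) (K : V -> V -> Prop).

Definition box (v : V) := `|px v| <= x0 /\ `|py v| <= t0.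

Hypothesis l0 : 0 < l.
Hypothesis lx0 : l <= x0.
Hypothesis G_diff : forall v, is_diff v G (fun w => w *m DG v).
Hypothesis DG_cts : forall w : V, continuous (fun v => w *m DG v).
Hypothesis K_inv : forall v w, K v w -> K (G v) (w *m DG v).
Hypothesis K_flat : forall v w, box v -> K v w -> w != 0 -> `|py w| <= `|px w|.
Hypothesis K_top : forall v w, box v -> x0 - l <= px v -> t0 - l / 4 <= py v ->
  K v w -> px w < 0 -> py w < px w / 4.
Hypothesis K_bot : forall v w, box v -> x0 - l <= px v -> py v <= - (t0 - l / 4) ->
  K v w -> px w < 0 -> - (px w / 4) < py w.
Hypothesis G_disp : forall v, box v -> x0 - l <= px v ->
  [/\ px v + l / 4 <= px (G v), px (G v) <= px v + l & `|py (G v)| <= `|py v| + l / 16].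
Hypothesis box_back : forall v, box (G v) -> box v.
Hypothesis K_left : forall v w, box v -> K v w -> w != 0 -> 0 < px w * px (w *m DG v).

(** Tangency is demanded only at times [t >= 0] at which the curve is in the box. Solutions of a
    clamped differential equation, known to be tangent only there, qualify, and by [box_back] so do
    images under [G]. *)
Definition Ecurve (C C' : R -> V) :=
  [/\ forall t : R, is_derive t 1 C (C' t), continuous C' &
      forall t : R, 0 <= t -> box (C t) -> C' t != 0 /\ K (C t) (C' t)].

Lemma Ecurve_px_neq0 C C' t : Ecurve C C' -> 0 <= t -> box (C t) -> px (C' t) != 0.
Proof.
move=> [_ _ H] t_ge0 bC; have [C'0 KC] := H _ t_ge0 bC.
apply/eqP => p0; move/eqP: C'0; apply; apply: plane_ext; rewrite ?p0 ?px0 //.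
have := K_flat bC KC (H _ t_ge0 bC).1; rewrite p0 normr0 normr_le0 => /eqP ->.
by rewrite py0.
Qed.

Lemma Ecurve_image C C' : Ecurve C C' ->
  Ecurve (G \o C) (fun t => C' t *m DG (C t)).
Proof.
move=> [dC C'c CK]; split.
- move=> t; exact: (chain_curve (dC t) (G_diff (C t))).
- have Cc t : {for t, continuous C} by exact: is_derive_cts (dC t).
  have E t : C' t *m DG (C t) =
      px (C' t) *: (pt 1 0 *m DG (C t)) + py (C' t) *: (pt 0 1 *m DG (C t)).
    by apply: plane_ext; rewrite !(pE, px_mul, py_mul); ring.
  rewrite (_ : (fun t => _) = (fun t => px (C' t) *: (pt 1 0 *m DG (C t)) +
      py (C' t) *: (pt 0 1 *m DG (C t)))); last by apply/funext.
  move=> t; apply: cvgD; apply: cvgZ.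
  + exact: (continuous_comp (C'c t) (@px_continuous _ _)).
  + exact: (continuous_comp (Cc t) (@DG_cts _ _)).
  + exact: (continuous_comp (C'c t) (@py_continuous _ _)).
  + exact: (continuous_comp (Cc t) (@DG_cts _ _)).
- move=> t t_ge0 /= /box_back bC; have [C'0 KC] := CK _ t_ge0 bC; split; last exact: K_inv.
  apply/eqP => E; have := K_left bC KC C'0.
  by rewrite E px0 mulr0 ltxx.
Qed.

(** A trapezoid whose longer base is the right side of the box. Its slanted sides have slope 1/4,
    the bound in [K_top] and [K_bot], and lie in the strips where these apply. *)
Definition W0 (v : V) := [/\ x0 - l <= px v, px v <= x0 & `|py v| <= t0 - (x0 - px v) / 4].

Ltac slra := have ? := l0; have ? := lx0; lra.

Lemma W0_box v : W0 v -> box v.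
Proof.
move=> [a b c]; split; first by rewrite ler_norml; apply/andP; split; slra.
by apply: le_trans c _; slra.
Qed.

(* Inside W0 the curve can only leave through the left side, and before reaching it
   the point G (B s) crosses the line px = x0. *)
Lemma trap_step B B' (a b : R) : Ecurve B B' -> 0 <= a <= b ->
  px (B a) = x0 -> `|py (B a)| <= t0 -> px (B' a) < 0 -> ~ box (B b) ->
  exists s, [/\ a <= s <= b, px (G (B s)) = x0, `|py (G (B s))| <= t0, px (B' s) < 0 &
    forall u, a <= u <= s -> box (B u)].
Proof.
move=> EB /andP[a0 ab] Ba0 Ba1 B'a nb; have [dB B'c BK] := EB.
apply: contrapT => nex.
have dGB (t : R) : is_derive t 1 (G \o B) (B' t *m DG (B t)).
  exact: (chain_curve (dB t) (G_diff (B t))).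
have dx t := ((curve_components _ _ _).1 (dB t)).1.
have dy t := ((curve_components _ _ _).1 (dB t)).2.
have cx t := is_derive_cts (dx t).
have cy t := is_derive_cts (dy t).
have cg t := is_derive_cts ((curve_components _ _ _).1 (dGB t)).1.
have cB' : continuous (px \o B').
  by move=> t; exact: continuous_comp (B'c t) (@px_continuous _ _).
(* Under [nex] these conditions propagate up to time [b], against [nb]. Only the third could break,
   and a first time at which it does would be the time whose existence [nex] denies. *)
pose P s := [/\ W0 (B s), px (B' s) < 0 & x0 < px (G (B s))].
have dq1 (t : R) : is_derive t 1 (fun u => t0 - (x0 - px (B u)) / 4 - py (B u))
    (px (B' t) / 4 - py (B' t)).
  rewrite (_ : (fun u => _) = fun u => (t0 - x0 / 4) + 4^-1 * px (B u) + (-1) * py (B u)).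
    rewrite (_ : px (B' t) / 4 - py (B' t) = 4^-1 * px (B' t) + (-1) * py (B' t)); last by lra.
    exact: (is_derive_affine _ _ _ (dx t) (dy t)).
  by apply/funext => u; lra.
have dq2 (t : R) : is_derive t 1 (fun u => t0 - (x0 - px (B u)) / 4 + py (B u))
    (px (B' t) / 4 + py (B' t)).
  rewrite (_ : (fun u => _) = fun u => (t0 - x0 / 4) + 4^-1 * px (B u) + 1 * py (B u)).
    rewrite (_ : px (B' t) / 4 + py (B' t) = 4^-1 * px (B' t) + 1 * py (B' t)); last by lra.
    exact: (is_derive_affine _ _ _ (dx t) (dy t)).
  by apply/funext => u; lra.
have W0E v : W0 v <-> [/\ x0 - l <= px v, px v <= x0, 0 <= t0 - (x0 - px v) / 4 - py v
     & 0 <= t0 - (x0 - px v) / 4 + py v].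
  split=> [[w1 w2]|[w1 w2 w3 w4]]; first by rewrite ler_norml => /andP[? ?]; split => //; slra.
  by split => //; rewrite ler_norml; apply/andP; split; slra.
suff H : forall s, a <= s <= b -> P s.
  by apply: nb; apply: W0_box; case: (H b) => //; rewrite ab lexx.
apply: real_induction.
- have WB : W0 (B a) by split; rewrite Ba0; [slra|by []|rewrite subrr mul0r subr0].
  split => //; have [//|d1 _ _] := G_disp (W0_box WB); first by rewrite Ba0; slra.
  by apply: lt_le_trans d1; rewrite Ba0; slra.
- move=> s /andP[as_ sb] H.
  have [WB B's GBs] : P s by apply: H; rewrite as_ lexx.
  have bB := W0_box WB.
  have [w1 w2 w3 w4] := (W0E _).1 WB.
  have s0 : 0 <= s by exact: le_trans as_.
  have KB := (BK _ s0 bB).2.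
  have [_ d2 _] := G_disp bB w1.
  (* The left side of [W0] has not been reached: there [G_disp] would give [px (G (B s)) <= x0]. *)
  have [e1 e1_0 P1] : exists2 e, 0 < e & forall u, s < u < s + e -> 0 < px (B u) - (x0 - l).
    apply: (@open_right _ (fun u => px (B u) - (x0 - l))); last by slra.
    by apply: continuousB; [exact: cx|exact: cst_continuous].
  have [e2 e2_0 P2] : exists2 e, 0 < e & forall u, s < u < s + e -> - px (B s) < - px (B u).
    apply: (@deriv_right _ (fun u => - px (B u)) s (- px (B' s))); last by slra.
  have [e3 e3_0 P3] : exists2 e, 0 < e & forall u, s < u < s + e ->
      0 <= t0 - (x0 - px (B u)) / 4 - py (B u).
    apply: (@barrier_right _ (fun u => t0 - (x0 - px (B u)) / 4 - py (B u)) s _ w3 (dq1 s)) => E.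
    suff : py (B' s) < px (B' s) / 4 by lra.
    by apply: (K_top bB) => //; slra.
  have [e4 e4_0 P4] : exists2 e, 0 < e & forall u, s < u < s + e ->
      0 <= t0 - (x0 - px (B u)) / 4 + py (B u).
    apply: (@barrier_right _ (fun u => t0 - (x0 - px (B u)) / 4 + py (B u)) s _ w4 (dq2 s)) => E.
    suff : - (px (B' s) / 4) < py (B' s) by lra.
    by apply: (K_bot bB) => //; slra.
  have [e5 e5_0 P5] : exists2 e, 0 < e & forall u, s < u < s + e -> 0 < - px (B' u).
    apply: (@open_right _ (fun u => - px (B' u))); last by slra.
    by apply: continuousN; exact: cB'.
  have [e6 e6_0 P6] : exists2 e, 0 < e & forall u, s < u < s + e -> 0 < px (G (B u)) - x0.
    apply: (@open_right _ (fun u => px (G (B u)) - x0)); last by slra.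
    by apply: continuousB; [exact: cg|exact: cst_continuous].
  exists (Num.min (Num.min (Num.min e1 e2) (Num.min e3 e4)) (Num.min e5 e6)).
    by rewrite !lt_min e1_0 e2_0 e3_0 e4_0 e5_0 e6_0.
  move=> u /andP[su]; rewrite -ltrBlDl !lt_min !ltrBlDl.
  move=> /andP[/andP[/andP[u1 u2] /andP[u3 u4]] /andP[u5 u6]].
  split; [apply/W0E; split| |].
  + by have := P1 u; rewrite su u1 => /(_ isT); slra.
  + by have := P2 u; rewrite su u2 => /(_ isT); slra.
  + by apply: P3; rewrite su u3.
  + by apply: P4; rewrite su u4.
  + by have := P5 u; rewrite su u5 => /(_ isT); slra.
  + by have := P6 u; rewrite su u6 => /(_ isT); slra.
- move=> s /andP[as_ sb] H.
  have WB : W0 (B s).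
    apply/W0E; split.
    + rewrite -subr_ge0; apply: (@closed_left _ (fun u => px (B u) - (x0 - l)) a) => //.
        by apply: continuousB; [exact: cx|exact: cst_continuous].
      by move=> u /H[/W0E[? ? ? ?] _ _]; slra.
    + rewrite -subr_ge0; apply: (@closed_left _ (fun u => x0 - px (B u)) a) => //.
        by apply: continuousB; [exact: cst_continuous|exact: cx].
      by move=> u /H[/W0E[? ? ? ?] _ _]; slra.
    + apply: (closed_left as_ (is_derive_cts (dq1 s))).
      by move=> u /H[/W0E[? ? ? ?] _ _].
    + apply: (closed_left as_ (is_derive_cts (dq2 s))).
      by move=> u /H[/W0E[? ? ? ?] _ _].
  have bB := W0_box WB.
  have s0 : 0 <= s by apply: le_trans a0 (ltW as_).
  have B's : px (B' s) < 0.
    rewrite lt_neqAle (Ecurve_px_neq0 EB) //= -oppr_ge0.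
    apply: (@closed_left _ (fun u => - px (B' u)) a) => //.
      by apply: continuousN; exact: cB'.
    by move=> u /H[_ ? _]; slra.
  split => //; rewrite lt_neqAle; apply/andP; split; last first.
    rewrite -subr_ge0; apply: (@closed_left _ (fun u => px (G (B u)) - x0) a) => //.
      by apply: continuousB; [exact: cg|exact: cst_continuous].
    by move=> u /H[_ _ ?]; slra.
  apply/eqP => E; apply: nex; exists s; have [w1 w2 w3] := WB.
  have [d1 d2 d3] := G_disp bB w1.
  split => //; first by rewrite (ltW as_).
    (* Since [G] moves [B s] to the right by at least [l / 4], the point [B s] has abscissa at most
       [x0 - l / 4], hence height at most [t0 - l / 16] in [W0]. This pays for the vertical
       displacement [l / 16]. *)
    by apply: le_trans d3 _; slra.
  move=> u /andP[au us]; have [us'|su] := ltP u s.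
    by apply: W0_box; case: (H u) => //; rewrite au.
  by have -> : u = s by apply/eqP; rewrite eq_le us su.
Qed.

Lemma box_back_iter v j n : (j <= n)%N -> box (iter n G v) -> box (iter j G v).
Proof.
move=> /subnK <-; elim: (n - j)%N => [|k IH] // /box_back; exact: IH.
Qed.

(* [t_ n] is the time at which the n-th image of the curve is on the right side of the box; the
   next one is given by [trap_step]. *)
Lemma trap_limit C C' (b : R) : Ecurve C C' -> 0 <= b ->
  px (C 0) = x0 -> `|py (C 0)| <= t0 -> px (C' 0) < 0 -> ~ box (C b) ->
  exists (T : R) (t_ : nat -> R),
    [/\ 0 <= T <= b, forall u, 0 <= u <= T -> box (C u) /\ px (C' u) < 0,
        t_ @ \oo --> T & forall n j, (j <= n)%N -> box (iter j G (C (t_ n)))].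
Proof.
move=> EC b0 C0 C1 C'0 nb.
(* The state consists of a time and the velocity of the n-th image curve; the velocity is carried
   along because the next step needs to know that this image runs to the left. *)
pose St n (x : R * (R -> V)) :=
  [/\ Ecurve (iter n G \o C) x.2, 0 <= x.1 <= b, px (iter n G (C x.1)) = x0,
      `|py (iter n G (C x.1))| <= t0 & px (x.2 x.1) < 0].
have step n x : exists y, St n x -> [/\ St n.+1 y, x.1 <= y.1 &
    forall u, x.1 <= u <= y.1 -> box (iter n G (C u))].
  have [[Ex /andP[x_0 xb] xx xy xn]|nS] := pselect (St n x); last by exists x.
  have nbn : ~ box (iter n G (C b)) by move=> /(box_back_iter (leq0n n)).
  have [|s [/andP[xs sb] s1 s2 s3 s4]] := trap_step Ex _ xx xy xn nbn; first by rewrite x_0.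
  exists (s, fun t => x.2 t *m DG (iter n G (C t))) => _; split => //.
  split => //; [exact: Ecurve_image Ex|by rewrite /= sb (le_trans x_0)|].
  have s0 : 0 <= s by exact: le_trans xs.
  have bs : box (iter n G (C s)) by apply: s4; rewrite xs lexx.
  have [_ _ /(_ s s0 bs)[n0 KB]] := Ex.
  by have := K_left bs KB n0; rewrite nmulr_rgt0.
have /choice[f Hf] : forall nx : nat * (R * (R -> V)), exists y,
    St nx.1 nx.2 -> [/\ St nx.1.+1 y, nx.2.1 <= y.1 &
    forall u, nx.2.1 <= u <= y.1 -> box (iter nx.1 G (C u))].
  by move=> [n x]; exact: step.
pose fix X n := if n is k.+1 then f (k, X k) else (0, C').
have SX n : St n (X n).
  elim: n => [|n IH]; first by split => //=; rewrite lexx.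
  by have [] := Hf (n, X n) IH.
pose t_ n := (X n).1.
have t_S n : t_ n <= t_ n.+1 by have [] := Hf (n, X n) (SX n).
have t_box n u : t_ n <= u <= t_ n.+1 -> box (C u).
  by have [_ _ H] := Hf (n, X n) (SX n); move=> /H /(box_back_iter (leq0n n)).
have t_b n : 0 <= t_ n <= b by have [] := SX n.
have t_nd : nondecreasing_seq t_ by apply/nondecreasing_seqP.
have t_cv : cvgn t_.
  apply: nondecreasing_is_cvgn => //; exists b => _ [n _ <-].
  by have /andP[] := t_b n.
pose T := limn t_.
have t_T n : t_ n <= T by exact: nondecreasing_cvgn_le.
have Tb : T <= b by apply: limr_le => //; near=> n; have /andP[] := t_b n.
have T0 : 0 <= T by apply: le_trans (t_T 0%N); have /andP[] := t_b 0%N.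
(* A time [u < T] lies between two consecutive [t_ n], where the n-th image is in the box;
   [box_back] brings this down to the curve itself. *)
have box_lt u : 0 <= u < T -> box (C u).
  move=> /andP[u0 uT].
  have [n un] : exists n, u < t_ n.
    apply: contrapT => nex; suff : T <= u by rewrite leNgt uT.
    by apply: limr_le => //; near=> n; rewrite leNgt; apply/negP => h; apply: nex; exists n.
  elim: n un => [|n IH] un; first by move: un; rewrite /t_ /= ltNge u0.
  have [/IH //|tu] := ltP u (t_ n).
  by apply: (t_box n); rewrite tu ltW.
have [dC C'c CK] := EC.
have cx (t : R) : {for t, continuous (px \o C)} by exact: is_derive_cts ((curve_components _ _ _).1 (dC t)).1.
have cy (t : R) : {for t, continuous (py \o C)} by exact: is_derive_cts ((curve_components _ _ _).1 (dC t)).2.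
have boxT u : 0 <= u <= T -> box (C u).
  move=> /andP[u0 uT]; have [uT'|Tu] := ltP u T; first by apply: box_lt; rewrite u0.
  have {Tu uT} -> : u = T by apply/eqP; rewrite eq_le uT Tu.
  have [T00|Tn0] := eqVneq T 0.
    by apply: (t_box 0%N); rewrite T00 /t_ /= lexx -/(t_ 1%N) //; have /andP[] := t_b 1%N.
  have T_pos : 0 < T by rewrite lt_neqAle eq_sym Tn0.
  split; rewrite ler_norml; apply/andP; split; rewrite -subr_ge0 ?opprK.
  - rewrite addrC; apply: (@closed_left _ (fun u => x0 + px (C u)) 0) => //.
      by apply: continuousD; [exact: cst_continuous|exact: cx].
    by move=> v /box_lt[]; rewrite ler_norml => /andP[? ?] _; lra.
  - apply: (@closed_left _ (fun u => x0 - px (C u)) 0) => //.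
      by apply: continuousB; [exact: cst_continuous|exact: cx].
    by move=> v /box_lt[]; rewrite ler_norml => /andP[? ?] _; lra.
  - rewrite addrC; apply: (@closed_left _ (fun u => t0 + py (C u)) 0) => //.
      by apply: continuousD; [exact: cst_continuous|exact: cy].
    by move=> v /box_lt[_]; rewrite ler_norml => /andP[? ?]; lra.
  - apply: (@closed_left _ (fun u => t0 - py (C u)) 0) => //.
      by apply: continuousB; [exact: cst_continuous|exact: cy].
    by move=> v /box_lt[_]; rewrite ler_norml => /andP[? ?]; lra.
exists T, t_; split; rewrite ?T0 //.
- move=> u uT; split; first exact: boxT.
  apply: (@nonvanishing_neg _ (px \o C') 0 T) => //.
    by move=> t; exact: (continuous_comp (C'c t) (@px_continuous _ _)).
  by move=> v vT; apply: (Ecurve_px_neq0 EC); [case/andP: vT|exact: boxT].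
- move=> n j jn; apply: (box_back_iter jn).
  have [_ _ e1 e2 _] := SX n; split => //.
  rewrite -/(t_ n) /t_ e1 ger0_norm //; slra.
Unshelve. all: by end_near. Qed.

Variables (nrm : V -> R) (th B : R).
Hypothesis nrm_ge : forall v, `|v| <= nrm v.
Hypothesis nrm_box : forall v w, box v -> box w -> nrm (v - w) <= B.
Hypothesis th1 : 1 < th.
Hypothesis G_exp : forall v w, box v -> box w -> th * nrm (v - w) <= nrm (G v - G w).

Lemma iter_exp n v w : (forall j, (j <= n)%N -> box (iter j G v)) ->
  (forall j, (j <= n)%N -> box (iter j G w)) -> th ^+ n * nrm (v - w) <= B.
Proof.
move=> bv bw; have : th ^+ n * nrm (v - w) <= nrm (iter n G v - iter n G w).
  elim: n bv bw => [|n IH] bv bw; first by rewrite expr0 mul1r.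
  rewrite exprS -mulrA; apply: le_trans (G_exp (bv n (leqnSn n)) (bw n (leqnSn n))).
  rewrite ler_wpM2l ?(le_trans ler01 (ltW th1)) //.
  by apply: IH => j jn; [apply: bv|apply: bw]; exact: leqW.
by move=> /le_trans; apply; exact: nrm_box (bv n _) (bw n _).
Qed.

(** The points [C1 (t_ n)] and [C2 (s_ n)] have their first [n] iterates in the box, so by expansion
    their distance is at most [B / th ^+ n]. *)
Lemma trap_merge C1 C1' C2 C2' b1 b2 :
  Ecurve C1 C1' -> 0 <= b1 -> px (C1 0) = x0 -> `|py (C1 0)| <= t0 -> px (C1' 0) < 0 ->
  ~ box (C1 b1) ->
  Ecurve C2 C2' -> 0 <= b2 -> px (C2 0) = x0 -> `|py (C2 0)| <= t0 -> px (C2' 0) < 0 ->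
  ~ box (C2 b2) ->
  exists T1 T2, [/\ 0 <= T1, 0 <= T2,
    forall u, 0 <= u <= T1 -> box (C1 u) /\ px (C1' u) < 0,
    forall u, 0 <= u <= T2 -> box (C2 u) /\ px (C2' u) < 0 & C1 T1 = C2 T2].
Proof.
move=> E1 b10 c1 c2 c3 c4 E2 b20 d1 d2 d3 d4.
have [T1 [t_ [/andP[T10 _] H1 cv1 I1]]] := trap_limit E1 b10 c1 c2 c3 c4.
have [T2 [s_ [/andP[T20 _] H2 cv2 I2]]] := trap_limit E2 b20 d1 d2 d3 d4.
exists T1, T2; split => //.
have cC1 : C1 (t_ n) @[n --> \oo] --> C1 T1.
  by apply: continuous_cvg => //; case: E1 => H _ _; exact: is_derive_cts (H T1).
have cC2 : C2 (s_ n) @[n --> \oo] --> C2 T2.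
  by apply: continuous_cvg => //; case: E2 => H _ _; exact: is_derive_cts (H T2).
have cD : C1 (t_ n) - C2 (s_ n) @[n --> \oo] --> C1 T1 - C2 T2 by exact: cvgB.
suff cD0 : C1 (t_ n) - C2 (s_ n) @[n --> \oo] --> (0 : V).
  apply/eqP; rewrite -subr_eq0; apply/eqP.
  apply: (norm_cvg_unique cD); exact: cD0.
have th0 : 0 < th by exact: lt_trans ltr01 th1.
have geo : B * th^-1 ^+ n @[n --> \oo] --> 0.
  rewrite -[0](mulr0 B); apply: cvgM; first exact: cvg_cst.
  by apply: cvg_expr; rewrite gtr0_norm ?invr_gt0 // invf_lt1.
apply/norm_cvg0P; apply: (squeeze_cvgr _ (@cvg_cst _ 0 _ _ _) geo).
near=> n; rewrite normr_ge0 /=; apply: le_trans (nrm_ge _) _.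
rewrite exprVn ler_pdivlMr ?exprn_gt0 // mulrC; apply: iter_exp => j; [exact: I1|exact: I2].
Unshelve. all: by end_near. Qed.

End Trap.

(** * Lifts to the plane *)

Section NearDiff.
Variable R : realType.
Variables V W : normedModType R.

Lemma near0_is_diff (k : V -> W) (x : V) :
  (\forall y \near x, k y = 0) -> is_diff x k 0.
Proof.
move=> k0; have kx : k x = 0 by exact: nbhs_singleton k0.
have H : continuous (0 : V -> W) /\
    k \o shift x = cst (k x) + (0 : V -> W) +o_ 0 id.
  split; first exact: cst_continuous.
  apply/eqaddoP => e e0.
  have : \forall h \near (0 : V), k (h + x) = 0.
    have sc : (fun h : V => h + x) @ (0 : V) --> x.
      rewrite -[X in _ --> X]add0r; apply: cvgD; [exact: cvg_id|exact: cvg_cst].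
    exact: sc k0.
  apply: filterS => h kh /=.
  by rewrite !fctE /= kh kx addr0 subrr normr0 mulr_ge0 // ltW.
have dk : 'd k x = 0 :> (V -> W) by apply: diff_unique; case: H.
apply: DiffDef => //; apply/diff_locallyP; rewrite dk; exact: H.
Qed.

Lemma near_is_diff (f g L : V -> W) (x : V) :
  (\forall y \near x, f y = g y) -> is_diff x f L -> is_diff x g L.
Proof.
move=> fg fL.
have k0 : is_diff x (g - f) 0.
  by apply: near0_is_diff; apply: filterS fg => y E; have : g y - f y = 0 by rewrite E subrr.
have := is_diffD fL k0; rewrite addr0 (_ : f + (g - f) = g) //.
by apply/funext => y; rewrite !fctE /= addrC subrK.
Qed.

End NearDiff.

Section TorusBasics.
Variable R : realType.
Notation V := 'rV[R]_2.
Notation T := (torus R).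
Implicit Types (v w : V) (p q : T).

Definition lattice v := (px v \is a Num.int) && (py v \is a Num.int).

Lemma tproj_eq v w : tproj v = tproj w <-> lattice (v - w).
Proof.
rewrite /tproj; split=> [/eqquotP H|/andP[H0 H1]].
  have /forallP {}H : torus_rel_op v w by exact: H.
  by apply/andP; rewrite pxB pyB; split; [exact: (H 0)|exact: (H 1)].
apply/eqquotP; suff : torus_rel_op v w by [].
apply/forallP => i; move: H0 H1; rewrite pxB pyB => H0 H1.
by case: (ord2P i) => ->.
Qed.

Lemma lattice_add v w : lattice v -> lattice w -> lattice (v + w).
Proof. by rewrite /lattice !pE => /andP[a b] /andP[c d]; rewrite !rpredD. Qed.

Lemma lattice_opp v : lattice v -> lattice (- v).
Proof. by rewrite /lattice !pE => /andP[a b]; rewrite !rpredN a. Qed.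

Lemma lattice_sub v w : lattice v -> lattice w -> lattice (v - w).
Proof. by move=> a b; apply: lattice_add => //; exact: lattice_opp. Qed.

Lemma tproj_add v k : lattice k -> tproj (v + k) = tproj v.
Proof. by move=> Hk; apply/tproj_eq; rewrite addrC addKr. Qed.

Lemma int_small (x : R) : x \is a Num.int -> `|x| < 1 -> x = 0.
Proof.
move=> /intrP[m ->]; rewrite -intr_norm -[1]/(1%:~R) ltr_int => H.
by have -> : m = 0 by move: H; lia.
Qed.

Lemma lattice_small v : lattice v -> `|v| < 1 -> v = 0.
Proof.
move=> /andP[a b]; rewrite norm_lt // => /andP[c d].
by apply: plane_ext; rewrite ?px0 ?py0; exact: int_small.
Qed.

Lemma tproj_inj_small v w : tproj v = tproj w -> `|v - w| < 1 -> v = w.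
Proof. by move=> /tproj_eq L /(lattice_small L) /subr0_eq. Qed.

Lemma tproj_surj p : exists v, tproj v = p.
Proof. by exists (repr p); rewrite /tproj reprK. Qed.

Lemma tproj_continuous : continuous (@tproj R).
Proof. exact: (@pi_continuous V _). Qed.

Lemma torus_continuous (Z : topologicalType) (f : T -> Z) :
  continuous (f \o @tproj R) -> continuous f.
Proof. by move=> H; apply/(@quotient_continuous V _). Qed.

Let tdset p q := [set d : R | exists x y, [/\ tproj x = p, tproj y = q & d = enorm (x - y)]].

Let tdset_has_inf p q : has_inf (tdset p q).
Proof.
split; last by exists 0 => d [x [y [_ _ ->]]]; exact: enorm_ge0.
have [v vp] := tproj_surj p; have [w wq] := tproj_surj q.
by exists (enorm (v - w)), v, w.
Qed.

Lemma tdist_le v w : tdist (tproj v) (tproj w) <= enorm (v - w).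
Proof. by apply: ge_inf; [case: (tdset_has_inf (tproj v) (tproj w))|exists v, w]. Qed.

Lemma tdist_lt p q (e : R) : tdist p q < e ->
  exists v w, [/\ tproj v = p, tproj w = q & enorm (v - w) < e].
Proof.
rewrite -subr_gt0 => /inf_adherent /(_ (tdset_has_inf p q))[d [v [w [vp wq ->]]]].
have -> : inf (tdset p q) = tdist p q by [].
by rewrite [X in _ < X]addrC subrK => H; exists v, w.
Qed.

Lemma tdist_lt_at v q (e : R) : tdist (tproj v) q < e ->
  exists2 w, tproj w = q & enorm (v - w) < e.
Proof.
move=> /tdist_lt[v' [w [vv wq H]]]; have /tproj_eq L : tproj v = tproj v' by [].
exists (w + (v - v')); first by rewrite tproj_add.
by congr (_ < _): H; congr enorm; apply: plane_ext; rewrite !pE; ring.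
Qed.

Lemma tdist_ge0 p q : 0 <= tdist p q.
Proof.
apply: lb_le_inf; first by case: (tdset_has_inf p q).
by move=> d [x [y [_ _ ->]]]; exact: enorm_ge0.
Qed.

Lemma tdistxx p : tdist p p = 0.
Proof.
apply/eqP; rewrite eq_le tdist_ge0 andbT; have [v <-] := tproj_surj p.
by apply: le_trans (tdist_le _ _) _; rewrite subrr enorm0.
Qed.

Lemma tdist_triangle p q r : tdist p r <= tdist p q + tdist q r.
Proof.
apply/ler_addgt0Pr => e e0.
have [v vp] := tproj_surj p.
have : tdist (tproj v) q < tdist p q + e / 2 by rewrite vp ltrDl divr_gt0.
move=> /tdist_lt_at[w wq H1].
have : tdist (tproj w) r < tdist q r + e / 2 by rewrite wq ltrDl divr_gt0.
move=> /tdist_lt_at[z zr H2].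
rewrite -vp -zr; apply: le_trans (tdist_le _ _) _.
have -> : v - z = (v - w) + (w - z) by rewrite addrA subrK.
by apply: le_trans (enorm_triangle _ _) _; rewrite vp zr; lra.
Qed.

(** Connectedness of the line, for a predicate that is locally constant; negative times follow by
    reflection. *)
Lemma local_to_global (P : R -> Prop) :
  (forall t : R, exists2 d, 0 < d &
     forall u u', `|u - t| < d -> `|u' - t| < d -> P u -> P u') ->
  P 0 -> forall t, P t.
Proof.
have H (Q : R -> Prop) : (forall t : R, exists2 d, 0 < d &
     forall u u', `|u - t| < d -> `|u' - t| < d -> Q u -> Q u') ->
  Q 0 -> forall t, 0 <= t -> Q t.
  move=> Hl Q0 t t0; apply: (@real_induction _ Q 0 t) => //; last by rewrite t0 lexx.
  - move=> s /andP[s0 st] /(_ s); rewrite s0 lexx => /(_ isT) Qs.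
    have [d d0 dP] := Hl s; exists d => // u /andP[su us].
    by apply: (dP s u) => //; [rewrite subrr normr0|rewrite gtr0_norm ?subr_gt0 // ltrBlDl].
  - move=> s /andP[s0 st] HQ; have [d d0 dP] := Hl s.
    pose u := Num.max 0 (s - d / 2).
    have us : u < s by rewrite gt_max s0 /= ltrBlDr ltrDl divr_gt0.
    apply: (dP u s); rewrite ?subrr ?normr0 //; last by apply: HQ; rewrite us andbT le_max lexx.
    rewrite distrC gtr0_norm ?subr_gt0 //.
    have : s - d / 2 <= u by rewrite le_max lexx orbT.
    lra.
move=> Hl P0 t; have [t0|t0] := leP 0 t; first exact: H.
rewrite -[t]opprK; apply: (H (fun u => P (- u))); rewrite ?oppr0 ?oppr_ge0 ?(ltW t0) //.
move=> s; have [d d0 dP] := Hl (- s); exists d => // u u' H1 H2.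
by apply: dP; rewrite opprK -normrN opprD !opprK.
Qed.

(** The difference of two lifts is continuous with values in the lattice, hence locally constant. *)
Lemma lift_unique (C1 C2 : R -> V) : continuous C1 -> continuous C2 ->
  (forall t, tproj (C1 t) = tproj (C2 t)) -> C1 0 = C2 0 -> forall t, C1 t = C2 t.
Proof.
move=> c1 c2 E; apply: local_to_global => t.
have cD : (fun u => C1 u - C2 u) @ t --> C1 t - C2 t by apply: cvgB; [exact: c1|exact: c2].
have /near_dist[d d0 dP] : \forall u \near t, `|(C1 t - C2 t) - (C1 u - C2 u)| < 1 / 2.
  by move/cvgrPdist_lt : cD; apply; rewrite divr_gt0.
exists d => // u u' /dP Hu /dP Hu' Eu; apply: (tproj_inj_small (E u')).
move: Hu Hu'; rewrite Eu subrr subr0; set a := C1 t - C2 t; set b := C1 u' - C2 u' => Ha Hb.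
have -> : b = a - (a - b) by rewrite subKr.
by apply: le_lt_trans (ler_normB _ _) _; rewrite [1]splitr ltrD.
Qed.

(** The lift is obtained by integrating the velocity instead of gluing local lifts. On a short
    interval it differs from a local lift by a constant, so that lying over [c] at one time implies
    it at all times nearby. *)
Lemma path_lift (c : R -> T) (c' : R -> V) (v0 : V) :
  C1_with_diff c (fun t s => s *: c' t) -> tproj v0 = c 0 ->
  exists C : R -> V, [/\ C 0 = v0, forall t, tproj (C t) = c t &
    forall t : R, is_derive t 1 C (c' t)].
Proof.
move=> [Hl Hc] v0c.
have c'c : continuous c'.
  by have := Hc 1; under eq_fun do rewrite scale1r.
have [X [X0 HX]] : exists F : R -> R, F 0 = 0 /\ forall t : R, is_derive t 1 F (px (c' t)).
  apply: (@antiderivative _ (px \o c')) => t; apply: continuous_comp; [exact: c'c|exact: px_continuous].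
have [Y [Y0 HY]] : exists F : R -> R, F 0 = 0 /\ forall t : R, is_derive t 1 F (py (c' t)).
  apply: (@antiderivative _ (py \o c')) => t; apply: continuous_comp; [exact: c'c|exact: py_continuous].
pose C t := v0 + pt (X t) (Y t).
have dC (t : R) : is_derive t 1 C (c' t).
  apply/curve_components; split.
    rewrite (_ : px \o C = fun u => px v0 + 1 * X u + 0 * Y u); last first.
      by apply/funext => u; rewrite /= !pE; ring.
    rewrite (_ : px (c' t) = 1 * px (c' t) + 0 * py (c' t)); last by ring.
    exact: is_derive_affine.
  rewrite (_ : py \o C = fun u => py v0 + 0 * X u + 1 * Y u); last first.
    by apply/funext => u; rewrite /= !pE; ring.
  rewrite (_ : py (c' t) = 0 * px (c' t) + 1 * py (c' t)); last by ring.
  exact: is_derive_affine.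
have C0 : C 0 = v0 by apply: plane_ext; rewrite !pE ?X0 ?Y0 addr0.
exists C; split=> //; apply: local_to_global; last by rewrite C0.
move=> t; have [H /near_dist[d d0 dP]] := Hl t; exists d => // u u' Hu Hu' Eu.
have dD (s : R) : t - d < s < t + d -> is_derive s 1 (H - C) 0.
  rewrite -ltr_distl => /dP[_ /is_diff_derive]; rewrite scale1r => dH.
  by have := is_deriveB dH (dC s); rewrite subrr.
have cst : forall s s', t - d < s < t + d -> t - d < s' < t + d -> H s - C s = H s' - C s'.
  move=> s s' Hs Hs'; apply: plane_ext.
    apply: (@is_derive_cst0 _ (px \o (H - C)) (t - d) (t + d)) => // r Hr.
    by have /curve_components[+ _] := dD r Hr; rewrite px0.
  apply: (@is_derive_cst0 _ (py \o (H - C)) (t - d) (t + d)) => // r Hr.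
  by have /curve_components[_] := dD r Hr; rewrite py0.
have := cst u u'; rewrite -!ltr_distl => /(_ Hu Hu') E.
have [Pu _] := dP _ Hu; have [Pu' _] := dP _ Hu'.
have L : lattice (H u - C u) by apply/tproj_eq; rewrite Pu Eu.
by rewrite -Pu'; apply/esym/tproj_eq; rewrite -E.
Qed.

(** This makes a lift chosen point by point differentiable. Near [v] it differs from a local C^1
    lift [H] by lattice vectors; the variations of [H] and [F] and the two distances from [G] to [F]
    are each below 1/4, so that the lattice vector cannot change. *)
Lemma map_lift (h : T -> T) (D : T -> 'M[R]_2) (F G : V -> V) :
  torus_C1_with_diff h D -> continuous F ->
  (forall v, tproj (G v) = h (tproj v)) -> (forall v, `|G v - F v| < 1 / 4) ->
  forall v, is_diff v G (fun w => w *m D (tproj v)).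
Proof.
move=> [Hl _] Fc Gh GF v; have [H Hv] := Hl v.
have [_ dH] := nbhs_singleton Hv.
have Hc : {for v, continuous H} by exact: differentiable_continuous.
have L w : tproj (H w) = h (tproj w) -> lattice (H w - G w).
  by move=> E; apply/tproj_eq; rewrite E Gh.
set k := H v - G v; have Lk : lattice k by apply: L; exact: (nbhs_singleton Hv).1.
suff E : \forall w \near v, H w - k = G w.
  apply: near_is_diff E _; have := is_diffB dH (is_diff_cst k v).
  by rewrite subr0.
have n1 : \forall w \near v, `|H v - H w| < 1 / 4.
  by move/cvgrPdist_lt : Hc; apply; rewrite divr_gt0.
have n2 : \forall w \near v, `|F v - F w| < 1 / 4.
  by move/cvgrPdist_lt : (Fc v); apply; rewrite divr_gt0.
near=> w.
have Hw : tproj (H w) = h (tproj w) by apply: (near Hv w _).1.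
have H1 : `|H v - H w| < 1 / 4 by near: w.
have H2 : `|F v - F w| < 1 / 4 by near: w.
suff : H w - G w - k = 0 by move/subr0_eq => <-; rewrite subKr.
apply: lattice_small; first by apply: lattice_sub => //; exact: L.
have -> : H w - G w - k = - (H v - H w) + (F v - F w) + (G v - F v) - (G w - F w).
  by apply: plane_ext; rewrite !pE; ring.
have := GF v; have := GF w; set a := G w - F w; set b := G v - F v => Ha Hb.
move: H1 H2; set c := H v - H w; set d := F v - F w => Hc' Hd.
apply: le_lt_trans (ler_normB _ _) _; apply: le_lt_trans (_ : `|c| + `|d| + `|b| + `|a| < 1).
  rewrite lerD2r; apply: le_trans (ler_normD _ _) _; rewrite lerD2r.
  by apply: le_trans (ler_normD _ _) _; rewrite normrN.
lra.
Unshelve. all: by end_near. Qed.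

End TorusBasics.

(** * Perturbations of the identity of the line *)

Section Trig.
Variable R : realType.
Implicit Types x y A om : R.

Lemma mvt_all (f df : R -> R) x y : (forall t : R, is_derive t 1 f (df t)) -> x < y ->
  exists c, x < c < y /\ f y - f x = df c * (y - x).
Proof.
move=> fd xy.
have fc : {within `[x, y], continuous f}.
  by apply: derivable_within_continuous => t _; case: (fd t).
have [c cxy E] := MVT xy (fun t _ => fd t) fc.
by exists c; split => //; move: cxy; rewrite in_itv.
Qed.

Lemma lip_of_derive (f df : R -> R) (k x y : R) :
  (forall t : R, is_derive t 1 f (df t)) -> (forall t, `|df t| <= k) ->
  `|f x - f y| <= k * `|x - y|.
Proof.
move=> fd dk; wlog xy : x y / x < y => [H|].
  have [xy|yx|->] := ltgtP x y; first exact: H.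
    by rewrite distrC [in leRHS]distrC; exact: H.
  by rewrite !subrr normr0 mulr0.
have [c [_ E]] := mvt_all fd xy.
by rewrite distrC [in leRHS]distrC E normrM ler_wpM2r.
Qed.

Lemma sin_lip x y : `|sin x - sin y| <= `|x - y|.
Proof.
rewrite -[leRHS]mul1r; apply: (@lip_of_derive sin cos) => t; exact: cos_max.
Qed.

Lemma cos_lip x y : `|cos x - cos y| <= `|x - y|.
Proof.
rewrite -[leRHS]mul1r; apply: (@lip_of_derive cos (fun t => - sin t)) => t.
by rewrite normrN; exact: sin_max.
Qed.

Lemma sin_norm_le x : `|sin x| <= `|x|.
Proof. by have := sin_lip x 0; rewrite sin0 !subr0. Qed.

Lemma cos_lower x : 1 - x ^+ 2 <= cos x.
Proof.
have -> : x = (x / 2) *+ 2 by rewrite -mulr_natr divfK.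
rewrite cos_mulr2n cos2sin2; have := sin_norm_le (x / 2).
rewrite -(@ler_pXn2r _ 2) ?nnegrE // !real_normK ?num_real // => H.
rewrite -[_ *+ 2 in leLHS]mulr_natr; nra.
Qed.

Lemma sin_sub_id x : `|sin x - x| <= `|x| ^+ 3.
Proof.
have d (t : R) : is_derive t 1 (fun u => sin u - u) (cos t - 1).
  exact: (is_deriveB (is_derive_sin t) (is_derive_id t 1)).
have [->|x0] := eqVneq x 0; first by rewrite sin0 subrr normr0 expr0n.
have [c [cx E]] : exists c, `|c| <= `|x| /\ sin x - x = (cos c - 1) * x.
  have [xp|xn] := ltP 0 x.
    have [c [/andP[c0 cx] E]] := mvt_all d xp; exists c.
    by rewrite !gtr0_norm // ltW //; split => //; move: E; rewrite sin0 !subr0.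
  have {}xn : x < 0 by rewrite lt_neqAle x0.
  have [c [/andP[c0 cx] E]] := mvt_all d xn; exists c.
  rewrite !ltr0_norm // lerN2 ltW //; split => //.
  by move: E; rewrite sin0; lra.
rewrite E normrM exprS mulrC ler_wpM2l // ler0_norm ?subr_le0 ?cos_le1 // opprB lerBlDr.
have := cos_lower c; rewrite -(real_normK (num_real c)) => H.
have : `|c| ^+ 2 <= `|x| ^+ 2 by rewrite ler_pXn2r ?nnegrE.
lra.
Qed.

Lemma sin_int x (m : int) : sin (x + pi *+ 2 * m%:~R) = sin x.
Proof.
have H n y : sin (y + pi *+ 2 * n%:R) = sin y.
  by rewrite (mulr_natr (pi *+ 2) n) (periodicn (@sinD2pi R)).
case: m => n; first exact: H.
rewrite NegzE mulrNz mulrN -[in RHS](subrK (pi *+ 2 * n.+1%:R) x) H.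
by [].
Qed.

Lemma cos_int x (m : int) : cos (x + pi *+ 2 * m%:~R) = cos x.
Proof. by rewrite -!sinDpihalf addrAC sin_int. Qed.

Definition circ A om x := x + A * sin (om * x).

Variables A om : R.
Hypothesis Aom : 0 <= A * om <= 1 / 2.

Lemma is_derive_trig (f df : R -> R) (k x : R) : (forall t : R, is_derive t 1 f (df t)) ->
  is_derive x 1 (fun t => f (k * t)) (k * df (k * x)).
Proof.
move=> fd; have dk : is_derive x 1 (fun t => k * t) k.
  by have := is_deriveZ k (is_derive_id x 1); rewrite /GRing.scale /= mulr1.
have := chain_curve dk (is_derive_diff (fd (k * x))).
by [].
Qed.

Lemma circ_derive x : is_derive x 1 (circ A om) (1 + A * om * cos (om * x)).
Proof.
have d := is_derive_trig om x (@is_derive_sin R).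
have := is_derive_affine 0 1 A (is_derive_id x 1) d.
rewrite mul1r mulrA; congr (is_derive _ _ _ _).
by apply/funext => u; rewrite add0r mul1r.
Qed.

Lemma circ_slope x y : x < y -> exists2 s, `|s| <= A * om & circ A om y - circ A om x = (1 + s) * (y - x).
Proof.
move=> xy; have [c [_ ->]] := mvt_all circ_derive xy.
exists (A * om * cos (om * c)) => //.
by rewrite normrM ger0_norm; [rewrite ler_piMr //; [case/andP: Aom|exact: cos_max]|case/andP: Aom].
Qed.

Lemma circ_lt : {mono circ A om : x y / x < y}.
Proof.
have H x y : x < y -> circ A om x < circ A om y.
  move=> xy; have [s] := circ_slope xy; rewrite ler_norml => /andP[s1 s2] E.
  rewrite -subr_gt0 E mulr_gt0 ?subr_gt0 //; case/andP: Aom => ? ?; lra.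
by apply: leW_mono; apply: le_mono.
Qed.

Lemma circ_le : {mono circ A om : x y / x <= y}.
Proof. by apply: le_mono => x y; rewrite circ_lt. Qed.

Lemma circ_lower x y : `|x - y| <= 2 * `|circ A om x - circ A om y|.
Proof.
wlog xy : x y / x < y => [H|].
  have [xy|yx|->] := ltgtP x y; first exact: H.
    by rewrite distrC [X in _ <= 2 * X]distrC; exact: H.
  by rewrite !subrr normr0 mulr0.
have [s] := circ_slope xy; rewrite ler_norml => /andP[s1 s2] E.
rewrite distrC [X in _ <= 2 * X]distrC E normrM mulrA ler_peMl //.
by rewrite ger0_norm; case/andP: Aom => ? ?; lra.
Qed.

Lemma circ_continuous : continuous (circ A om).
Proof. by move=> x; exact: is_derive_cts (circ_derive x). Qed.

Lemma circ_dist x : `|circ A om x - x| <= `|A|.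
Proof. by rewrite /circ addrC addKr normrM ler_piMr // sin_max. Qed.

Lemma circ_surj y : exists x, circ A om x = y.
Proof.
have ab : y - `|A| <= y + `|A| by have := normr_ge0 A; lra.
have fc : {within `[y - `|A|, y + `|A|], continuous (circ A om)}.
  by apply: continuous_subspaceT; exact: circ_continuous.
have [|x _ <-] := IVT (v := y) ab fc; last by exists x.
have := circ_dist (y - `|A|); have := circ_dist (y + `|A|).
rewrite !ler_norml => /andP[? ?] /andP[? ?].
by rewrite ge_min le_max; apply/andP; split; apply/orP; [left|right]; lra.
Qed.

Definition cinv y := sval (cid (circ_surj y)).
Lemma cinvK : cancel cinv (circ A om).
Proof. by move=> y; exact: (svalP (cid (circ_surj y))). Qed.
Lemma circK : cancel (circ A om) cinv.
Proof.
by move=> x; apply: (inc_inj circ_le); rewrite cinvK.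
Qed.

Lemma circ_slope_gt0 x : 0 < 1 + A * om * cos (om * x).
Proof.
have := cos_geN1 (om * x); have := cos_le1 (om * x); case/andP: Aom; move: (A * om) (cos _) => u v; nra.
Qed.

Lemma cinv_derive y : is_derive y 1 cinv (1 + A * om * cos (om * cinv y))^-1.
Proof.
rewrite -{1}[y]cinvK; apply: (@is_derive_inverse _ (circ A om)).
- by near=> z; exact: circK.
- by near=> z; exact: circ_continuous.
- exact: circ_derive.
- by rewrite gt_eqF // circ_slope_gt0.
Unshelve. all: by end_near. Qed.

Lemma cinv_continuous : continuous cinv.
Proof. by move=> x; exact: is_derive_cts (cinv_derive x). Qed.

End Trig.

(** * The diffeomorphism and its perturbations *)

Section DiffTools.
Variable R : realType.
Notation V := 'rV[R]_2.

Lemma px_is_diff (v : V) : is_diff v px px.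
Proof.
apply: DiffDef; first exact: (@differentiable_coord R 1 2 v 0 0).
have H : linear (px : V -> R) by move=> a u w; rewrite pxD pxZ.
pose f : {linear V -> R} := HB.pack (px : V -> R) (GRing.isLinear.Build _ _ _ _ _ H).
exact: (@diff_lin _ _ _ f v (@px_continuous R)).
Qed.

Lemma py_is_diff (v : V) : is_diff v py py.
Proof.
apply: DiffDef; first exact: (@differentiable_coord R 1 2 v 0 1).
have H : linear (py : V -> R) by move=> a u w; rewrite pyD pyZ.
pose f : {linear V -> R} := HB.pack (py : V -> R) (GRing.isLinear.Build _ _ _ _ _ H).
exact: (@diff_lin _ _ _ f v (@py_continuous R)).
Qed.

Lemma comp1_is_diff (k dk : V -> R) (f : R -> R) (f' : R) (v : V) :
  is_diff v k dk -> is_derive (k v) 1 f f' -> is_diff v (f \o k) (fun w => f' * dk w).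
Proof.
move=> hk /is_derive_diff hf; have := is_diff_comp hk hf.
by congr (is_diff_def _ _ _); apply/funext => w /=; rewrite mulrC.
Qed.

Lemma scal_is_diff (k dk : V -> R) (u v : V) :
  is_diff v k dk -> is_diff v (fun w => k w *: u) (fun w => dk w *: u).
Proof. by move=> hk; exact: (is_diff_comp hk (is_diff_scalel (k v) u)). Qed.

Lemma pt_is_diff (h k dh dk : V -> R) (v : V) :
  is_diff v h dh -> is_diff v k dk ->
  is_diff v (fun w => pt (h w) (k w)) (fun w => pt (dh w) (dk w)).
Proof.
move=> hh hk; have := is_diffD (scal_is_diff (pt 1 0) hh) (scal_is_diff (pt 0 1) hk).
congr (is_diff_def _ _ _); apply/funext => w; apply: plane_ext;
  rewrite -[(_ + _) w]/(_ *: _ + _ *: _) !pE; ring.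
Qed.

Lemma px_diff_comp (G L : V -> V) v : is_diff v G L -> is_diff v (px \o G) (px \o L).
Proof. by move=> hG; exact: (is_diff_comp hG (px_is_diff (G v))). Qed.

Lemma py_diff_comp (G L : V -> V) v : is_diff v G L -> is_diff v (py \o G) (py \o L).
Proof. by move=> hG; exact: (is_diff_comp hG (py_is_diff (G v))). Qed.

Lemma is_diff_ext (W W' : normedModType R) (h L L' : W -> W') v :
  (forall w, L w = L' w) -> is_diff v h L -> is_diff v h L'.
Proof. by move=> /funext ->. Qed.

Definition mx2 (a b c d : R) : 'M[R]_2 :=
  \matrix_(i, j) (if i == 0 then (if j == 0 then a else b) else (if j == 0 then c else d)).

Lemma px_mul_mx2 v a b c d : px (v *m mx2 a b c d) = px v * a + py v * c.
Proof. by rewrite px_mul !mxE. Qed.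
Lemma py_mul_mx2 v a b c d : py (v *m mx2 a b c d) = px v * b + py v * d.
Proof. by rewrite py_mul !mxE. Qed.

Lemma comb_cts (a b : V -> R) (x y : R) : continuous a -> continuous b ->
  continuous (fun v => x * a v + y * b v).
Proof.
move=> ca cb v.
exact: (cvgD (cvgM (@cvg_cst _ x _ _ _) (ca v)) (cvgM (@cvg_cst _ y _ _ _) (cb v))).
Qed.

Lemma mul_mx2_continuous (a b c d : V -> R) (w : V) :
  continuous a -> continuous b -> continuous c -> continuous d ->
  continuous (fun v => w *m mx2 (a v) (b v) (c v) (d v)).
Proof.
move=> ca cb cc cd; apply: norm_pt_continuous.
  rewrite (_ : px \o _ = fun v => px w * a v + py w * c v); last first.
    by apply/funext => v /=; rewrite px_mul_mx2.
  exact: comb_cts.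
rewrite (_ : py \o _ = fun v => px w * b v + py w * d v); last first.
  by apply/funext => v /=; rewrite py_mul_mx2.
exact: comb_cts.
Qed.

End DiffTools.

Section Map.
Variable R : realType.
Notation V := 'rV[R]_2.

Implicit Types (v k : V) (y : R).

(* In the file header [N = KN], [a = aa] and [c = cc]. The choice of [cc] makes the derivative
   [cc * (2 * fr)] equal to 1/100, and [aa = 16 cc] lets the drift [aa sin (om x)] dominate
   [cc cos (2 fr t)] at the sides of the box used below. *)
Definition KN : R := 5 * 10 ^+ 3.
Definition om : R := pi *+ 2.
Definition fr : R := KN * om.
Definition cc : R := (200 * fr)^-1.
Definition aa : R := 16 * cc.

Lemma om_gt0 : 0 < om. Proof. by rewrite /om mulrn_wgt0 // pi_gt0. Qed.
Lemma KN_gt0 : 0 < KN. Proof. by rewrite /KN; lra. Qed.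
Lemma fr_gt0 : 0 < fr. Proof. by rewrite mulr_gt0 ?KN_gt0 ?om_gt0. Qed.
Lemma cc_gt0 : 0 < cc.
Proof. rewrite invr_gt0; have := fr_gt0; lra. Qed.
Lemma cc_fr : cc * (2 * fr) = 1 / 10 ^+ 2.
Proof. by have := fr_gt0; rewrite /cc => f0; field; lra. Qed.
Lemma aa_om : aa * om = 16 / (200 * KN).
Proof.
by have := om_gt0; have := KN_gt0; rewrite /aa /cc /fr => f0 k0; field; apply/andP; split; lra.
Qed.
Lemma aa_omE : aa * om = 16 / 10 ^+ 6.
Proof. by rewrite aa_om /KN; field. Qed.
Lemma om_bounds : 4 <= om <= 8.
Proof.
rewrite /om -mulr_natr; have := pi_ge2 R; have := pihalf_lt2 R => h1 h2.
by apply/andP; split; lra.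
Qed.
Lemma cc_bounds : 1 / (8 * 10 ^+ 6) <= cc <= 1 / (4 * 10 ^+ 6).
Proof.
have /andP[b4 b8] := om_bounds; have f0 := fr_gt0.
have : cc * fr = 1 / 200 by have := cc_fr; lra.
rewrite /fr /KN => E; have c0 := cc_gt0; apply/andP; split; nra.
Qed.

Lemma aa_ok : 0 <= aa * om <= 1 / 2.
Proof. by rewrite aa_omE; apply/andP; split; lra. Qed.
Lemma cc_ok : 0 <= cc * (2 * fr) <= 1 / 2.
Proof. by rewrite cc_fr; apply/andP; split; lra. Qed.

Definition phi := circ aa om.
Definition psi := circ cc (2 * fr).

Definition F (v : V) := pt (phi (px v) + cc * cos (2 * fr * py v)) (psi (py v)).
Definition DF (v : V) := mx2 (1 + aa * om * cos (om * px v)) 0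
   (- (cc * (2 * fr) * sin (2 * fr * py v))) (1 + cc * (2 * fr) * cos (2 * fr * py v)).

(** The height of [F v] depends on the height of [v] alone, so [F] is inverted one coordinate at a
    time. *)
Definition Finv (v : V) :=
  let y := cinv cc (2 * fr) (py v) in
  pt (cinv aa om (px v - cc * cos (2 * fr * y))) y.

Lemma FinvK : cancel Finv F.
Proof.
move=> v; apply: plane_ext; rewrite !pE /phi /psi cinvK // subrK //.
Qed.

Lemma FK : cancel F Finv.
Proof.
move=> v; rewrite /Finv /F !pE /psi circK ?cc_ok // addrK /phi circK ?aa_ok //.
exact: pt_eta.
Qed.

Lemma lattice_px v : lattice v -> exists m : int, px v = m%:~R.
Proof. by case/andP => /intrP[m ->] _; exists m. Qed.
Lemma lattice_py v : lattice v -> exists m : int, py v = m%:~R.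
Proof. by case/andP => _ /intrP[m ->]; exists m. Qed.

Lemma fr_period y (m : int) : exists n : int, 2 * fr * (y + m%:~R) = 2 * fr * y + pi *+ 2 * n%:~R.
Proof.
exists (2 * (5 * 10 ^+ 3) * m); rewrite mulrDr; congr (_ + _).
by rewrite /fr /KN /om !(rmorphM, rmorphXn); ring.
Qed.

Lemma fr_half_period y (m : int) : exists n : int, fr * (y + m%:~R) = fr * y + pi *+ 2 * n%:~R.
Proof.
exists ((5 * 10 ^+ 3) * m); rewrite mulrDr; congr (_ + _).
by rewrite /fr /KN /om !(rmorphM, rmorphXn); ring.
Qed.

Lemma om_period y (m : int) : om * (y + m%:~R) = om * y + pi *+ 2 * m%:~R.
Proof. by rewrite mulrDr. Qed.

Lemma F_lattice v k : lattice k -> F (v + k) = F v + k.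
Proof.
move=> Lk; have [m Em] := lattice_px Lk; have [n En] := lattice_py Lk.
have [n' E'] := fr_period (py v) n.
apply: plane_ext; rewrite !pE /phi /psi /circ.
  by rewrite Em En E' om_period sin_int cos_int; ring.
by rewrite En E' sin_int; ring.
Qed.

Lemma DF_lattice v k : lattice k -> DF (v + k) = DF v.
Proof.
move=> Lk; have [m Em] := lattice_px Lk; have [n En] := lattice_py Lk.
have [n' E'] := fr_period (py v) n.
by rewrite /DF !pE Em En E' om_period !sin_int !cos_int.
Qed.

Lemma Finv_lattice v k : lattice k -> Finv (v + k) = Finv v + k.
Proof. by move=> Lk; rewrite -[RHS]FK F_lattice // FinvK. Qed.

Lemma F_diff v : is_diff v F (fun w => w *m DF v).
Proof.
have d1 := comp1_is_diff (px_is_diff v) (circ_derive aa om (px v)).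
have d2 := comp1_is_diff (py_is_diff v) (is_derive_trig (2 * fr) (py v) (@is_derive_cos R)).
have d3 := comp1_is_diff (py_is_diff v) (circ_derive cc (2 * fr) (py v)).
have := pt_is_diff (is_diffD d1 (is_diffZ cc d2)) d3.
apply: is_diff_ext => w; apply: plane_ext; rewrite !pE ?px_mul_mx2 ?py_mul_mx2.
  rewrite -[(_ + _) w]/(_ * _ + cc * (_ * _)); ring.
by ring.
Qed.

Lemma trig_cts (k : V -> R) (q : R) : continuous k -> continuous (fun v => cos (q * k v)) /\
  continuous (fun v => sin (q * k v)).
Proof.
move=> ck; have c v : (fun v => q * k v) @ v --> q * k v by exact: (cvgM (@cvg_cst _ q _ _ _) (ck v)).
split=> v; [exact: (continuous_comp (c v) (@continuous_cos R _))|exact: (continuous_comp (c v) (@continuous_sin R _))].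
Qed.

Lemma affine_cts (k : V -> R) (q r : R) : continuous k -> continuous (fun v => q + r * k v).
Proof.
by move=> ck v; exact: (cvgD (@cvg_cst _ q _ _ _) (cvgM (@cvg_cst _ r _ _ _) (ck v))).
Qed.

Lemma DF_cts (w : V) : continuous (fun v => w *m DF v).
Proof.
have [c1 _] := trig_cts om (@px_continuous R).
have [c2 c3] := trig_cts (2 * fr) (@py_continuous R).
apply: mul_mx2_continuous; [exact: affine_cts|exact: cst_continuous| |exact: affine_cts].
rewrite (_ : (fun v => _) = fun v : V => 0 + (- (cc * (2 * fr))) * sin (2 * fr * py v)).
  exact: affine_cts.
by apply/funext => v; rewrite add0r mulNr.
Qed.

Definition DFinv (v : V) :=
  let y := cinv cc (2 * fr) (py v) in
  let x := cinv aa om (px v - cc * cos (2 * fr * y)) in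
  let p := (1 + aa * om * cos (om * x))^-1 in
  let q := (1 + cc * (2 * fr) * cos (2 * fr * y))^-1 in
  mx2 p 0 (p * (cc * (2 * fr) * sin (2 * fr * y)) * q) q.

Lemma Finv_diff v : is_diff v Finv (fun w => w *m DFinv v).
Proof.
have d1 := comp1_is_diff (py_is_diff v) (cinv_derive cc_ok (py v)).
have d2 := comp1_is_diff d1 (is_derive_trig (2 * fr) _ (@is_derive_cos R)).
have d3 := is_diffB (px_is_diff v) (is_diffZ cc d2).
have d4 := comp1_is_diff d3 (cinv_derive aa_ok _).
have := pt_is_diff d4 d1.
apply: is_diff_ext => w; apply: plane_ext; rewrite !pE ?px_mul_mx2 ?py_mul_mx2.
  rewrite -[(_ - _) w]/(px w - cc * (_ * (_ * _))) /=.
  rewrite -[(px - _) v]/(px v - cc * _) /=; ring.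
by ring.
Qed.

Lemma inv_cts (k : V -> R) : continuous k -> (forall v, k v != 0) -> continuous (fun v => (k v)^-1).
Proof. by move=> ck k0 v; exact: (cvgV (k0 v) (ck v)). Qed.

Lemma DFinv_cts (w : V) : continuous (fun v => w *m DFinv v).
Proof.
have cy : continuous (fun v : V => cinv cc (2 * fr) (py v)).
  by move=> v; apply: continuous_comp; [exact: py_continuous|exact: (cinv_continuous cc_ok)].
have [cy1 cy2] := trig_cts (2 * fr) cy.
have cx : continuous (fun v : V => cinv aa om (px v - cc * cos (2 * fr * cinv cc (2 * fr) (py v)))).
  move=> v; apply: (@continuous_comp _ _ _ (fun v : V => px v - cc * cos (2 * fr * cinv cc (2 * fr) (py v)))); last exact: (cinv_continuous aa_ok).
  exact: (cvgB (px_continuous (x := v)) (cvgM (@cvg_cst _ cc _ _ _) (cy1 v))).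
have [cx1 _] := trig_cts om cx.
have cp := inv_cts (@affine_cts _ 1 (aa * om) cx1) (fun v => lt0r_neq0 (circ_slope_gt0 aa_ok _)).
have cq := inv_cts (@affine_cts _ 1 (cc * (2 * fr)) cy1) (fun v => lt0r_neq0 (circ_slope_gt0 cc_ok _)).
apply: mul_mx2_continuous; [exact: cp|exact: cst_continuous| |exact: cq].
move=> v; exact: (cvgM (cvgM (cp v) (cvgM (@cvg_cst _ _ _ _ _) (cy2 v))) (cq v)).
Qed.

Notation T := (torus R).

(** The representative does not matter as soon as [H] commutes with lattice translations, see
    [descendE]. *)
Definition descend (H : V -> V) (p : T) : T := tproj (H (repr p)).
Definition ftorus : T -> T := descend F.
Definition finv_torus : T -> T := descend Finv.
Definition Dftorus (p : T) := DF (repr p).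

Lemma repr_lattice (v : V) : exists2 k, lattice k & repr (tproj v) = v + k.
Proof.
exists (repr (tproj v) - v); last by rewrite addrC subrK.
by apply/tproj_eq; rewrite [LHS]reprK.
Qed.

Lemma descendE (H : V -> V) : (forall v k, lattice k -> H (v + k) = H v + k) ->
  forall v, descend H (tproj v) = tproj (H v).
Proof.
by move=> HL v; rewrite /descend; have [k Lk ->] := repr_lattice v; rewrite HL // tproj_add.
Qed.

Lemma ftorusE v : ftorus (tproj v) = tproj (F v). Proof. exact: descendE F_lattice v. Qed.
Lemma finv_torusE v : finv_torus (tproj v) = tproj (Finv v).
Proof. exact: descendE Finv_lattice v. Qed.

Lemma DftorusE v : Dftorus (tproj v) = DF v.
Proof. by rewrite /Dftorus; have [k Lk ->] := repr_lattice v; rewrite DF_lattice. Qed.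

Lemma ftorusK : cancel ftorus finv_torus.
Proof. by move=> p; have [v <-] := tproj_surj p; rewrite ftorusE finv_torusE FK. Qed.
Lemma finv_torusK : cancel finv_torus ftorus.
Proof. by move=> p; have [v <-] := tproj_surj p; rewrite finv_torusE ftorusE FinvK. Qed.

Lemma ftorus_C1 : torus_C1_with_diff ftorus Dftorus.
Proof.
split=> [v|w].
  by exists F; near=> u; rewrite DftorusE ftorusE; split => //; exact: F_diff.
by under eq_fun do rewrite DftorusE; exact: DF_cts.
Unshelve. all: by end_near. Qed.

Lemma finv_C1 : exists D', torus_C1_with_diff finv_torus D'.
Proof.
have DL v k : lattice k -> DFinv (v + k) = DFinv v.
  move=> Lk; rewrite /DFinv.
  have E := Finv_lattice v Lk; have Ey := congr1 py E; have Ex := congr1 px E.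
  have [m Em] := lattice_px Lk; have [n En] := lattice_py Lk.
  move: Ex Ey; rewrite /Finv !px_pt !py_pt !pyD !pxD !px_pt !py_pt => -> ->.
  have [n' E'] := fr_period (cinv cc (2 * fr) (py v)) n.
  by rewrite Em En E' om_period !sin_int !cos_int.
exists (fun p => DFinv (repr p)).
have DE v : DFinv (repr (tproj v)) = DFinv v.
  by have [k Lk ->] := repr_lattice v; rewrite DL.
split=> [v|w].
  by exists Finv; near=> u; rewrite DE finv_torusE; split => //; exact: Finv_diff.
by under eq_fun do rewrite DE; exact: DFinv_cts.
Unshelve. all: by end_near. Qed.

Definition fdiffeo : diffeo R := Diffeo ftorusK finv_torusK ftorus_C1 finv_C1.

End Map.

Section Perturb.
Variable R : realType.
Notation V := 'rV[R]_2.
Notation T := (torus R).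
Implicit Types (v w k : V).
Local Notation F := (@F R).
Local Notation DF := (@DF R).
Local Notation Finv := (@Finv R).
Local Notation fdiffeo := (@fdiffeo R).

(** Two conditions fix the size: [e0 <= cc / 10 ^+ 2], so that the drift at the sides of the box
    survives ([e0_cc]), and [fr * e0 <= 4 / 10 ^+ 5], the error in the angle by which the frame
    turns ([rotation_bounds]). *)
Definition e0 : R := (10 ^+ 9)^-1.
Lemma e0_gt0 : 0 < e0. Proof. by rewrite invr_gt0; lra. Qed.
Lemma e0E : e0 = 1 / (10 ^+ 9). Proof. by rewrite /e0 mul1r. Qed.

(** This transfers the closeness of [F] and a perturbation to their inverses. Each coordinate map
    loses at most a factor 2 by [circ_lower], and the shear costs only 1/100 of the vertical
    distance. *)
Lemma F_lower v w : `|px v - px w| <= 3 * `|F v - F w| /\ `|py v - py w| <= 3 * `|F v - F w|.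
Proof.
have := py_le_norm (F v - F w); have := px_le_norm (F v - F w); rewrite !pE => H1 H2.
have H3 := circ_lower (cc_ok R) (py v) (py w).
have H4 := circ_lower (aa_ok R) (px v) (px w).
rewrite /phi /psi in H1 H2.
have H5 : cc R * `|cos (2 * fr R * py v) - cos (2 * fr R * py w)| <= 1 / 10 ^+ 2 * `|py v - py w|.
  apply: le_trans (_ : cc R * (`|2 * fr R * (py v - py w)|) <= _).
    by rewrite ler_pM2l ?cc_gt0 // mulrBr cos_lip.
  rewrite normrM ger0_norm; last by have := fr_gt0 R; lra.
  by rewrite mulrA cc_fr.
move: H1; set a := circ _ _ _; set b := circ _ _ (px w); set c := cos _; set d := cos _ => H1.
have H6 : `|a - b| <= `|a + cc R * c - (b + cc R * d)| + cc R * `|c - d|.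
  have -> : cc R * `|c - d| = `|cc R * (c - d)| by rewrite normrM gtr0_norm ?cc_gt0.
  have -> : a - b = a + cc R * c - (b + cc R * d) - cc R * (c - d) by ring.
  exact: ler_normB.
have n0 := normr_ge0 (py v - py w).
move: H1 H2 H3 H4 H5 H6 n0; rewrite -/a -/b -/c -/d.
set p := `|_ - (b + _)|; set q := `|F v - F w|.
by move=> *; split; lra.
Qed.

Lemma Finv_cts : continuous Finv.
Proof. by move=> v; exact: (differentiable_continuous (@ex_diff _ _ _ _ _ _ _ (Finv_diff v))). Qed.
Lemma F_cts : continuous F.
Proof. by move=> v; exact: (differentiable_continuous (@ex_diff _ _ _ _ _ _ _ (F_diff v))). Qed.

Variable g : diffeo R.
Hypothesis gf : C1_close e0 fdiffeo g.

(** Over each [v] the point over [g (tproj v)] that is close to [F v] is chosen separately;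
    regularity of this choice comes afterwards from [map_lift]. *)
Lemma lift_exists : exists G : V -> V,
  (forall v, tproj (G v) = g (tproj v)) /\ (forall v, `|G v - F v| < e0).
Proof.
have /choice[G HG] : forall v, exists w, tproj w = g (tproj v) /\ `|w - F v| < e0.
  move=> v; have [+ _] := gf (tproj v).
  rewrite -[fdiffeo _]/(ftorus (tproj v)) ftorusE => /tdist_lt_at[w wE H].
  by exists w; split => //; rewrite distrC; apply: le_lt_trans (norm_le_enorm _) _.
by exists G; split=> v; have [] := HG v.
Qed.

Definition G := projT1 (cid lift_exists).
Lemma tproj_G v : tproj (G v) = g (tproj v).
Proof. exact: (projT2 (cid lift_exists)).1. Qed.
Lemma G_close v : `|G v - F v| < e0.
Proof. exact: (projT2 (cid lift_exists)).2. Qed.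
Lemma G_close_px v : `|px (G v) - px (F v)| < e0.
Proof. by rewrite -pxB; apply: le_lt_trans (px_le_norm _) (G_close v). Qed.
Lemma G_close_py v : `|py (G v) - py (F v)| < e0.
Proof. by rewrite -pyB; apply: le_lt_trans (py_le_norm _) (G_close v). Qed.

Definition DG v := diffeo_diff g (tproj v).

Lemma DG_close v i j : `|DG v i j - DF v i j| < e0.
Proof.
have [_ H] := gf (tproj v); apply: le_lt_trans H.
rewrite -[diffeo_diff fdiffeo _]/(Dftorus (tproj v)) DftorusE distrC.
have -> : DF v i j - DG v i j = (DF v - DG v) i j by rewrite !mxE.
exact: mx_entry_le.
Qed.

Lemma G_diff v : is_diff v G (fun w => w *m DG v).
Proof.
apply: (map_lift (diffeo_C1 g) F_cts); first exact: tproj_G.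
by move=> w; apply: lt_trans (G_close w) _; rewrite e0E; lra.
Qed.

Lemma DG_cts (w : V) : continuous (fun v => w *m DG v).
Proof. by have [_] := diffeo_C1 g; apply. Qed.

(** Both sides lie over the same point of the torus and within [e0] of [F (v + k) = F v + k]. *)
Lemma G_lattice v k : lattice k -> G (v + k) = G v + k.
Proof.
move=> Lk; apply: tproj_inj_small; first by rewrite tproj_add // !tproj_G tproj_add.
have -> : G (v + k) - (G v + k) = (G (v + k) - F (v + k)) - (G v - F v).
  by rewrite F_lattice //; apply: plane_ext; rewrite !pE; ring.
apply: le_lt_trans (ler_normB _ _) _.
have := G_close (v + k); have := G_close v; rewrite e0E => H1 H2.
by apply: lt_trans (ltrD H2 H1) _; lra.
Qed.

Lemma G_surj v : exists w, G w = v.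
Proof.
have [w0 Ew] := tproj_surj (diffeo_inv g (tproj v)).
have L : lattice (v - G w0) by apply/tproj_eq; rewrite tproj_G Ew diffeo_invK.
by exists (w0 + (v - G w0)); rewrite G_lattice // addrC subrK.
Qed.

Lemma G_inj v w : G v = G w -> v = w.
Proof.
move=> E; have L : lattice (v - w).
  by apply/tproj_eq/(can_inj (@diffeo_funK R g)); rewrite -!tproj_G E.
have : G v = G w + (v - w) by rewrite -G_lattice // addrC subrK.
by rewrite E -{1}[G w]addr0 => /addrI/esym/subr0_eq.
Qed.

Definition Ginv v := projT1 (cid (G_surj v)).
Lemma GinvK v : G (Ginv v) = v.
Proof. exact: projT2 (cid (G_surj v)). Qed.
Lemma GK v : Ginv (G v) = v.
Proof. by apply: G_inj; rewrite GinvK. Qed.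

Lemma tproj_Ginv v : tproj (Ginv v) = diffeo_inv g (tproj v).
Proof. by rewrite -[in RHS](GinvK v) tproj_G diffeo_funK. Qed.

Lemma Ginv_close v : `|Ginv v - Finv v| < 3 * e0.
Proof.
have [H1 H2] := F_lower (Ginv v) (Finv v).
have H : `|F (Ginv v) - F (Finv v)| < e0.
  by rewrite FinvK -[v in _ - v]GinvK distrC G_close.
have p : 0 < 3 * e0 by have := e0_gt0; lra.
rewrite norm_lt // pxB pyB; apply/andP; split.
  by apply: le_lt_trans H1 _; lra.
by apply: le_lt_trans H2 _; lra.
Qed.

Definition DGinv v := projT1 (cid (diffeo_inv_C1 g)) (tproj v).

Lemma Ginv_diff v : is_diff v Ginv (fun w => w *m DGinv v).
Proof.
apply: (map_lift (projT2 (cid (diffeo_inv_C1 g))) Finv_cts); first exact: tproj_Ginv.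
by move=> w; apply: lt_trans (Ginv_close w) _; rewrite e0E; lra.
Qed.

Lemma DGinv_cts (w : V) : continuous (fun v => w *m DGinv v).
Proof. by have [_] := projT2 (cid (diffeo_inv_C1 g)); apply. Qed.

Lemma DGinvK v w : (w *m DGinv v) *m DG (Ginv v) = w.
Proof.
have H := is_diff_comp (Ginv_diff v) (G_diff (Ginv v)).
have E : G \o Ginv = id by apply/funext => u; rewrite /= GinvK.
rewrite E in H; have E1 := @diff_val _ _ _ _ _ _ _ H.
have E2 := @diff_val _ _ _ _ _ _ _ (is_diff_id v).
exact: (congr1 (fun f : V -> V => f w) (etrans (esym E1) E2)).
Qed.

Lemma DGK v w : (w *m DG v) *m DGinv (G v) = w.
Proof.
have H := is_diff_comp (G_diff v) (Ginv_diff (G v)).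
have E : Ginv \o G = id by apply/funext => u; rewrite /= GK.
rewrite E in H; have E1 := @diff_val _ _ _ _ _ _ _ H.
have E2 := @diff_val _ _ _ _ _ _ _ (is_diff_id v).
exact: (congr1 (fun f : V -> V => f w) (etrans (esym E1) E2)).
Qed.

End Perturb.

(** * Invariant line fields *)

Section Graph.
Variables (R : realType) (T : topologicalType).

Lemma expr_small (th e : R) : 0 <= th < 1 -> 0 < e -> exists n, th ^+ n < e.
Proof.
move=> /andP[t0 t1] e_gt0.
have H : th ^+ n @[n --> \oo] --> 0 by apply: cvg_expr; rewrite ger0_norm.
have [n _ Hn] := (cvgr_norm_lt _ H e ltac:(by rewrite normr0)).
exists n; apply: le_lt_trans (ler_norm _) _; exact: Hn (leqnn n).
Qed.

Variables (k : T -> T) (A B C D : T -> R).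
Hypothesis kc : continuous k.
Hypotheses (Ac : continuous A) (Bc : continuous B) (Cc : continuous C) (Dc : continuous D).
Hypothesis bnd : forall p, [/\ 98 / 10 ^+ 2 <= A p, D p <= 102 / 10 ^+ 2, 97 / 10 ^+ 4 <= D p - A p,
  `|B p| <= 2 / 10 ^+ 4 & `|C p| <= 2 / 10 ^+ 4].

(** The action of a matrix on slopes. In [graphs_exist] the matrix is, for [E], the adjugate of the
    differential at [p], which pulls slopes back from [g p]; for [F] it is the differential at the
    preimage of [p], which pushes them forward. *)
Let Phi p (x : R) := (A p * x + B p) / (C p * x + D p).

Let den p x : `|x| <= 1 / 20 -> 97 / 10 ^+ 2 <= C p * x + D p.
Proof.
have [a1 d1 da b1 c1] := bnd p; rewrite ler_norml => /andP[x1 x2].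
move: b1 c1; rewrite !ler_norml => /andP[b1 b2] /andP[c1 c2]; nra.
Qed.

Let Phi_bound p x : `|x| <= 1 / 20 -> `|Phi p x| <= 1 / 20.
Proof.
move=> Hx; have d0 := den p Hx; have [a1 d1 da b1 c1] := bnd p.
rewrite /Phi normrM normfV (@gtr0_norm _ (C p * x + D p)); last by lra.
rewrite ler_pdivrMr; last by lra.
apply: le_trans (ler_normD _ _) _; rewrite normrM (@ger0_norm _ (A p)); last by lra.
have : `|C p * x| <= 2 / 10 ^+ 4 * (1 / 20) by rewrite normrM ler_pM.
rewrite ler_norml => /andP[c2 c3].
have : A p * `|x| <= A p * (1 / 20) by rewrite ler_pM2l //; lra.
lra.
Qed.

(** The rate is essentially [A / D]. As the gap [97 / 10 ^+ 4] is divided by [D <= 102 / 10 ^+ 2],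
    this is below [991 / 10 ^+ 3], and the rest of the margin absorbs [B] and [C]. *)
Let Phi_contr p x y : `|x| <= 1 / 20 -> `|y| <= 1 / 20 ->
  `|Phi p x - Phi p y| <= 995 / 10 ^+ 3 * `|x - y|.
Proof.
move=> Hx Hy; have d0 := den p Hx; have d0' := den p Hy; have [a1 d1 da b1 c1] := bnd p.
have E : Phi p x - Phi p y =
    (A p * D p - B p * C p) * (x - y) / ((C p * x + D p) * (C p * y + D p)).
  by rewrite /Phi; field; apply/andP; split; lra.
rewrite E normrM normfV normrM (@gtr0_norm _ ((C p * x + D p) * (C p * y + D p))); last by apply: mulr_gt0; lra.
suff K : `|A p * D p - B p * C p| <= 995 / 10 ^+ 3 * ((C p * x + D p) * (C p * y + D p)).
  rewrite mulrAC; apply: ler_wpM2r => //.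
  by rewrite ler_pdivrMr //; apply: mulr_gt0; lra.
have cb (z : R) : `|z| <= 1 / 20 -> `|C p * z| <= 1 / 10 ^+ 5.
  by move=> Hz; rewrite normrM; apply: le_trans (ler_pM _ _ c1 Hz) _ => //; lra.
have := cb _ Hx; have := cb _ Hy; rewrite !ler_norml => /andP[u1 u2] /andP[u3 u4].
have : `|B p * C p| <= 1 / 10 ^+ 5.
  by rewrite normrM; apply: le_trans (ler_pM _ _ b1 c1) _ => //; lra.
rewrite ler_norml => /andP[w1 w2].
move: d1 da a1 w1 w2 u1 u2 u3 u4; clear.
move: (A p) (D p) (B p * C p) (C p * x) (C p * y) => a d bc cx cy d1 da a1 w1 w2 u1 u2 u3 u4.
have H2 : a * d <= (d - 97 / 10 ^+ 4) * d by rewrite ler_wpM2r //; lra.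
have H3 : d * d <= 102 / 10 ^+ 2 * d by rewrite ler_wpM2r //; lra.
have H4 : 0 <= a * d by apply: mulr_ge0; lra.
have H1 : (d - 1 / 10 ^+ 5) * (d - 1 / 10 ^+ 5) <= (cx + d) * (cy + d) by apply: ler_pM; lra.
apply/andP; split; lra.
Qed.

Let m_ := fix m n p : R := if n is n'.+1 then Phi p (m n' (k p)) else 0.

Let m_bound n p : `|m_ n p| <= 1 / 20.
Proof.
by elim: n p => [|n IH] p /=; [rewrite normr0; lra|exact: Phi_bound].
Qed.

Let m_cts n : continuous (m_ n).
Proof.
elim: n => [|n IH]; first exact: cst_continuous.
have mk : continuous (fun p => m_ n (k p)) by move=> p; exact: (continuous_comp (kc (x := p)) (IH (k p))).
move=> p; have d0 := den p (m_bound n (k p)).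
apply: cvgM.
  exact: (cvgD (cvgM (Ac (x := p)) (mk p)) (Bc (x := p))).
have dne : C p * m_ n (k p) + D p != 0 by rewrite gt_eqF //; lra.
exact: (cvgV dne (cvgD (cvgM (Cc (x := p)) (mk p)) (Dc (x := p)))).
Qed.

Let th : R := 995 / 10 ^+ 3.
Let th_small (e : R) : 0 < e -> exists n, th ^+ n < e.
Proof. by move=> e_gt0; apply: expr_small => //; rewrite /th; apply/andP; split; lra. Qed.
Let th_ge0 n : 0 <= th ^+ n. Proof. by rewrite exprn_ge0 // /th; lra. Qed.

Let m_cauchy n j p : `|m_ (n + j) p - m_ n p| <= th ^+ n.
Proof.
elim: n p => [|n IH] p.
  by rewrite add0n subr0 expr0; apply: le_trans (m_bound j p) _; lra.
rewrite addSn; apply: le_trans (Phi_contr _ (m_bound _ _) (m_bound _ _)) _.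
rewrite [th ^+ n.+1]exprS; apply: ler_wpM2l; [lra|exact: IH].
Qed.

(* The fixed point of the graph transform [m |-> Phi p (m (k p))], a contraction because [A < D]
   while [B] and [C] are small. *)
Lemma invariant_graph : exists m : T -> R, [/\ continuous m, forall p, `|m p| <= 1 / 20 &
  forall p, m p = (A p * m (k p) + B p) / (C p * m (k p) + D p)].
Proof.
(* The limit of the iterates, written as a supremum: by [m_cauchy] each [m_ n p - th ^+ n] lies
   below it and each [m_ n p + th ^+ n] above. *)
pose S p := [set x | exists n, x = m_ n p - th ^+ n].
pose m p := sup (S p).
have ab p i j : m_ i p - th ^+ i <= m_ j p + th ^+ j.
  have [ij|/ltnW ji] := leqP i j.
    have := m_cauchy i (j - i) p; rewrite subnKC // ler_norml => /andP[h1 h2].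
    by have := th_ge0 j; lra.
  have := m_cauchy j (i - j) p; rewrite subnKC // ler_norml => /andP[h1 h2].
  by have := th_ge0 i; lra.
have hS p : has_sup (S p).
  by split; [exists (m_ 0 p - th ^+ 0), 0%N|exists (m_ 0 p + th ^+ 0) => _ [n ->]].
have close p n : `|m p - m_ n p| <= th ^+ n.
  have h1 : m_ n p - th ^+ n <= m p by apply: ub_le_sup; [case: (hS p)|exists n].
  have h2 : m p <= m_ n p + th ^+ n by apply: ge_sup; [case: (hS p)|move=> _ [i ->]].
  by rewrite ler_norml; apply/andP; split; lra.
have mb p : `|m p| <= 1 / 20.
  apply/ler_addgt0Pr => e /th_small[n Hn].
  have := close p n; have := m_bound n p; rewrite !ler_norml => /andP[? ?] /andP[? ?].
  by apply/andP; split; lra.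
exists m; split => //.
- move=> p; apply/cvgrPdist_lt => e e_gt0.
  have [n Hn] := th_small (divr_gt0 e_gt0 (ltr0Sn R 2)).
  have : \forall q \near p, `|m_ n p - m_ n q| < e / 3.
    by move/cvgrPdist_lt : (@m_cts n p); apply; rewrite divr_gt0.
  apply: filterS => q; have := close p n; have := close q n.
  rewrite !ler_norml !ltr_norml => /andP[? ?] /andP[? ?] /andP[? ?].
  by apply/andP; split; lra.
- move=> p; apply/eqP; rewrite -subr_eq0 -normr_le0; apply/ler_addgt0Pr => e e_gt0.
  have [n Hn] := th_small (divr_gt0 e_gt0 (ltr0Sn R 1)).
  have h1 := close p n.+1; have h2 := Phi_contr p (mb (k p)) (m_bound n (k p)).
  have h3 := close (k p) n.
  have h4 : th ^+ n.+1 <= th ^+ n by rewrite [th ^+ n.+1]exprS; apply: ler_piMl; [exact: th_ge0|rewrite /th; lra].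
  rewrite add0r -/(Phi p (m (k p))).
  have -> : m p - Phi p (m (k p)) = (m p - m_ n.+1 p) - (Phi p (m (k p)) - Phi p (m_ n (k p))).
    by rewrite /=; ring.
  by apply: le_trans (ler_normB _ _) _; lra.
Qed.

End Graph.

Lemma mul_abs_le (R : realType) (x y X Y : R) : `|x| <= X -> `|y| <= Y -> `|x * y| <= X * Y.
Proof. by move=> hx hy; rewrite normrM ler_pM. Qed.

(** Here [cs], [ss] and [kk] are the squares and the product of the cosine and sine of the frame
    angle. With b = 1/100 the entries in the unturned frame are 1 - b ss, b kk, - b kk and 1 + b cs
    up to small errors. The target frame is turned by an angle whose sine [w] is close to b kk; to
    first order this cancels the off-diagonal entries and leaves the diagonal gap b (ss + cs) =
    b. *)
Lemma rotated_entries (R : realType) (w z P Q U W kk ss cs : R) :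
  `|w - 1 / 10 ^+ 2 * kk| <= 5 / 10 ^+ 5 -> `|w| <= 6 / 10 ^+ 3 -> 1 - 4 / 10 ^+ 5 <= z -> z <= 1 ->
  `|P - (1 - 1 / 10 ^+ 2 * ss)| <= 4 / 10 ^+ 5 -> `|Q - 1 / 10 ^+ 2 * kk| <= 4 / 10 ^+ 5 ->
  `|U + 1 / 10 ^+ 2 * kk| <= 4 / 10 ^+ 5 -> `|W - (1 + 1 / 10 ^+ 2 * cs)| <= 4 / 10 ^+ 5 ->
  cs + ss = 1 -> `|kk| <= 1 / 2 -> 0 <= ss -> 0 <= cs ->
  [/\ 98 / 10 ^+ 2 <= z * P + w * Q, z * W - w * U <= 102 / 10 ^+ 2,
    97 / 10 ^+ 4 <= z * W - w * U - (z * P + w * Q),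
    `|z * U + w * W| <= 2 / 10 ^+ 4 & `|z * Q - w * P| <= 2 / 10 ^+ 4].
Proof.
move=> r1 r2 r3 r4 m1 m2 m3 m4 E kb s0 c0.
have z1 : `|z - 1| <= 4 / 10 ^+ 5 by rewrite ler_norml; apply/andP; split; lra.
have bk : `|1 / 10 ^+ 2 * kk| <= 5 / 10 ^+ 3.
  rewrite normrM (@ger0_norm _ (1 / 10 ^+ 2)); lra.
have ss1 : `|1 / 10 ^+ 2 * ss| <= 1 / 10 ^+ 2 by rewrite ger0_norm; move: E s0 c0; clear; lra.
have cs1' : `|1 / 10 ^+ 2 * cs| <= 1 / 10 ^+ 2 by rewrite ger0_norm; move: E s0 c0; clear; lra.
have P1 : `|P - 1| <= 11 / 10 ^+ 3.
  have -> : P - 1 = (P - (1 - 1 / 10 ^+ 2 * ss)) - 1 / 10 ^+ 2 * ss by ring.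
  by apply: le_trans (ler_normB _ _) _; move: m1 ss1; clear; lra.
have W1 : `|W - 1| <= 11 / 10 ^+ 3.
  have -> : W - 1 = (W - (1 + 1 / 10 ^+ 2 * cs)) + 1 / 10 ^+ 2 * cs by ring.
  by apply: le_trans (ler_normD _ _) _; move: m4 cs1'; clear; lra.
have near1 (x : R) : `|x - 1| <= 11 / 10 ^+ 3 -> `|x| <= 102 / 10 ^+ 2.
  move=> h; have -> : x = (x - 1) + 1 by ring.
  by apply: le_trans (ler_normD _ _) _; rewrite normr1; move: h; clear; lra.
have Pb := near1 _ P1; have Wb := near1 _ W1.
have Qb : `|Q| <= 6 / 10 ^+ 3.
  have -> : Q = (Q - 1 / 10 ^+ 2 * kk) + 1 / 10 ^+ 2 * kk by ring.
  by apply: le_trans (ler_normD _ _) _; move: m2 bk; clear; lra.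
have Ub : `|U| <= 6 / 10 ^+ 3.
  have -> : U = (U + 1 / 10 ^+ 2 * kk) - 1 / 10 ^+ 2 * kk by ring.
  by apply: le_trans (ler_normB _ _) _; move: m3 bk; clear; lra.
have a1 := mul_abs_le z1 Qb; have a2 := mul_abs_le r1 Pb; have a3 := mul_abs_le bk P1.
have a4 := mul_abs_le z1 Ub; have a5 := mul_abs_le r1 Wb; have a6 := mul_abs_le bk W1.
have a7 := mul_abs_le z1 Pb; have a8 := mul_abs_le r2 Qb.
have a9 := mul_abs_le z1 Wb; have a10 := mul_abs_le r2 Ub.
have EC : z * Q - w * P = (z - 1) * Q + (Q - 1 / 10 ^+ 2 * kk) - (w - 1 / 10 ^+ 2 * kk) * P
   - (1 / 10 ^+ 2 * kk) * (P - 1) by ring.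
have EB : z * U + w * W = (z - 1) * U + (U + 1 / 10 ^+ 2 * kk) + (w - 1 / 10 ^+ 2 * kk) * W
   + (1 / 10 ^+ 2 * kk) * (W - 1) by ring.
have EE : z * P + w * Q = (z - 1) * P + (P - (1 - 1 / 10 ^+ 2 * ss)) + w * Q + (1 - 1 / 10 ^+ 2 * ss).
  by ring.
have ED : z * W - w * U = (z - 1) * W + (W - (1 + 1 / 10 ^+ 2 * cs)) - w * U + (1 + 1 / 10 ^+ 2 * cs).
  by ring.
rewrite EC EB EE ED; split.
- move: (lerNnormlW a7) (lerNnormlW m1) (lerNnormlW a8) E s0 c0.
  move: ((z - 1) * P) (P - _) (w * Q) => u1 u2 u3; clear; lra.
- move: (ler_normlW a9) (ler_normlW m4) (lerNnormlW a10) E s0 c0.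
  move: ((z - 1) * W) (W - _) (w * U) => u1 u2 u3; clear; lra.
- move: (ler_normlW a7) (ler_normlW m1) (ler_normlW a8) (lerNnormlW a9) (lerNnormlW m4) (ler_normlW a10) E s0 c0.
  move: ((z - 1) * P) (P - _) (w * Q) ((z - 1) * W) (W - _) (w * U) => u1 u2 u3 u4 u5 u6; clear; lra.
- apply: le_trans (ler_normD _ _) _; apply: le_trans (lerD (ler_normD _ _) a6) _.
  by apply: le_trans (lerD (lerD (ler_normD _ _) a5) (lexx _)) _; move: a4 m3; clear; lra.
- apply: le_trans (ler_normB _ _) _; apply: le_trans (lerD (ler_normB _ _) a3) _.
  by apply: le_trans (lerD (lerD (ler_normD _ _) a2) (lexx _)) _; move: a1 m2; clear; lra.
Qed.

(** * The rotating frame *)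

Section Frames.
Variable R : realType.
Notation V := 'rV[R]_2.
Notation T := (torus R).
Implicit Types (v w k : V) (p q : T).

Definition cT p : R := cos (fr R * py (repr p)).
Definition sT p : R := sin (fr R * py (repr p)).

Lemma cTE v : cT (tproj v) = cos (fr R * py v).
Proof.
rewrite /cT; have [k Lk ->] := repr_lattice v; have [n En] := lattice_py Lk.
by have [n' E'] := fr_half_period (py v) n; rewrite pyD En E' cos_int.
Qed.
Lemma sTE v : sT (tproj v) = sin (fr R * py v).
Proof.
rewrite /sT; have [k Lk ->] := repr_lattice v; have [n En] := lattice_py Lk.
by have [n' E'] := fr_half_period (py v) n; rewrite pyD En E' sin_int.
Qed.

Lemma cT_cts : continuous cT.
Proof.
apply: torus_continuous; rewrite (_ : _ \o _ = fun v => cos (fr R * py v)).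
  exact: (trig_cts (fr R) (@py_continuous R)).1.
by apply/funext => v; exact: cTE.
Qed.
Lemma sT_cts : continuous sT.
Proof.
apply: torus_continuous; rewrite (_ : _ \o _ = fun v => sin (fr R * py v)).
  exact: (trig_cts (fr R) (@py_continuous R)).2.
by apply/funext => v; exact: sTE.
Qed.

Lemma cs1 p : cT p ^+ 2 + sT p ^+ 2 = 1.
Proof. exact: cos2Dsin2. Qed.

Variable g : diffeo R.
Hypothesis gf : C1_close (e0 R) (fdiffeo R) g.

Let D p := diffeo_diff g p.

(* The matrix of [D p] in the frame at [p] is [[eP, eQ], [eU, eW]]; with the frame at [g p] on
   the target side, which is rotated by the angle of cosine [cw] and sine [sw], it becomes
   [[ee, ec], [eb, ed]]. *)
Definition eP p := cT p * cT p * D p 0 0 + sT p * cT p * (D p 0 1 + D p 1 0) + sT p * sT p * D p 1 1.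
Definition eQ p := cT p * sT p * (D p 1 1 - D p 0 0) - sT p * sT p * D p 1 0 + cT p * cT p * D p 0 1.
Definition eU p := cT p * sT p * (D p 1 1 - D p 0 0) + cT p * cT p * D p 1 0 - sT p * sT p * D p 0 1.
Definition eW p := sT p * sT p * D p 0 0 - sT p * cT p * (D p 0 1 + D p 1 0) + cT p * cT p * D p 1 1.
Definition cw p := cT p * cT (g p) + sT p * sT (g p).
Definition sw p := cT p * sT (g p) - sT p * cT (g p).

Definition ee p := cw p * eP p + sw p * eQ p.
Definition ec p := cw p * eQ p - sw p * eP p.
Definition eb p := cw p * eU p + sw p * eW p.
Definition ed p := cw p * eW p - sw p * eU p.

Definition nuE p := pt (cT p) (sT p).
Definition nuF p := pt (- sT p) (cT p).

Lemma nuE_image p : nuE p *m D p = ee p *: nuE (g p) + ec p *: nuF (g p).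
Proof.
have h1 := cs1 p; have h2 := cs1 (g p).
have E1 : cw p * cT p - sw p * sT p = cT (g p).
  by rewrite -[RHS]mulr1 -h1 /cw /sw; ring.
have E2 : cw p * sT p + sw p * cT p = sT (g p).
  by rewrite -[RHS]mulr1 -h1 /cw /sw; ring.
have h3 : cw p ^+ 2 + sw p ^+ 2 = 1.
  by rewrite -[RHS]mulr1 -{1}h1 -h2 /cw /sw; ring.
have A1 : ee p * cw p - ec p * sw p = eP p.
  by rewrite -[RHS]mulr1 -h3 /ee /ec; ring.
have A2 : ee p * sw p + ec p * cw p = eQ p.
  by rewrite -[RHS]mulr1 -h3 /ee /ec; ring.
apply: plane_ext; rewrite ?px_mul ?py_mul !pE -E1 -E2.
  transitivity (cT p * eP p - sT p * eQ p); last by rewrite -A1 -A2; ring.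
  rewrite /eP /eQ -[LHS]mulr1 -h1; ring.
transitivity (sT p * eP p + cT p * eQ p); last by rewrite -A1 -A2; ring.
rewrite /eP /eQ -[LHS]mulr1 -h1; ring.
Qed.

Lemma nuF_image p : nuF p *m D p = eb p *: nuE (g p) + ed p *: nuF (g p).
Proof.
have h1 := cs1 p; have h2 := cs1 (g p).
have E1 : cw p * cT p - sw p * sT p = cT (g p).
  by rewrite -[RHS]mulr1 -h1 /cw /sw; ring.
have E2 : cw p * sT p + sw p * cT p = sT (g p).
  by rewrite -[RHS]mulr1 -h1 /cw /sw; ring.
have h3 : cw p ^+ 2 + sw p ^+ 2 = 1.
  by rewrite -[RHS]mulr1 -{1}h1 -h2 /cw /sw; ring.
have A1 : eb p * cw p - ed p * sw p = eU p.
  by rewrite -[RHS]mulr1 -h3 /eb /ed; ring.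
have A2 : eb p * sw p + ed p * cw p = eW p.
  by rewrite -[RHS]mulr1 -h3 /eb /ed; ring.
apply: plane_ext; rewrite ?px_mul ?py_mul !pE -E1 -E2.
  transitivity (cT p * eU p - sT p * eW p); last by rewrite -A1 -A2; ring.
  rewrite /eU /eW -[LHS]mulr1 -h1; ring.
transitivity (sT p * eU p + cT p * eW p); last by rewrite -A1 -A2; ring.
rewrite /eU /eW -[LHS]mulr1 -h1; ring.
Qed.

Let k p : R := cT p * sT p.

(** The frame turns by [fr] times the vertical displacement. For the unperturbed map this is
    [fr * cc * sin (2 * fr * t)], and [fr * cc = 1 / 200] together with the double angle formula
    gives [k / 10 ^+ 2]. *)
Lemma rotation_bounds p : [/\ `|sw p - 1 / 10 ^+ 2 * k p| <= 5 / 10 ^+ 5,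
  `|sw p| <= 6 / 10 ^+ 3, 1 - 4 / 10 ^+ 5 <= cw p & cw p <= 1].
Proof.
have [v <-] := tproj_surj p; pose o := fr R * (py (G gf v) - py v).
have gE : g (tproj v) = tproj (G gf v) by rewrite tproj_G.
have E : fr R * py (G gf v) = fr R * py v + o by rewrite /o; ring.
have swE : sw (tproj v) = sin o.
  rewrite /sw gE !cTE !sTE E sinD cosD -[RHS]mulr1 -(cos2Dsin2 (fr R * py v)); ring.
have cwE : cw (tproj v) = cos o.
  rewrite /cw gE !cTE !sTE E sinD cosD -[RHS]mulr1 -(cos2Dsin2 (fr R * py v)); ring.
rewrite swE cwE /k cTE sTE; set K := cos _ * sin _.
have Kb : `|K| <= 1 / 2.
  have Kb0 (c s : R) : c ^+ 2 + s ^+ 2 = 1 -> `|c * s| <= 1 / 2.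
    move=> E1; have := sqr_ge0 (c - s); have := sqr_ge0 (c + s).
    by rewrite ler_norml => h1 h2; apply/andP; split; nra.
  exact: Kb0 (cos2Dsin2 _).
have frb : fr R <= 4 * 10 ^+ 4.
  have /andP[_ h] := om_bounds R; rewrite /fr /KN.
  by apply: le_trans (_ : 5 * 10 ^+ 3 * 8 <= _); [rewrite ler_pM2l //; lra|lra].
have oE : `|o - 1 / 10 ^+ 2 * K| <= 4 / 10 ^+ 5.
  have -> : o - 1 / 10 ^+ 2 * K = fr R * (py (G gf v) - py (F v)).
    have h := cc_fr R.
    have -> : 1 / 10 ^+ 2 * K = fr R * (cc R * sin (2 * fr R * py v)).
      have -> : 2 * fr R * py v = (fr R * py v) *+ 2 by rewrite -mulr_natl; ring.
      by rewrite sin_mulr2n -/K -h; rewrite -mulr_natl; ring.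
    by rewrite /o /F py_pt /psi /circ; ring.
  rewrite normrM gtr0_norm ?fr_gt0 //.
  have := G_close_py gf v; rewrite e0E => /ltW h.
  apply: le_trans (ler_pM (ltW (fr_gt0 R)) (normr_ge0 _) frb h) _; lra.
have ob : `|o| <= 51 / 10 ^+ 4.
  have -> : o = (o - 1 / 10 ^+ 2 * K) + 1 / 10 ^+ 2 * K by ring.
  apply: le_trans (ler_normD _ _) _; rewrite normrM (@ger0_norm _ (1 / 10 ^+ 2)); last by lra.
  lra.
have o2 : `|o| ^+ 2 <= 3 / 10 ^+ 5.
  have h : `|o| ^+ 2 <= (51 / 10 ^+ 4) ^+ 2 by rewrite ler_pXn2r ?nnegrE //; lra.
  by apply: le_trans h _; lra.
have o3 : `|o| ^+ 3 <= 2 / 10 ^+ 7.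
  rewrite exprS; apply: le_trans (ler_pM (normr_ge0 _) _ ob o2) _; first exact: exprn_ge0.
  lra.
have h1 := sin_sub_id o; have h2 := sin_norm_le o; have h3 := cos_lower o; have h4 := cos_le1 o.
split => //.
- have -> : sin o - 1 / 10 ^+ 2 * K = (sin o - o) + (o - 1 / 10 ^+ 2 * K) by ring.
  by apply: le_trans (ler_normD _ _) _; lra.
- by lra.
- by rewrite -(real_normK (num_real o)) in h3; lra.
Qed.

Lemma D_close p : let b := 1 / 10 ^+ 2 in
  [/\ `|D p 0 0 - 1| <= 2 / 10 ^+ 5, `|D p 0 1| <= 2 / 10 ^+ 5,
      `|D p 1 0 + b * (2 * k p)| <= 2 / 10 ^+ 5 &
      `|D p 1 1 - (1 + b * (cT p ^+ 2 - sT p ^+ 2))| <= 2 / 10 ^+ 5].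
Proof.
have [v <-] := tproj_surj p; move=> b; rewrite /k cTE sTE.
have E2 : 2 * fr R * py v = (fr R * py v) *+ 2 by rewrite -mulr_natl; ring.
have S2 : sin (2 * fr R * py v) = 2 * (cos (fr R * py v) * sin (fr R * py v)).
  by rewrite E2 sin_mulr2n mulr_natl.
have C2 : cos (2 * fr R * py v) = cos (fr R * py v) ^+ 2 - sin (fr R * py v) ^+ 2.
  by rewrite E2 cos_mulr2n sin2cos2; ring.
have H i j := ltW (DG_close gf v i j); rewrite e0E in H.
have := H 0 0; have := H 0 1; have := H 1 0; have := H 1 1.
rewrite /DG -/(D (tproj v)) /DF !mxE /= cc_fr aa_omE S2 C2 -/b subr0 opprK.
have h0 := cos_max (om R * px v).
have h1 : `|16 / 10 ^+ 6 * cos (om R * px v)| <= 16 / 10 ^+ 6.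
  rewrite normrM (@ger0_norm _ (16 / 10 ^+ 6)); last by lra.
  by rewrite ler_piMr //; lra.
move=> h11 h10 h01 h00; split.
- have -> : D (tproj v) 0 0 - 1 =
    (D (tproj v) 0 0 - (1 + 16 / 10 ^+ 6 * cos (om R * px v))) + 16 / 10 ^+ 6 * cos (om R * px v) by ring.
  by apply: le_trans (ler_normD _ _) _; lra.
- by lra.
- by lra.
- by lra.
Qed.

(** The two squares contribute [e] together, and [|c * s| <= 1 / 2] bounds the mixed terms by
    another [e]. *)
Lemma quad_err (c s d1 d2 d3 d4 e : R) : c ^+ 2 + s ^+ 2 = 1 ->
  `|d1| <= e -> `|d2| <= e -> `|d3| <= e -> `|d4| <= e ->
  `|c * c * d1 + c * s * (d2 + d3) + s * s * d4| <= 2 * e.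
Proof.
move=> E h1 h2 h3 h4; have e_ge0 : 0 <= e by exact: le_trans h1.
have cs : `|c * s| <= 1 / 2.
  have := sqr_ge0 (c - s); have := sqr_ge0 (c + s).
  by rewrite ler_norml => ? ?; apply/andP; split; nra.
have a1 : `|c * c * d1| <= c * c * e by rewrite normrM -expr2 (ger0_norm (sqr_ge0 c)) ler_wpM2l ?sqr_ge0.
have a4 : `|s * s * d4| <= s * s * e by rewrite normrM -expr2 (ger0_norm (sqr_ge0 s)) ler_wpM2l ?sqr_ge0.
have a2 : `|c * s * (d2 + d3)| <= 1 / 2 * (2 * e).
  rewrite normrM; apply: ler_pM => //; apply: le_trans (ler_normD _ _) _; lra.
have a3 : c * c * e + s * s * e = e by rewrite -mulrDl -!expr2 E mul1r.
apply: le_trans (ler_normD _ _) _; apply: le_trans (lerD (ler_normD _ _) (lexx _)) _; lra.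
Qed.

Lemma main_entries p : let b := 1 / 10 ^+ 2 in let e := 4 / 10 ^+ 5 in
  [/\ `|eP p - (1 - b * (sT p * sT p))| <= e, `|eQ p - b * k p| <= e,
      `|eU p + b * k p| <= e & `|eW p - (1 + b * (cT p * cT p))| <= e].
Proof.
move=> b e; have := D_close p; have E := cs1 p.
rewrite -/b /eP /eQ /eU /eW /k; set c := cT p in E *; set s := sT p in E *.
case; set d1 := D p 0 0 - 1; set d2 := D p 0 1; set d3 := D p 1 0 + b * (2 * (c * s));
set d4 := D p 1 1 - (1 + b * (c ^+ 2 - s ^+ 2)) => h1 h2 h3 h4.
have e2 : 2 * (2 / 10 ^+ 5) = e by rewrite /e; lra.
have [n1 n2 n3 n4] : [/\ `|- d1| <= 2 / 10 ^+ 5, `|- d2| <= 2 / 10 ^+ 5,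
  `|- d3| <= 2 / 10 ^+ 5 & `|- d4| <= 2 / 10 ^+ 5] by split; rewrite normrN; assumption.
(* A suitable multiple of this vanishing expression is added to each difference below, so that
   identities which hold only modulo the trigonometric relation become polynomial ones. *)
have Z : c ^+ 2 + s ^+ 2 - 1 = 0 by rewrite E subrr.
have EQ : D p 0 0 = d1 + 1 by rewrite /d1 subrK.
have EQ2 : D p 1 0 = d3 - b * (2 * (c * s)) by rewrite /d3 addrK.
have EQ3 : D p 1 1 = d4 + (1 + b * (c ^+ 2 - s ^+ 2)) by rewrite /d4 subrK.
rewrite -e2 EQ EQ2 EQ3; split.
- apply: le_trans (quad_err E h1 h2 h3 h4).
  rewrite -[X in _ <= `|X|]addr0 -[X in _ <= `|_ + X|](mul0r (1 - b * (s * s))) -Z.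
  by rewrite le_eqVlt; apply/orP; left; apply/eqP; congr (`|_|); ring.
- apply: le_trans (quad_err E h2 n1 h4 n3).
  rewrite -[X in _ <= `|X|]addr0 -[X in _ <= `|_ + X|](mul0r (b * (c * s))) -Z.
  by rewrite le_eqVlt; apply/orP; left; apply/eqP; congr (`|_|); ring.
- apply: le_trans (quad_err E h3 n1 h4 n2).
  rewrite -[X in _ <= `|X|]addr0 -[X in _ <= `|_ + X|](mul0r (- (b * (c * s)))) -Z.
  by rewrite le_eqVlt; apply/orP; left; apply/eqP; congr (`|_|); ring.
- apply: le_trans (quad_err E h4 n2 n3 h1).
  rewrite -[X in _ <= `|X|]addr0 -[X in _ <= `|_ + X|](mul0r (1 + b * (c * c))) -Z.
  by rewrite le_eqVlt; apply/orP; left; apply/eqP; congr (`|_|); ring.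
Qed.

Lemma entries p : [/\ 98 / 10 ^+ 2 <= ee p, ed p <= 102 / 10 ^+ 2,
  97 / 10 ^+ 4 <= ed p - ee p, `|eb p| <= 2 / 10 ^+ 4 & `|ec p| <= 2 / 10 ^+ 4].
Proof.
have [r1 r2 r3 r4] := rotation_bounds p; have [m1 m2 m3 m4] := main_entries p.
have E := cs1 p.
have kb : `|k p| <= 1 / 2.
  have := sqr_ge0 (cT p - sT p); have := sqr_ge0 (cT p + sT p).
  by rewrite ler_norml /k => ? ?; apply/andP; split; nra.
have s0 := sqr_ge0 (sT p); have c0 := sqr_ge0 (cT p); rewrite !expr2 in s0 c0 E.
rewrite /ee /ec /eb /ed.
exact: (rotated_entries r1 r2 r3 r4 m1 m2 m3 m4 E kb s0 c0).
Qed.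

End Frames.

(** Apart from the errors, a cross-multiplied comparison of two weighted means of [A] and [E]:
    weight [M] on [E] in the first, weight [N] on [A] in the second. The difference is
    [(E - A) * (1 - M * N)]. *)
Lemma gap_alg (R : realType) (A E M N : R) : 0 <= M -> M <= 1 / 400 -> 0 <= N -> N <= 1 / 400 ->
  A <= E - 19 / 10 ^+ 3 ->
  (A + E * M + 5 / 10 ^+ 5) * (1 + N) < (E + A * N - 5 / 10 ^+ 5) * (1 + M).
Proof.
move=> M0 M1 N0 N1 AE.
have MN : M * N <= 1 / 400 * (1 / 400) by exact: ler_pM.
have MN0 : 0 <= M * N by rewrite mulr_ge0.
have K : 19 / 10 ^+ 3 * (1 - M * N) <= (E - A) * (1 - M * N).
  by rewrite ler_wpM2r //; lra.
have K2 : (E + A * N - 5 / 10 ^+ 5) * (1 + M) - (A + E * M + 5 / 10 ^+ 5) * (1 + N) =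
  (E - A) * (1 - M * N) - 5 / 10 ^+ 5 * (2 + M + N) by ring.
rewrite -subr_gt0 K2; lra.
Qed.

Lemma sqr_gap (R : realType) (a d : R) : 98 / 10 ^+ 2 <= a -> 97 / 10 ^+ 4 <= d - a -> a ^+ 2 <= d ^+ 2 - 19 / 10 ^+ 3.
Proof.
move=> h1 h3; have : 97 / 10 ^+ 4 * (196 / 10 ^+ 2) <= (d - a) * (d + a) by apply: ler_pM; lra.
by rewrite -subr_sqr; lra.
Qed.

(** Domination for directions of slope [m] and [f] in the frame: each sum of squares is the squared
    length of an image, and the factors [1 + m ^+ 2] and [1 + f ^+ 2] are the squared lengths of the
    vectors themselves. The entries [b] and [c] contribute only the error [5 / 10 ^+ 5] on each
    side. *)
Lemma rate_gap (R : realType) (a b c d m f : R) : 98 / 10 ^+ 2 <= a -> d <= 102 / 10 ^+ 2 ->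
  97 / 10 ^+ 4 <= d - a -> `|b| <= 2 / 10 ^+ 4 -> `|c| <= 2 / 10 ^+ 4 ->
  `|m| <= 1 / 20 -> `|f| <= 1 / 20 ->
  ((a + b * m) ^+ 2 + (c + d * m) ^+ 2) * (1 + f ^+ 2) <
  ((a * f + b) ^+ 2 + (c * f + d) ^+ 2) * (1 + m ^+ 2).
Proof.
move=> h1 h2 h3 hb hc hm hf.
have sq_le (x y : R) : `|x| <= y -> x ^+ 2 <= y ^+ 2.
  by move=> hx; rewrite -(real_normK (num_real x)) ler_pXn2r ?nnegrE // (le_trans _ hx).
have ab : `|a * b| <= 102 / 10 ^+ 2 * (2 / 10 ^+ 4).
  by apply: mul_abs_le => //; rewrite ger0_norm; move: h1 h2 h3; clear; lra.
have cd : `|c * d| <= 2 / 10 ^+ 4 * (102 / 10 ^+ 2).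
  by apply: mul_abs_le => //; rewrite ger0_norm; move: h1 h2 h3; clear; lra.
have m2 := sq_le _ _ hm; have f2 := sq_le _ _ hf.
have m0 := sqr_ge0 m; have f0 := sqr_ge0 f.
have b2 := sq_le _ _ hb; have csq := sq_le _ _ hc.
have b0 := sqr_ge0 b; have c0 := sqr_ge0 c.
have le1 (x : R) : x <= (1 / 20) ^+ 2 -> x <= 1 / 400 by lra.
have m4 := le1 _ m2; have f4 := le1 _ f2.
have abm := mul_abs_le ab hm; have abf := mul_abs_le ab hf.
have cdm := mul_abs_le cd hm; have cdf := mul_abs_le cd hf.
have b2m : b ^+ 2 * m ^+ 2 <= b ^+ 2 by rewrite ler_piMr //; move: m4; clear; lra.
have c2f : 0 <= c ^+ 2 * f ^+ 2 by rewrite mulr_ge0.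
have a2 := sqr_gap h1 h3.
pose A := a ^+ 2; pose E := d ^+ 2; pose M := m ^+ 2; pose N := f ^+ 2.
have L : (a + b * m) ^+ 2 + (c + d * m) ^+ 2 <= A + E * M + 5 / 10 ^+ 5.
  have -> : (a + b * m) ^+ 2 + (c + d * m) ^+ 2 =
    A + E * M + (2 * (a * b * m) + 2 * (c * d * m) + b ^+ 2 * m ^+ 2 + c ^+ 2).
    by rewrite /A /E /M; ring.
  move: (ler_normlW abm) (ler_normlW cdm) b2m csq b2; clear; lra.
have U : E + A * N - 5 / 10 ^+ 5 <= (a * f + b) ^+ 2 + (c * f + d) ^+ 2.
  have -> : (a * f + b) ^+ 2 + (c * f + d) ^+ 2 =
    E + A * N + (2 * (a * b * f) + 2 * (c * d * f) + b ^+ 2 + c ^+ 2 * f ^+ 2).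
    by rewrite /A /E /N; ring.
  move: (lerNnormlW abf) (lerNnormlW cdf) c2f b0; clear; lra.
have pf : 0 <= 1 + f ^+ 2 by rewrite addr_ge0.
have pm : 0 <= 1 + m ^+ 2 by rewrite addr_ge0.
apply: le_lt_trans (ler_wpM2r pf L) _; apply: lt_le_trans (ler_wpM2r pm U).
exact: (gap_alg m0 m4 f0 f4 a2).
Qed.

(** * The dominated splitting of a perturbation *)

Section Splitting.
Variable R : realType.
Notation V := 'rV[R]_2.
Notation T := (torus R).
Implicit Types (v w : V) (p q : T).

Variable g : diffeo R.
Hypothesis gf : C1_close (e0 R) (fdiffeo R) g.
Local Notation D := (diffeo_diff g).

Lemma g_cts : continuous g.
Proof.
apply: torus_continuous; rewrite (_ : _ \o _ = @tproj R \o G gf).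
  move=> v; apply: continuous_comp; last exact: tproj_continuous.
  by apply: differentiable_continuous; exact: (@ex_diff _ _ _ _ _ _ _ (G_diff gf v)).
by apply/funext => v; rewrite /= tproj_G.
Qed.

Lemma ginv_cts : continuous (diffeo_inv g).
Proof.
apply: torus_continuous; rewrite (_ : _ \o _ = @tproj R \o Ginv gf).
  move=> v; apply: continuous_comp; last exact: tproj_continuous.
  by apply: differentiable_continuous; exact: (@ex_diff _ _ _ _ _ _ _ (Ginv_diff gf v)).
by apply/funext => v; rewrite /= tproj_Ginv.
Qed.

Lemma D_row_cts (w : V) : continuous (fun p => w *m D p).
Proof. by apply: torus_continuous; have [_] := diffeo_C1 g; apply. Qed.

Lemma D_entry_cts i j : continuous (fun p => D p i j).
Proof.
have H (w : V) p : {for p, continuous (fun p => px (w *m D p))} /\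
    {for p, continuous (fun p => py (w *m D p))}.
  have h : {for p, continuous (fun p => w *m D p)} by exact: D_row_cts.
  by split; [exact: (continuous_comp h (@px_continuous R _))
            |exact: (continuous_comp h (@py_continuous R _))].
move=> p; have [h1 h2] := H (pt 1 0) p; have [h3 h4] := H (pt 0 1) p.
case: (ord2P i) => ->; case: (ord2P j) => ->.
- rewrite (_ : (fun p => _) = fun p => px (pt 1 0 *m D p)) //.
  by apply/funext => q; rewrite px_mul !pE; ring.
- rewrite (_ : (fun p => _) = fun p => py (pt 1 0 *m D p)) //.
  by apply/funext => q; rewrite py_mul !pE; ring.
- rewrite (_ : (fun p => _) = fun p => px (pt 0 1 *m D p)) //.
  by apply/funext => q; rewrite px_mul !pE; ring.
- rewrite (_ : (fun p => _) = fun p => py (pt 0 1 *m D p)) //.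
  by apply/funext => q; rewrite py_mul !pE; ring.
Qed.

Let ctsM (a b : T -> R) : continuous a -> continuous b -> continuous (fun p => a p * b p).
Proof. by move=> ha hb p; exact: cvgM (ha p) (hb p). Qed.
Let ctsD (a b : T -> R) : continuous a -> continuous b -> continuous (fun p => a p + b p).
Proof. by move=> ha hb p; exact: cvgD (ha p) (hb p). Qed.
Let ctsB (a b : T -> R) : continuous a -> continuous b -> continuous (fun p => a p - b p).
Proof. by move=> ha hb p; exact: cvgB (ha p) (hb p). Qed.
Let ctsN (a : T -> R) : continuous a -> continuous (fun p => - a p).
Proof. by move=> ha p; exact: cvgN (ha p). Qed.
Let cts_comp (a : T -> R) (k : T -> T) : continuous k -> continuous a -> continuous (fun p => a (k p)).
Proof. by move=> hk ha p; exact: (continuous_comp (hk p) (ha (k p))). Qed.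

Let c1 := cT_cts (R := R). Let s1 := sT_cts (R := R).
Let c2 := cts_comp g_cts c1. Let s2 := cts_comp g_cts s1.

Let cwc : continuous (cw g). Proof. by apply: ctsD; apply: ctsM. Qed.
Let swc : continuous (sw g). Proof. by apply: ctsB; apply: ctsM. Qed.
Let D00 := @D_entry_cts 0 0. Let D01 := @D_entry_cts 0 1.
Let D10 := @D_entry_cts 1 0. Let D11 := @D_entry_cts 1 1.
Let Pc : continuous (eP g).
Proof. by apply: ctsD; [apply: ctsD|]; apply: ctsM => //; (exact: ctsM || exact: ctsD). Qed.
Let Qc : continuous (eQ g).
Proof. by apply: ctsD; [apply: ctsB|]; apply: ctsM => //; (exact: ctsM || exact: ctsB). Qed.
Let Uc : continuous (eU g).
Proof. by apply: ctsB; [apply: ctsD|]; apply: ctsM => //; (exact: ctsM || exact: ctsB). Qed.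
Let Wc : continuous (eW g).
Proof. by apply: ctsD; [apply: ctsB|]; apply: ctsM => //; (exact: ctsM || exact: ctsD). Qed.
Let eec : continuous (ee g). Proof. by apply: ctsD; exact: ctsM. Qed.
Let ecc : continuous (ec g). Proof. by apply: ctsB; exact: ctsM. Qed.
Let ebc : continuous (eb g). Proof. by apply: ctsD; exact: ctsM. Qed.
Let edc : continuous (ed g). Proof. by apply: ctsB; exact: ctsM. Qed.

Lemma graphs_exist : exists mE mF : T -> R,
  [/\ continuous mE /\ continuous mF,
     forall p, `|mE p| <= 1 / 20 /\ `|mF p| <= 1 / 20,
     forall p, (nuE p + mE p *: nuF p) *m D p =
        (ee g p + eb g p * mE p) *: (nuE (g p) + mE (g p) *: nuF (g p)) &
     forall p, (nuF p + mF p *: nuE p) *m D p =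
        (ec g p * mF p + ed g p) *: (nuF (g p) + mF (g p) *: nuE (g p))].
Proof.
have [|mE [cE bE iE]] := invariant_graph g_cts eec (ctsN ecc) (ctsN ebc) edc.
  by move=> p; have [? ? ? ? ?] := entries gf p; rewrite !normrN.
have [|mF [cF bF iF]] := invariant_graph ginv_cts (cts_comp ginv_cts eec)
    (cts_comp ginv_cts ebc) (cts_comp ginv_cts ecc) (cts_comp ginv_cts edc).
  by move=> p; exact: entries gf (diffeo_inv g p).
exists mE, mF; split => //.
- move=> p; rewrite mulmxDl -scalemxAl nuE_image nuF_image.
  have [e1 e2 e3 e4 e5] := entries gf p.
  have den : - eb g p * mE (g p) + ed g p != 0.
    rewrite gt_eqF //; have := bE (g p); have : `|eb g p * mE (g p)| <= 2 / 10 ^+ 4 * (1 / 20).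
      by apply: mul_abs_le.
    rewrite ler_norml => /andP[? ?] _; lra.
  have E : ec g p + ed g p * mE p = mE (g p) * (ee g p + eb g p * mE p).
    by rewrite iE; field.
  apply: plane_ext; rewrite !pE.
    transitivity ((ee g p + eb g p * mE p) * cT (g p) - (ec g p + ed g p * mE p) * sT (g p)); first by ring.
    by rewrite E; ring.
  transitivity ((ee g p + eb g p * mE p) * sT (g p) + (ec g p + ed g p * mE p) * cT (g p)); first by ring.
  by rewrite E; ring.
- move=> p; rewrite mulmxDl -scalemxAl nuE_image nuF_image.
  have [e1 e2 e3 e4 e5] := entries gf p.
  have den : ec g p * mF p + ed g p != 0.
    rewrite gt_eqF //; have : `|ec g p * mF p| <= 2 / 10 ^+ 4 * (1 / 20).
      by apply: mul_abs_le.
    rewrite ler_norml => /andP[? ?]; lra.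
  have E : eb g p + ee g p * mF p = mF (g p) * (ec g p * mF p + ed g p).
    by rewrite (iF (g p)) diffeo_funK; field.
  apply: plane_ext; rewrite !pE.
    transitivity ((ec g p * mF p + ed g p) * (- sT (g p)) + (eb g p + ee g p * mF p) * cT (g p)); first by ring.
    by rewrite E; ring.
  transitivity ((ec g p * mF p + ed g p) * cT (g p) + (eb g p + ee g p * mF p) * sT (g p)); first by ring.
  by rewrite E; ring.
Qed.

Definition line_bundle (e : T -> V) (p : T) : {vspace V} := <[e p]>%VS.

Lemma line_image (f : 'End(V)) (v : V) : (f @: <[v]> = <[f v]>)%VS.
Proof. exact: limg_line. Qed.

Lemma scaled_line (a : R) (v : V) : a != 0 -> (<[a *: v]> = <[v]>)%VS.
Proof.
move=> a0; apply/eqP; rewrite eqEsubv; apply/andP; split; rewrite -memvE.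
  by rewrite memvZ // memv_line.
by apply/vlineP; exists a^-1; rewrite scalerA mulVf // scale1r.
Qed.

Lemma line_dist_le (v w : V) : v != 0 -> w != 0 ->
  line_dist <[v]> <[w]> <= enorm ((enorm v)^-1 *: v - (enorm w)^-1 *: w).
Proof.
have en (u : V) : u != 0 -> enorm ((enorm u)^-1 *: u) = 1.
  move=> u0; have n0 : enorm u != 0.
    apply: contra_neq u0 => E; apply: plane_ext; rewrite ?px0 ?py0; apply/eqP; rewrite -normr_le0 -E.
      exact: px_le_enorm.
    exact: py_le_enorm.
  by rewrite enormZ ger0_norm ?invr_ge0 ?enorm_ge0 // mulVf.
move=> v0 w0; apply: ge_inf.
  by exists 0 => d [x [y [_ _ _ _ ->]]]; exact: enorm_ge0.
by exists ((enorm v)^-1 *: v), ((enorm w)^-1 *: w); rewrite !memvZ ?memv_line ?en.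
Qed.

Lemma line_subbundle (e : T -> V) : continuous (px \o e) -> continuous (py \o e) ->
  (forall p, e p != 0) -> subbundle1 (line_bundle e).
Proof.
move=> cx cy e0; split=> [p|p d d0]; first by rewrite dim_vline e0.
have en0 q : enorm (e q) != 0.
  apply: contra_neq (e0 q) => E; apply: plane_ext; rewrite ?px0 ?py0; apply/eqP; rewrite -normr_le0 -E.
    exact: px_le_enorm.
  exact: py_le_enorm.
have cn : continuous (fun q => enorm (e q)).
  rewrite (_ : (fun q => _) = fun q => Num.sqrt (px (e q) * px (e q) + py (e q) * py (e q))).
    by move=> q; exact: (continuous_comp (ctsD (ctsM cx cx) (ctsM cy cy) (x := q)) (@sqrt_continuous R _)).
  by apply/funext => q; rewrite enormE !expr2.
have ci : continuous (fun q => (enorm (e q))^-1) by move=> q; exact: cvgV (en0 q) (cn q).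
have cu : continuous (fun q => (enorm (e q))^-1 *: e q).
  apply: norm_pt_continuous.
    rewrite (_ : px \o _ = fun q => (enorm (e q))^-1 * (px \o e) q); first exact: ctsM.
    by apply/funext => q; rewrite /= pxZ.
  rewrite (_ : py \o _ = fun q => (enorm (e q))^-1 * (py \o e) q); first exact: ctsM.
  by apply/funext => q; rewrite /= pyZ.
have d2 : 0 < d / 2 by rewrite divr_gt0.
have Hn : \forall q \near p, `|(enorm (e p))^-1 *: e p - (enorm (e q))^-1 *: e q| < d / 2.
  by move/cvgrPdist_lt : (cu p); apply.
apply: filterS Hn => q H.
apply: le_lt_trans (line_dist_le (e0 p) (e0 q)) _.
apply: le_lt_trans (enorm_le_norm _) _; by rewrite -ltr_pdivlMl // mulrC.
Qed.

Lemma enorm_nuE_comb (a b : R) p : enorm (a *: nuE p + b *: nuF p) = Num.sqrt (a ^+ 2 + b ^+ 2).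
Proof.
by rewrite enormE !pE -[in RHS](mulr1 (a ^+ 2 + _)) -(cs1 p); congr Num.sqrt; ring.
Qed.

Lemma nuE_comb_inj (a b a' b' : R) p :
  a *: nuE p + b *: nuF p = a' *: nuE p + b' *: nuF p -> a = a' /\ b = b'.
Proof.
move=> E; have h1 := congr1 px E; have h2 := congr1 py E; rewrite !pE in h1 h2.
have h := cs1 p; split.
  transitivity ((a * cT p + b * - sT p) * cT p + (a * sT p + b * cT p) * sT p).
    by rewrite -[LHS]mulr1 -h; ring.
  by rewrite h1 h2 -[RHS]mulr1 -h; ring.
transitivity ((a * cT p + b * - sT p) * (- sT p) + (a * sT p + b * cT p) * cT p).
  by rewrite -[LHS]mulr1 -h; ring.
by rewrite h1 h2 -[RHS]mulr1 -h; ring.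
Qed.

Lemma unit_comb (a m : R) (u : V) p (H : u = a *: (nuE p + m *: nuF p) \/ u = a *: (nuF p + m *: nuE p)) :
  enorm u = 1 -> a ^+ 2 * (1 + m ^+ 2) = 1.
Proof.
move=> u1; have := enorm_sqr u; rewrite u1 expr1n => E.
have h := cs1 p; rewrite [RHS]E; transitivity (a ^+ 2 * (1 + m ^+ 2) * (cT p ^+ 2 + sT p ^+ 2)).
  by rewrite h mulr1.
by case: H => ->; rewrite !pE; ring.
Qed.

Definition dirE (m : T -> R) p := nuE p + m p *: nuF p.
Definition dirF (m : T -> R) p := nuF p + m p *: nuE p.

Lemma bundles_split (mE mF : T -> R) : continuous mE -> continuous mF ->
  (forall p, `|mE p| <= 1 / 20 /\ `|mF p| <= 1 / 20) ->
  (forall p, (nuE p + mE p *: nuF p) *m D p =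
        (ee g p + eb g p * mE p) *: (nuE (g p) + mE (g p) *: nuF (g p))) ->
  (forall p, (nuF p + mF p *: nuE p) *m D p =
        (ec g p * mF p + ed g p) *: (nuF (g p) + mF (g p) *: nuE (g p))) ->
  dominated_splitting g (line_bundle (dirE mE))
    (line_bundle (dirF mF)).
Proof.
move=> cE cF bm iE iF.
have eE0 p : dirE mE p != 0.
  apply/eqP => E; have [] := @nuE_comb_inj 1 (mE p) 0 0 p; last by move/eqP; rewrite oner_eq0.
  by rewrite scale1r [LHS]E !scale0r addr0.
have eF0 p : dirF mF p != 0.
  apply/eqP => E; have [] := @nuE_comb_inj (mF p) 1 0 0 p; last by move=> _ /eqP; rewrite oner_eq0.
  by rewrite scale1r addrC [LHS]E !scale0r addr0.
have lE p : ee g p + eb g p * mE p != 0.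
  have [e1 e2 e3 e4 e5] := entries gf p; have [h _] := bm p; have := mul_abs_le e4 h.
  by rewrite ler_norml => /andP[? ?]; rewrite gt_eqF //; lra.
have lF p : ec g p * mF p + ed g p != 0.
  have [e1 e2 e3 e4 e5] := entries gf p; have [_ h] := bm p; have := mul_abs_le e5 h.
  by rewrite ler_norml => /andP[? ?]; rewrite gt_eqF //; lra.
have cap p : (line_bundle (dirE mE) p :&:
    line_bundle (dirF mF) p)%VS = 0%VS.
  apply/eqP; rewrite -subv0; apply/subvP => w /memv_capP[/vlineP[a ->] /vlineP[b E]].
  have [|h1 h2] := @nuE_comb_inj a (a * mE p) (b * mF p) b p.
    by move: E; rewrite /dirE /dirF !scalerDr !scalerA => ->; rewrite addrC.
  have [h3 h4] := bm p.
  have : a * (1 - mE p * mF p) = 0 by rewrite mulrBr mulr1 mulrA h2 -h1 subrr.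
  have := mul_abs_le h3 h4; rewrite ler_norml => /andP[_ h5] /eqP.
  rewrite mulf_eq0 => /orP[/eqP ->|]; first by rewrite scale0r mem0v.
  by rewrite gt_eqF //; lra.
split.
- split; apply: line_subbundle => //.
  + rewrite (_ : px \o _ = fun p => cT p + mE p * (- sT p)); last by apply/funext => p; rewrite /= /dirE /dirF !pE.
    by apply: ctsD => //; apply: ctsM => //; exact: ctsN.
  + rewrite (_ : py \o _ = fun p => sT p + mE p * cT p); last by apply/funext => p; rewrite /= /dirE /dirF !pE.
    by apply: ctsD => //; apply: ctsM.
  + rewrite (_ : px \o _ = fun p => - sT p + mF p * cT p); last by apply/funext => p; rewrite /= /dirE /dirF !pE.
    by apply: ctsD; [exact: ctsN|exact: ctsM].
  + rewrite (_ : py \o _ = fun p => cT p + mF p * sT p); last by apply/funext => p; rewrite /= /dirE /dirF !pE.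
    by apply: ctsD => //; exact: ctsM.
- move=> p; have dv : directv (line_bundle (dirE mE) p +
    line_bundle (dirF mF) p) by apply/directv_addP; exact: cap.
  split => //; apply/eqP; rewrite eqEdim subvf /=.
  rewrite (directvP dv) /= !dim_vline eE0 eF0 dimvf /dim /=.
  by rewrite mul1n.
- split=> p; rewrite /line_bundle line_image lfunE /=.
    by rewrite /dirE iE scaled_line.
  by rewrite /dirF iF scaled_line.
- move=> p u v /vlineP[a ->] /vlineP[b ->] /(unit_comb (or_introl erefl)) ha
    /(unit_comb (or_intror erefl)) hb.
  have [e1 e2 e3 e4 e5] := entries gf p; have [h1 h2] := bm p.
  have gap := rate_gap e1 e2 e3 e4 e5 h1 h2.
  rewrite /dirE /dirF -!scalemxAl !mulmxDl -!scalemxAl nuE_image nuF_image.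
  have -> : a *: (ee g p *: nuE (g p) + ec g p *: nuF (g p) +
      mE p *: (eb g p *: nuE (g p) + ed g p *: nuF (g p))) =
      (a * (ee g p + eb g p * mE p)) *: nuE (g p) + (a * (ec g p + ed g p * mE p)) *: nuF (g p).
    by apply: plane_ext; rewrite !pE; ring.
  have -> : b *: (eb g p *: nuE (g p) + ed g p *: nuF (g p) +
      mF p *: (ee g p *: nuE (g p) + ec g p *: nuF (g p))) =
      (b * (ee g p * mF p + eb g p)) *: nuE (g p) + (b * (ec g p * mF p + ed g p)) *: nuF (g p).
    by apply: plane_ext; rewrite !pE; ring.
  rewrite !enorm_nuE_comb ltr_sqrt; last first.
    have h3 : 0 < b ^+ 2 * (ec g p * mF p + ed g p) ^+ 2.
      rewrite mulr_gt0 // ?exprn_even_gt0 //=.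
      by apply/eqP => b0; move/eqP: hb; rewrite b0 expr0n mul0r eq_sym oner_eq0.
    by rewrite !exprMn; apply: ltr_wpDl => //; rewrite mulr_ge0 ?sqr_ge0.
  rewrite !exprMn -!mulrDr.
  have a0 : 0 < 1 + mE p ^+ 2 by rewrite ltr_pwDl ?sqr_ge0.
  have b0 : 0 < 1 + mF p ^+ 2 by rewrite ltr_pwDl ?sqr_ge0.
  have -> : a ^+ 2 = (1 + mE p ^+ 2)^-1 by apply: (mulIf (lt0r_neq0 a0)); rewrite ha mulVf // gt_eqF.
  have -> : b ^+ 2 = (1 + mF p ^+ 2)^-1 by apply: (mulIf (lt0r_neq0 b0)); rewrite hb mulVf // gt_eqF.
  by rewrite [X in X < _]mulrC [X in _ < X]mulrC ltr_pdivrMr // mulrAC ltr_pdivlMr //.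
Qed.

End Splitting.

(** * Merging of tangent curves *)

Section Constants.
Variable R : realType.
Notation V := 'rV[R]_2.
Implicit Types (v w : V).
Local Notation om := (om R). Local Notation fr := (fr R).
Local Notation cc := (cc R). Local Notation aa := (aa R).

(** The triple 3, 4, 5 makes the sines and cosines of [om * x0] and [fr * t0] rational. In the box
    [cos (om * x)] and [cos (2 * fr * t)] are at least 3/5 and 7/25, which gives expansion; at the
    sides [sin (om * x)] is 4/5 and [sin (2 * fr * t)] is 24/25 in absolute value, which gives
    outward drift; and the frame has slope at most 3/4, so that lines of the cone stay flat. *)
Definition x0 : R := acos (3 / 5) / om.
Definition t0 : R := asin (3 / 5) / fr.
(* [ll = 2 aa] bounds the horizontal displacement by one iterate. *)
Definition ll : R := 32 * cc.

Let h35 : -1 <= (3 / 5 : R) <= 1. Proof. by apply/andP; split; lra. Qed.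
Let sq45 : Num.sqrt (1 - (3 / 5) ^+ 2) = 4 / 5 :> R.
Proof.
have -> : 1 - (3 / 5) ^+ 2 = (4 / 5) ^+ 2 :> R by field.
by rewrite sqrtr_sqr ger0_norm //; lra.
Qed.
Let omx0 : om * x0 = acos (3 / 5).
Proof. by rewrite /x0 mulrC divfK // gt_eqF // om_gt0. Qed.
Let frt0 : fr * t0 = asin (3 / 5).
Proof. by rewrite /t0 mulrC divfK // gt_eqF // fr_gt0. Qed.

Lemma cos_x0 : cos (om * x0) = 3 / 5.
Proof. by rewrite omx0 acosK // in_itv /=. Qed.
Lemma sin_x0 : sin (om * x0) = 4 / 5.
Proof. by rewrite omx0 sin_acos. Qed.
Lemma sin_t0 : sin (fr * t0) = 3 / 5.
Proof. by rewrite frt0 asinK // in_itv /=. Qed.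
Lemma cos_t0 : cos (fr * t0) = 4 / 5.
Proof. by rewrite frt0 cos_asin. Qed.

Lemma cc_fr' : cc * fr = 5 / 10 ^+ 3.
Proof. by have := cc_fr R; lra. Qed.

Lemma e0_cc : e0 R <= cc / 10 ^+ 2.
Proof. by rewrite e0E; have /andP[h _] := cc_bounds R; lra. Qed.

Lemma x0_bounds : 0 < x0 < 1 / 2.
Proof.
have o0 := om_gt0 R; have p0 := pi_gt0 R.
rewrite /x0 divr_gt0 //=; last by rewrite acos_gt0 //; apply/andP; split; lra.
rewrite ltr_pdivrMr //.
have : acos (3 / 5 : R) < pi by rewrite acos_ltpi //; apply/andP; split; lra.
by rewrite /om -mulr_natr; lra.
Qed.

Lemma t0_bounds : 0 < t0 < 1 / 10 ^+ 3.
Proof.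
have f0 := fr_gt0 R; have p0 := pi_gt0 R.
have a1 : asin (3 / 5 : R) <= pi / 2 by apply: asin_lepi2.
have a0 : 0 < asin (3 / 5 : R).
  have := asin_geNpi2 h35 => h; rewrite ltNge; apply/negP => h0.
  have : sin (asin (3 / 5 : R)) <= sin 0.
    rewrite leNgt ltr_sin ?in_itv /=; first by rewrite -leNgt.
      by apply/andP; split; lra.
    by rewrite h a1.
  by rewrite asinK ?in_itv //= sin0; lra.
rewrite /t0 divr_gt0 //= ltr_pdivrMr //.
apply: le_lt_trans a1 _; rewrite /fr /KN /om -mulr_natr.
have := pihalf_lt2 R; have := pihalf_ge1 R; lra.
Qed.

Let cos_mono (q z y : R) : 0 < q -> q * z <= pi -> `|y| <= z -> cos (q * z) <= cos (q * y).
Proof.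
move=> q0 qz yz; have n0 := normr_ge0 y.
rewrite -(cos_norm (q * y)) normrM gtr0_norm // leNgt ltr_cos ?in_itv /= -?leNgt.
- by rewrite ler_pM2l.
- by rewrite qz andbT; apply: mulr_ge0; [exact: ltW|exact: le_trans yz].
- by rewrite (mulr_ge0 (ltW q0) n0) /=; apply: le_trans qz; rewrite ler_pM2l.
Qed.

Lemma box_cos_x x : `|x| <= x0 -> 3 / 5 <= cos (om * x).
Proof.
move=> hx; rewrite -cos_x0; apply: cos_mono => //; first exact: om_gt0.
by rewrite omx0 acos_lepi.
Qed.

Lemma box_cos_t y : `|y| <= t0 -> 4 / 5 <= cos (fr * y).
Proof.
move=> hy; rewrite -cos_t0; apply: cos_mono => //; first exact: fr_gt0.
rewrite frt0; have := asin_lepi2 h35; have := pi_gt0 R; lra.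
Qed.

Lemma box_sin_t y : `|y| <= t0 -> `|sin (fr * y)| <= 3 / 5.
Proof.
move=> /box_cos_t h; have := cos2Dsin2 (fr * y).
move: (cos _) (sin _) h => c s h E.
by rewrite ler_norml; apply/andP; split; nra.
Qed.

(* Slightly larger boxes, for points moved by at most one iterate. *)
Lemma near_cos_x x d : `|x| <= x0 + d -> 0 <= d <= 100 * cc -> 59 / 10 ^+ 2 <= cos (om * x).
Proof.
move=> hx /andP[d0 d1]; have xb := x0_bounds.
have [y [hy xy]] : exists y, `|y| <= x0 /\ `|x - y| <= d.
  have [h|h] := leP `|x| x0; first by exists x; rewrite subrr normr0.
  have [x_pos|x_neg] := leP 0 x.
    exists x0; move: hx h; rewrite (ger0_norm x_pos) => hx h.
    by rewrite (@ger0_norm _ x0); [split => //; rewrite ler_norml; apply/andP; split; lra|lra].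
  exists (- x0); rewrite normrN opprK; move: hx h; rewrite (ltr0_norm x_neg) => hx h.
  by rewrite (@ger0_norm _ x0); [split => //; rewrite ler_norml; apply/andP; split; lra|lra].
have h1 := box_cos_x hy; have := cos_lip (om * x) (om * y).
rewrite -mulrBr normrM gtr0_norm ?om_gt0 // => h2.
have h3 : om * `|x - y| <= om * d by rewrite ler_pM2l ?om_gt0.
have h4 : om * d <= om * (100 * cc) by rewrite ler_pM2l ?om_gt0.
have := aa_omE R; rewrite /aa => h5.
have {h2}: `|cos (om * x) - cos (om * y)| <= 1 / 10 ^+ 3 by lra.
by rewrite ler_norml => /andP[? ?]; lra.
Qed.

Lemma near_t y : `|y| <= t0 + 2 * cc ->
  79 / 10 ^+ 2 <= cos (fr * y) /\ `|sin (fr * y)| <= 61 / 10 ^+ 2.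
Proof.
move=> hy; have tb := t0_bounds; have c0 := cc_gt0 R.
have [z [hz yz]] : exists z, `|z| <= t0 /\ `|y - z| <= 2 * cc.
  have [h|h] := leP `|y| t0; first by exists y; rewrite subrr normr0; split => //; lra.
  have [y_pos|y_neg] := leP 0 y.
    exists t0; move: hy h; rewrite (ger0_norm y_pos) => hy h.
    by rewrite (@ger0_norm _ t0); [split => //; rewrite ler_norml; apply/andP; split; lra|lra].
  exists (- t0); rewrite normrN opprK; move: hy h; rewrite (ltr0_norm y_neg) => hy h.
  by rewrite (@ger0_norm _ t0); [split => //; rewrite ler_norml; apply/andP; split; lra|lra].
have h1 := box_cos_t hz; have h1' := box_sin_t hz.
have := cos_lip (fr * y) (fr * z); have := sin_lip (fr * y) (fr * z).
rewrite -mulrBr normrM gtr0_norm ?fr_gt0 //.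
have h3 : fr * `|y - z| <= fr * (2 * cc) by rewrite ler_pM2l ?fr_gt0.
have h5 := cc_fr'; set q := fr * `|_| in h3 *.
move: h1'; rewrite !ler_norml => /andP[? ?] /andP[? ?] /andP[? ?].
by split; [lra|apply/andP; split; lra].
Qed.

(* The weight of the vertical coordinate absorbs the shear [- cc (2 fr) sin (2 fr t)]. *)
Definition nrm v := Num.max `|px v| (10 ^+ 4 * `|py v|).
Definition thx : R := 1 + 1 / 10 ^+ 6.

Lemma nrm_ge v : `|v| <= nrm v.
Proof.
rewrite [leLHS]/Num.Def.normr /= mx_normrE; apply: bigmax_le.
  by rewrite /nrm le_max normr_ge0.
move=> [i j] _ /=; rewrite (ord1 i) /nrm le_max; case: (ord2P j) => ->; apply/orP; [left|right] => //.
by rewrite -/(py v); have := normr_ge0 (py v); lra.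
Qed.

Lemma nrm_box v w : box x0 t0 v -> box x0 t0 w -> nrm (v - w) <= 10 ^+ 2.
Proof.
have xb := x0_bounds; have tb := t0_bounds.
move=> [v1 v2] [w1 w2]; rewrite /nrm ge_max !pE; apply/andP; split.
  by apply: le_trans (ler_normB _ _) _; lra.
have := ler_normB (py v) (py w); lra.
Qed.

End Constants.

Section Cone.
Variable R : realType.
Notation V := 'rV[R]_2.
Variable K : V -> V -> Prop.
Local Notation fr := (fr R). Local Notation cc := (cc R).

(* [K v w] implies that [w] makes an angle of tangent at most 1/20 with the direction of angle
   [fr t]. *)
Definition in_cone := forall v w, K v w -> exists a m : R, `|m| <= 1 / 20 /\
  w = pt (a * (cos (fr * py v) - m * sin (fr * py v))) (a * (sin (fr * py v) + m * cos (fr * py v))).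
Hypothesis K_cone : in_cone.

Lemma mul_small (m z c : R) : `|m| <= 1 / 20 -> `|z| <= c -> `|m * z| <= c / 20.
Proof. by move=> hm hz; apply: le_trans (mul_abs_le hm hz) _; lra. Qed.

Lemma cone_flat_near v w : `|py v| <= t0 R + 2 * cc -> K v w -> w != 0 -> `|py w| <= `|px w|.
Proof.
move=> /near_t[c1 s1] /K_cone[a [m [hm ->]]] _; rewrite !pE !normrM ler_wpM2l //.
have := mul_small hm s1; have := mul_small hm (cos_max (fr * py v)).
move: s1; rewrite !ler_norml => /andP[? ?] /andP[? ?] /andP[? ?].
rewrite (@ger0_norm _ (cos _ - _)); last by lra.
by apply/andP; split; lra.
Qed.

Lemma cone_flat v w : box (x0 R) (t0 R) v -> K v w -> w != 0 -> `|py w| <= `|px w|.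
Proof. by move=> [_ hv]; apply: cone_flat_near; have := cc_gt0 R; lra. Qed.

Lemma sin_strip y : `|y| <= t0 R -> t0 R - ll R / 4 <= y -> 56 / 10 ^+ 2 <= sin (fr * y).
Proof.
move=> hy h1; have := sin_lip (fr * t0 R) (fr * y); rewrite sin_t0 -mulrBr normrM gtr0_norm ?fr_gt0 //.
move: hy; rewrite ler_norml => /andP[_ h2]; rewrite (@ger0_norm _ (t0 R - y)); last by lra.
have : fr * (t0 R - y) <= fr * (8 * cc) by rewrite ler_pM2l ?fr_gt0 //; move: h1; rewrite /ll; lra.
have := cc_fr' R; rewrite ler_norml => ? ? /andP[? ?]; lra.
Qed.

(** At height [t0] the frame has slope 3/4; neither the descent by [ll / 4] nor the opening 1/20 of
    the cone brings the slope down to 1/4. *)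
Lemma cone_top v w : box (x0 R) (t0 R) v -> x0 R - ll R <= px v -> t0 R - ll R / 4 <= py v ->
  K v w -> px w < 0 -> py w < px w / 4.
Proof.
move=> [_ hv] _ h1 /K_cone[a [m [hm ->]]]; rewrite !pE.
have s1 := sin_strip hv h1; have c1 := box_cos_t hv; have s2 := box_sin_t hv.
have := mul_small hm s2; have c2 := cos_le1 (fr * py v).
have := mul_small hm (cos_max (fr * py v)).
move: (cos _) (sin _) s1 c1 s2 c2 => c s s1 c1 s2 c2; rewrite !ler_norml => /andP[u1 u2] /andP[u3 u4] h.
have a0 : a < 0 by rewrite ltNge; apply/negP => a0; have : 0 <= a * (c - m * s) by [apply: mulr_ge0 => //; lra]; lra.
rewrite -mulrA ltr_nM2l //; lra.
Qed.

Lemma cone_bot v w : box (x0 R) (t0 R) v -> x0 R - ll R <= px v -> py v <= - (t0 R - ll R / 4) ->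
  K v w -> px w < 0 -> - (px w / 4) < py w.
Proof.
move=> [_ hv] _ h1 /K_cone[a [m [hm ->]]]; rewrite !pE.
have s1 : 56 / 10 ^+ 2 <= - sin (fr * py v).
  by rewrite -sinN -mulrN; apply: sin_strip; rewrite ?normrN //; lra.
have c1 := box_cos_t hv; have s2 := box_sin_t hv.
have := mul_small hm s2; have c2 := cos_le1 (fr * py v).
have := mul_small hm (cos_max (fr * py v)).
move: (cos _) (sin _) s1 c1 s2 c2 => c s s1 c1 s2 c2; rewrite !ler_norml => /andP[u1 u2] /andP[u3 u4] h.
have a0 : a < 0 by rewrite ltNge; apply/negP => a0; have : 0 <= a * (c - m * s) by [apply: mulr_ge0 => //; lra]; lra.
rewrite -mulrA -mulrN ltr_nM2l //; lra.
Qed.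

(** For a flat vector the horizontal component changes by at most a fifth of itself. Thus images of
    leftward curves still run to the left. *)
Lemma flat_image_sign (w w' : V) (M : 'M[R]_2) : w != 0 -> `|py w| <= `|px w| ->
  `|M 0 0 - 1| <= 1 / 10 -> `|M 1 0| <= 1 / 10 -> w' = w *m M -> 0 < px w * px w'.
Proof.
move=> w0 hw h0 h1 ->; rewrite px_mul.
have pw : px w != 0.
  apply: contra_neq w0 => E; apply: plane_ext; rewrite ?px0 ?py0 //.
  by apply/eqP; rewrite -normr_le0 (le_trans hw) // E normr0.
have p2 : 0 < px w ^+ 2 by rewrite exprn_even_gt0.
have : `|px w * py w| <= px w ^+ 2.
  by rewrite normrM -(real_normK (num_real (px w))) expr2 ler_wpM2l.
move=> h2; have := mul_abs_le h2 h1.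
have : `|px w ^+ 2 * (M 0 0 - 1)| <= px w ^+ 2 * (1 / 10).
  by apply: mul_abs_le => //; rewrite ger0_norm // ltW.
have -> : px w * (px w * M 0 0 + py w * M 1 0) =
  px w ^+ 2 + px w ^+ 2 * (M 0 0 - 1) + px w * py w * M 1 0 by ring.
rewrite !ler_norml => /andP[? ?] /andP[? ?]; lra.
Qed.

End Cone.

(** * The expanding box at the origin *)

Section MergingSource.
Variable R : realType.
Notation V := 'rV[R]_2.
Implicit Types (v w : V).
Local Notation om := (om R). Local Notation fr := (fr R).
Local Notation cc := (cc R). Local Notation aa := (aa R).
Local Notation x0 := (x0 R). Local Notation t0 := (t0 R). Local Notation ll := (ll R).

(** The conclusion of [trap_merge] for the fixed box. It mentions the line field but no dynamics,
    and is all that the two negative results take from the trapping argument. *)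
Definition merging (K : V -> V -> Prop) := forall C1 C1' C2 C2' (b1 b2 : R),
  Ecurve x0 t0 K C1 C1' -> 0 <= b1 -> px (C1 0) = x0 -> `|py (C1 0)| <= t0 -> px (C1' 0) < 0 ->
  ~ box x0 t0 (C1 b1) ->
  Ecurve x0 t0 K C2 C2' -> 0 <= b2 -> px (C2 0) = x0 -> `|py (C2 0)| <= t0 -> px (C2' 0) < 0 ->
  ~ box x0 t0 (C2 b2) ->
  exists T1 T2, [/\ 0 <= T1, 0 <= T2,
    forall u, 0 <= u <= T1 -> box x0 t0 (C1 u) /\ px (C1' u) < 0,
    forall u, 0 <= u <= T2 -> box x0 t0 (C2 u) /\ px (C2' u) < 0 & C1 T1 = C2 T2].

Lemma ll_gt0 : 0 < ll. Proof. by have := cc_gt0 R; rewrite /ll; lra. Qed.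

Lemma ll_le : ll <= x0.
Proof.
have /andP[xp _] := x0_bounds R; have op := om_gt0 R.
have := le_trans (ler_norm _) (sin_norm_le (om * x0)).
rewrite sin_x0 ger0_norm; last by rewrite mulr_ge0 // ltW.
have /andP[_ o8] := om_bounds R.
have : om * x0 <= 8 * x0 by rewrite ler_pM2r.
by have /andP[_ ?] := cc_bounds R; rewrite /ll; lra.
Qed.

Lemma sin_right x : x0 - 100 * cc <= x <= x0 + 100 * cc -> 79 / 10 ^+ 2 <= sin (om * x).
Proof.
move=> /andP[h1 h2]; have := sin_lip (om * x0) (om * x); rewrite sin_x0 -mulrBr normrM gtr0_norm ?om_gt0 //.
have h3 : om * `|x0 - x| <= om * (100 * cc).
  by rewrite ler_pM2l ?om_gt0 // ler_norml; apply/andP; split; lra.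
have := aa_omE R; rewrite /aa => h5.
by rewrite ler_norml => /andP[? ?]; lra.
Qed.

Lemma segment_abs (a b s c : R) : `|a| <= c -> `|b| <= c -> 0 <= s <= 1 -> `|a + s * (b - a)| <= c.
Proof.
rewrite !ler_norml => /andP[? ?] /andP[? ?] /andP[? ?]; apply/andP; split; nra.
Qed.

Lemma mvt_components (H : V -> V) (DH : V -> 'M[R]_2) v w :
  (forall u, is_diff u H (fun z => z *m DH u)) ->
  (exists2 s, 0 <= s <= 1 & px (H w) - px (H v) =
     px (w - v) * DH (v + s *: (w - v)) 0 0 + py (w - v) * DH (v + s *: (w - v)) 1 0) /\
  (exists2 s, 0 <= s <= 1 & py (H w) - py (H v) =
     px (w - v) * DH (v + s *: (w - v)) 0 1 + py (w - v) * DH (v + s *: (w - v)) 1 1).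
Proof.
move=> dH; split.
  have [|s [s01 E]] := @mvt_plane R (px \o H) (fun u => DH u 0 0) (fun u => DH u 1 0) v w.
    move=> s _; apply: is_diff_ext (px_diff_comp (dH _)) => u /=; exact: px_mul.
  by exists s.
have [|s [s01 E]] := @mvt_plane R (py \o H) (fun u => DH u 0 1) (fun u => DH u 1 1) v w.
  move=> s _; apply: is_diff_ext (py_diff_comp (dH _)) => u /=; exact: py_mul.
by exists s.
Qed.

Lemma cos_double y : cos (2 * fr * y) = 1 - 2 * sin (fr * y) ^+ 2.
Proof.
have -> : 2 * fr * y = (fr * y) *+ 2 by rewrite -mulr_natl; ring.
by rewrite cos_mulr2n cos2sin2; ring.
Qed.

Lemma sin_double y : sin (2 * fr * y) = 2 * (cos (fr * y) * sin (fr * y)).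
Proof.
have -> : 2 * fr * y = (fr * y) *+ 2 by rewrite -mulr_natl; ring.
by rewrite sin_mulr2n mulr_natl.
Qed.

Lemma cos_double_near y : `|y| <= t0 + 2 * cc -> 25 / 10 ^+ 2 <= cos (2 * fr * y).
Proof.
move=> /near_t[_]; rewrite cos_double ler_norml => /andP[? ?]; nra.
Qed.

(** With one of the two points on a side of the box, this compares the image of any point with the
    image of that side. *)
Lemma circ_mono (A q x x1 : R) : 0 < q -> `|A * q| <= 1 -> x1 <= x ->
  x1 + A * sin (q * x1) <= x + A * sin (q * x).
Proof.
move=> q0 Aq hx.
have h : `|A * (sin (q * x1) - sin (q * x))| <= 1 * (x - x1).
  rewrite normrM; apply: le_trans (_ : `|A| * (q * (x - x1)) <= _).
    rewrite ler_wpM2l //; apply: le_trans (sin_lip _ _) _.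
    by rewrite -mulrBr normrM gtr0_norm // distrC ger0_norm // subr_ge0.
  by rewrite mulrA -[q in X in X <= _](gtr0_norm q0) -normrM ler_wpM2r // subr_ge0.
by move: h; rewrite ler_norml => /andP[? ?]; lra.
Qed.

Lemma sin_2t0 : sin (2 * fr * t0) = 24 / 25.
Proof. by rewrite sin_double cos_t0 sin_t0; lra. Qed.

Variable g : diffeo R.
Hypothesis gf : C1_close (e0 R) (fdiffeo R) g.
Variable K : V -> V -> Prop.
Hypothesis K_cone : in_cone K.

Let e_cc := e0_cc R.
Let cc0 := cc_gt0 R.

Lemma G_px v : exists2 d, `|d| < e0 R & px (G gf v) = px v + aa * sin (om * px v) + cc * cos (2 * fr * py v) + d.
Proof.
exists (px (G gf v) - px (F v)); first exact: G_close_px.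
by rewrite /F px_pt /phi /circ; ring.
Qed.

Lemma G_py v : exists2 d, `|d| < e0 R & py (G gf v) = py v + cc * sin (2 * fr * py v) + d.
Proof.
exists (py (G gf v) - py (F v)); first exact: G_close_py.
by rewrite /F py_pt /psi /circ; ring.
Qed.

Lemma cc_trig (c : R) : `|c| <= 1 -> - cc <= cc * c <= cc.
Proof.
by rewrite ler_norml => /andP[? ?]; apply/andP; split; have := cc0; nra.
Qed.

Lemma DG_entries v : exists d00 d01 d10 d11, [/\
  [/\ `|d00| <= 1 / 10 ^+ 9, `|d01| <= 1 / 10 ^+ 9, `|d10| <= 1 / 10 ^+ 9 & `|d11| <= 1 / 10 ^+ 9],
  DG g v 0 0 = 1 + 16 / 10 ^+ 6 * cos (om * px v) + d00,
  DG g v 0 1 = d01,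
  DG g v 1 0 = - (1 / 10 ^+ 2 * sin (2 * fr * py v)) + d10 &
  DG g v 1 1 = 1 + 1 / 10 ^+ 2 * cos (2 * fr * py v) + d11].
Proof.
have H i j : `|DG g v i j - DF v i j| <= 1 / 10 ^+ 9 by rewrite -e0E ltW // DG_close.
exists (DG g v 0 0 - DF v 0 0), (DG g v 0 1 - DF v 0 1), (DG g v 1 0 - DF v 1 0), (DG g v 1 1 - DF v 1 1).
split; first by split; exact: H.
- by rewrite !mxE /= aa_omE; ring.
- by rewrite !mxE /= subr0.
- by rewrite !mxE /= cc_fr; ring.
- by rewrite !mxE /= cc_fr; ring.
Qed.

(** In units of [cc] the drift lies here between 16 * 79/100 and 16, and the other terms are at most
    about 1; the bounds [ll / 4], [ll] and [ll / 16] are 8, 32 and 2. *)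
Lemma source_disp v : box x0 t0 v -> x0 - ll <= px v ->
  [/\ px v + ll / 4 <= px (G gf v), px (G gf v) <= px v + ll & `|py (G gf v)| <= `|py v| + ll / 16].
Proof.
move=> [hx hy] hl; have c0 := cc0; have ec := e_cc.
have [d1 hd1 ->] := G_px v; have [d2 hd2 ->] := G_py v.
have /andP[c1 c2] := cc_trig (cos_max (2 * fr * py v)).
have s1 : 79 / 10 ^+ 2 <= sin (om * px v).
  apply: sin_right; move: hx hl; rewrite ler_norml /ll => /andP[? ?] ?; apply/andP; split; lra.
have s2 := sin_le1 (om * px v).
have h1 : aa * (79 / 10 ^+ 2) <= aa * sin (om * px v) by rewrite ler_wpM2l // /aa; lra.
have h2 : aa * sin (om * px v) <= aa * 1 by rewrite ler_wpM2l // /aa; lra.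
move: hd1 h1 h2; rewrite ltr_norml /aa => /andP[? ?] h1 h2.
rewrite /ll; split; [lra|lra|].
have h3 : `|cc * sin (2 * fr * py v)| <= cc.
  by rewrite normrM gtr0_norm // ler_piMr ?sin_max // ltW.
apply: le_trans (ler_normD _ _) _; have := ler_normD (py v) (cc * sin (2 * fr * py v)); lra.
Qed.

(** The sides are pushed outwards: the vertical ones by 64/5 [cc], against at most [cc + e0] from
    the other terms, the horizontal ones by 24/25 [cc], against [e0 <= cc / 10 ^+ 2]. By
    monotonicity points beyond a side stay beyond it. *)
Lemma source_back v : box x0 t0 (G gf v) -> box x0 t0 v.
Proof.
have c0 := cc0; have ec := e_cc.
have [d1 hd1 E1] := G_px v; have [d2 hd2 E2] := G_py v.
have /andP[c1 c2] := cc_trig (cos_max (2 * fr * py v)).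
have ao : `|aa * om| <= 1 by rewrite aa_omE ger0_norm; lra.
have co : `|cc * (2 * fr)| <= 1 by rewrite cc_fr ger0_norm; lra.
have o0 := om_gt0 R; have f0 : 0 < 2 * fr by have := fr_gt0 R; lra.
have sx := sin_x0 R; have st := sin_2t0; have aE : aa = 16 * cc by [].
move=> []; rewrite E1 E2 => hx hy.
move: hd1 hd2 hx hy; rewrite !ltr_norml !ler_norml => /andP[? ?] /andP[? ?] /andP[? ?] /andP[? ?].
split; rewrite ler_norml; apply/andP; split; rewrite leNgt; apply/negP => h.
- have := circ_mono o0 ao (ltW h); rewrite mulrN sinN sx; lra.
- have := circ_mono o0 ao (ltW h); rewrite sx; lra.
- have := circ_mono f0 co (ltW h); rewrite mulrN sinN st; lra.
- have := circ_mono f0 co (ltW h); rewrite st; lra.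
Qed.

Lemma source_left v w : box x0 t0 v -> K v w -> w != 0 -> 0 < px w * px (w *m DG g v).
Proof.
move=> bv Kw w0; have fl := cone_flat K_cone bv Kw w0.
have [d00 [d01 [d10 [d11 [[h1 _ h2 _] E00 _ E10 _]]]]] := DG_entries v.
apply: (flat_image_sign w0 fl) (erefl _).
  have -> : DG g v 0 0 - 1 = 16 / 10 ^+ 6 * cos (om * px v) + d00 by rewrite E00; ring.
  apply: le_trans (ler_normD _ _) _.
  rewrite normrM (@ger0_norm _ (16 / 10 ^+ 6)); last by lra.
  have := cos_max (om * px v); lra.
rewrite E10; apply: le_trans (ler_normD _ _) _; rewrite normrN normrM (@ger0_norm _ (1 / 10 ^+ 2)); last by lra.
have := sin_max (2 * fr * py v); lra.
Qed.

(** If the horizontal part dominates in [nrm], the shear costs only [11 / 10 ^+ 7] of it, well below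
    the gain [9 / 10 ^+ 6]; otherwise the vertical gain [2 / 10 ^+ 3] is far larger than what [c]
    can cost. *)
Lemma weighted_expand (dx dy a b c d : R) : 1 + 9 / 10 ^+ 6 <= a -> `|b| <= 11 / 10 ^+ 3 ->
  `|c| <= 1 / 10 ^+ 9 -> 1 + 2 / 10 ^+ 3 <= d ->
  thx R * nrm (pt dx dy) <= nrm (pt (dx * a + dy * b) (dx * c + dy * d)).
Proof.
move=> ha hb hc hd; rewrite /nrm !pE /thx le_max.
have n1 := normr_ge0 dx; have n2 := normr_ge0 dy.
have a1 : (1 + 9 / 10 ^+ 6) * `|dx| <= `|dx * a|.
  by rewrite normrM mulrC ler_wpM2l //; apply: le_trans (ler_norm _).
have b1 : `|dy * b| <= `|dy| * (11 / 10 ^+ 3) by rewrite normrM ler_wpM2l.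
have c1 : `|dx * c| <= `|dx| * (1 / 10 ^+ 9) by rewrite normrM ler_wpM2l.
have d1 : (1 + 2 / 10 ^+ 3) * `|dy| <= `|dy * d|.
  by rewrite normrM mulrC ler_wpM2l //; apply: le_trans (ler_norm _).
have T1 : `|dx * a| - `|dy * b| <= `|dx * a + dy * b|.
  by have := ler_normB (dx * a + dy * b) (dy * b); rewrite addrK; lra.
have T2 : `|dy * d| - `|dx * c| <= `|dx * c + dy * d|.
  by have := ler_normB (dx * c + dy * d) (dx * c); rewrite addrC addKr; lra.
move: a1 b1 c1 d1 T1 T2 n1 n2; clear.
move: (`|dx * a|) (`|dy * b|) (`|dx * c|) (`|dy * d|) (`|dx * a + dy * b|) (`|dx * c + dy * d|) (`|dx|) (`|dy|).
move=> A B C D P Q X Y a1 b1 c1 d1 T1 T2 n1 n2.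
by have [h|/ltW h] := leP X (10 ^+ 4 * Y); apply/orP; [right|left]; lra.
Qed.

Lemma source_expand v w : box x0 t0 v -> box x0 t0 w ->
  thx R * nrm (v - w) <= nrm (G gf v - G gf w).
Proof.
move=> [v1 v2] [w1 w2]; have [[s s01 E1] [s' s01' E2]] := mvt_components w v (G_diff gf).
rewrite -[v - w]pt_eta -[G gf v - G gf w]pt_eta (pxB (G gf v)) (pyB (G gf v)) E1 E2.
have bx r : 0 <= r <= 1 -> `|px (w + r *: (v - w))| <= x0 by move=> hr; rewrite !pE; exact: segment_abs.
have by_ r : 0 <= r <= 1 -> `|py (w + r *: (v - w))| <= t0 by move=> hr; rewrite !pE; exact: segment_abs.
have [a00 [a01 [a10 [a11 [[h1 _ h2 _] A00 _ A10 _]]]]] := DG_entries (w + s *: (v - w)).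
have [b00 [b01 [b10 [b11 [[_ k1 _ k2] _ B01 _ B11]]]]] := DG_entries (w + s' *: (v - w)).
have q1 := box_cos_x (bx s s01).
have q2 : 25 / 10 ^+ 2 <= cos (2 * fr * py (w + s' *: (v - w))).
  by apply: cos_double_near; apply: le_trans (by_ s' s01') _; have := cc0; lra.
have q3 := sin_max (2 * fr * py (w + s *: (v - w))).
apply: weighted_expand.
- by rewrite A00; move: h1; rewrite ler_norml => /andP[? ?]; lra.
- rewrite A10; apply: le_trans (ler_normD _ _) _; rewrite normrN normrM (@ger0_norm _ (1 / 10 ^+ 2)); lra.
- by rewrite B01.
- by rewrite B11; move: k2; rewrite ler_norml => /andP[? ?]; lra.
Qed.

Hypothesis K_inv : forall v w, K v w -> K (G gf v) (w *m DG g v).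

Lemma source_merging : merging K.
Proof.
have th1 : 1 < thx R by rewrite /thx; lra.
move=> C1 C1' C2 C2' b1 b2.
exact: (trap_merge ll_gt0 ll_le (G_diff gf) (@DG_cts R g) K_inv (cone_flat K_cone)
  (cone_top K_cone) (cone_bot K_cone) source_disp source_back source_left
  (@nrm_ge R) (@nrm_box R) th1 source_expand).
Qed.

End MergingSource.

Lemma contracting_entries (R : realType) (x y s d00 d10 d11 : R) :
  59 / 10 ^+ 2 <= x <= 1 -> 25 / 10 ^+ 2 <= y <= 1 -> `|s| <= 1 ->
  `|d00| <= 1 / 10 ^+ 9 -> `|d10| <= 1 / 10 ^+ 9 -> `|d11| <= 1 / 10 ^+ 9 ->
  [/\ 0 <= 1 - 16 / 10 ^+ 6 * x + d00 <= 1 - 92 / 10 ^+ 7,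
    `|1 / 10 ^+ 2 * s + d10| <= 101 / 10 ^+ 4 &
    0 <= 1 - 1 / 10 ^+ 2 * y + d11 <= 1 - 2 / 10 ^+ 3].
Proof.
move=> /andP[x1 x2] /andP[y1 y2] s1 h1 h2 h3; split.
- by move: (ler_normlW h1) (lerNnormlW h1) x1 x2; clear=> *; apply/andP; split; lra.
- apply: le_trans (ler_normD _ _) _; rewrite normrM (@ger0_norm _ (1 / 10 ^+ 2)); last by clear; lra.
  by move: s1 h2; clear; lra.
- by move: (ler_normlW h3) (lerNnormlW h3) y1 y2; clear=> *; apply/andP; split; lra.
Qed.

(** * The box at the contracting point, under the inverse *)

Section MergingSink.
Variable R : realType.
Notation V := 'rV[R]_2.
Implicit Types (v w : V).
Local Notation om := (om R). Local Notation fr := (fr R).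
Local Notation cc := (cc R). Local Notation aa := (aa R).
Local Notation x0 := (x0 R). Local Notation t0 := (t0 R). Local Notation ll := (ll R).

(* At this point [F] is contracting, and the frame is rotated by a right angle. *)
Definition sink_base : V := pt (1 / 2) (1 / (4 * KN R)).

Lemma om_half : om * (1 / 2) = pi.
Proof. by rewrite /om -mulr_natr; field. Qed.
Lemma fr_base : fr * (1 / (4 * KN R)) = pi / 2.
Proof. by rewrite /fr /om -mulr_natr; have := KN_gt0 R => h; field; lra. Qed.
Lemma fr_base2 : 2 * fr * (1 / (4 * KN R)) = pi.
Proof. by rewrite -mulrA fr_base; field. Qed.

Lemma base_sin_x x : sin (om * (x + 1 / 2)) = - sin (om * x).
Proof. by rewrite mulrDr om_half sinDpi. Qed.
Lemma base_cos_x x : cos (om * (x + 1 / 2)) = - cos (om * x).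
Proof. by rewrite mulrDr om_half cosDpi. Qed.
Lemma base_sin_t y : sin (2 * fr * (y + 1 / (4 * KN R))) = - sin (2 * fr * y).
Proof. by rewrite mulrDr fr_base2 sinDpi. Qed.
Lemma base_cos_t y : cos (2 * fr * (y + 1 / (4 * KN R))) = - cos (2 * fr * y).
Proof. by rewrite mulrDr fr_base2 cosDpi. Qed.

Variable g : diffeo R.
Hypothesis gf : C1_close (e0 R) (fdiffeo R) g.
Variable K : V -> V -> Prop.
Hypothesis K_cone : in_cone K.

Let e_cc := e0_cc R.
Let cc0 := cc_gt0 R.

Let near18 : 0 <= 18 * cc <= 100 * cc.
Proof. by have := cc0 => h; apply/andP; split; lra. Qed.

(** The inverse in coordinates centred at [sink_base]. No formula describes it; its estimates are
    read off at [Gs v] from those of [H], which are those of [G] with all drift terms reversed. *)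
Definition Gs v := Ginv gf (v + sink_base) - sink_base.
Definition DGs v := DGinv g (v + sink_base).
Let H v := G gf (v + sink_base) - sink_base.

Lemma GsK v : H (Gs v) = v.
Proof. by rewrite /H /Gs subrK GinvK addrK. Qed.

Lemma H_px v : exists2 d, `|d| < e0 R & px (H v) = px v - aa * sin (om * px v) - cc * cos (2 * fr * py v) + d.
Proof.
have [d hd E] := G_px gf (v + sink_base); exists d => //.
by rewrite /H pxB E !pE base_sin_x base_cos_t; ring.
Qed.

Lemma H_py v : exists2 d, `|d| < e0 R & py (H v) = py v - cc * sin (2 * fr * py v) + d.
Proof.
have [d hd E] := G_py gf (v + sink_base); exists d => //.
by rewrite /H pyB E !pE base_sin_t; ring.
Qed.

Lemma Gs_diff v : is_diff v Gs (fun w => w *m DGs v).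
Proof.
have d1 : is_diff v (fun u : V => u + sink_base) id.
  by have := is_diffD (is_diff_id v) (is_diff_cst sink_base v); rewrite addr0.
have := is_diffB (is_diff_comp d1 (Ginv_diff gf (v + sink_base))) (is_diff_cst sink_base v).
by rewrite subr0.
Qed.

Lemma DGs_cts (w : V) : continuous (fun v => w *m DGs v).
Proof.
move=> v; have c : {for v, continuous (fun u : V => u + sink_base)}.
  exact: (cvgD (@cvg_id _ (nbhs v)) (@cvg_cst _ sink_base _ _ _)).
exact: (continuous_comp c (@DGinv_cts R g w _)).
Qed.

Lemma Gs_near v : `|px (Gs v) - px v| <= 18 * cc /\ `|py (Gs v) - py v| <= 2 * cc.
Proof.
have [d1 hd1 E1] := H_px (Gs v); have [d2 hd2 E2] := H_py (Gs v); rewrite GsK in E1 E2.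
have c0 := cc0; have ec := e_cc; have aE : aa = 16 * cc by [].
have bnd (A y c : R) : 0 <= A -> `|c| <= 1 -> `|A * c| <= A.
  by move=> A0 hc; rewrite normrM ger0_norm // ler_piMr.
have h1 : `|aa * sin (om * px (Gs v))| <= aa by apply: bnd; rewrite ?sin_max //; lra.
have h2 : `|cc * cos (2 * fr * py (Gs v))| <= cc by apply: bnd; rewrite ?cos_max // ltW.
have h3 : `|cc * sin (2 * fr * py (Gs v))| <= cc by apply: bnd; rewrite ?sin_max // ltW.
rewrite E1 E2; move: hd1 hd2 h1 h2 h3; clear E1 E2; rewrite !ltr_norml !ler_norml.
move=> /andP[? ?] /andP[? ?] /andP[? ?] /andP[? ?] /andP[? ?].
by split; apply/andP; split; lra.
Qed.

Lemma sink_disp v : box x0 t0 v -> x0 - ll <= px v ->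
  [/\ px v + ll / 4 <= px (Gs v), px (Gs v) <= px v + ll & `|py (Gs v)| <= `|py v| + ll / 16].
Proof.
move=> [hx hy] hl; have [n1 n2] := Gs_near v; have c0 := cc0; have ec := e_cc; have aE : aa = 16 * cc by [].
have [d1 hd1 E1] := H_px (Gs v); rewrite GsK in E1.
have s1 : 79 / 10 ^+ 2 <= sin (om * px (Gs v)).
  apply: sin_right; move: hx hl n1; rewrite !ler_norml /ll => /andP[? ?] ? /andP[? ?]; apply/andP; split; lra.
have h1 : aa * (79 / 10 ^+ 2) <= aa * sin (om * px (Gs v)) by rewrite ler_wpM2l //; lra.
have h2 : cc * (-1) <= cc * cos (2 * fr * py (Gs v)) by rewrite ler_wpM2l ?cos_geN1 // ltW.
rewrite /ll; split.
- by move: hd1; rewrite ltr_norml => /andP[? ?]; lra.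
- by move: n1; rewrite ler_norml => /andP[? ?]; lra.
- have := ler_normD (py (Gs v) - py v) (py v); rewrite subrK; lra.
Qed.

(** In other words [H] maps the box into itself: its sides are pushed inwards, and monotonicity does
    the rest. *)
Lemma sink_back v : box x0 t0 (Gs v) -> box x0 t0 v.
Proof.
have c0 := cc0; have ec := e_cc; have aE : aa = 16 * cc by [].
have [d1 hd1 E1] := H_px (Gs v); have [d2 hd2 E2] := H_py (Gs v); rewrite GsK in E1 E2.
have cb : `|cc * cos (2 * fr * py (Gs v))| <= cc.
  by rewrite normrM gtr0_norm // ler_piMr ?cos_max // ltW.
have ao : `|(- aa) * om| <= 1 by rewrite mulNr normrN aa_omE ger0_norm; lra.
have co : `|(- cc) * (2 * fr)| <= 1 by rewrite mulNr normrN cc_fr ger0_norm; lra.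
have o0 := om_gt0 R; have f0 : 0 < 2 * fr by have := fr_gt0 R; lra.
have sx := sin_x0 R; have st := sin_2t0 R.
move=> []; rewrite !ler_norml => /andP[x1 x2] /andP[y1 y2].
have m1 := circ_mono o0 ao x1; have m2 := circ_mono o0 ao x2.
have m3 := circ_mono f0 co y1; have m4 := circ_mono f0 co y2.
rewrite mulrN sinN sx in m1; rewrite sx in m2; rewrite mulrN sinN st in m3; rewrite st in m4.
move: hd1 hd2 cb; rewrite !ltr_norml !ler_norml => /andP[? ?] /andP[? ?] /andP[? ?].
by split; rewrite ler_norml; apply/andP; split; lra.
Qed.

Lemma DH_entries v : exists d00 d01 d10 d11, [/\
  [/\ `|d00| <= 1 / 10 ^+ 9, `|d01| <= 1 / 10 ^+ 9, `|d10| <= 1 / 10 ^+ 9 & `|d11| <= 1 / 10 ^+ 9],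
  DG g (v + sink_base) 0 0 = 1 - 16 / 10 ^+ 6 * cos (om * px v) + d00,
  DG g (v + sink_base) 0 1 = d01,
  DG g (v + sink_base) 1 0 = 1 / 10 ^+ 2 * sin (2 * fr * py v) + d10 &
  DG g (v + sink_base) 1 1 = 1 - 1 / 10 ^+ 2 * cos (2 * fr * py v) + d11].
Proof.
have [d00 [d01 [d10 [d11 [h E1 E2 E3 E4]]]]] := DG_entries gf (v + sink_base).
exists d00, d01, d10, d11; split => //.
- by rewrite E1 pxD px_pt base_cos_x mulrN.
- by rewrite E3 pyD py_pt base_sin_t mulrN opprK.
- by rewrite E4 pyD py_pt base_cos_t mulrN.
Qed.

Hypothesis K_inv : forall v w, K v w -> K (Gs v) (w *m DGs v).

Lemma sink_left v w : box x0 t0 v -> K v w -> w != 0 -> 0 < px w * px (w *m DGs v).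
Proof.
move=> [_ hy] Kw w0; set w' := w *m DGs v.
have E : w = w' *m DG g (Gs v + sink_base) by rewrite /w' /Gs subrK DGinvK.
have w'0 : w' != 0 by apply: contra_neq w0 => h; rewrite E h mul0mx.
have [n1 n2] := Gs_near v.
have fl : `|py w'| <= `|px w'|.
  (* The point [Gs v] may lie above or below the box by up to [2 * cc], which is why flatness was
     proved on a slightly larger strip. *)
  apply: (cone_flat_near K_cone (v := Gs v)) => //; last exact: K_inv.
  by have := ler_normD (py (Gs v) - py v) (py v); rewrite subrK; lra.
have [d00 [d01 [d10 [d11 [[h1 _ h2 _] E00 _ E10 _]]]]] := DH_entries (Gs v).
rewrite mulrC; apply: (flat_image_sign w'0 fl) E.
  have -> : DG g (Gs v + sink_base) 0 0 - 1 = - (16 / 10 ^+ 6 * cos (om * px (Gs v))) + d00.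
    by rewrite E00; ring.
  apply: le_trans (ler_normD _ _) _.
  rewrite normrN normrM (@ger0_norm _ (16 / 10 ^+ 6)); last by lra.
  have := cos_max (om * px (Gs v)); lra.
rewrite E10; apply: le_trans (ler_normD _ _) _; rewrite normrM (@ger0_norm _ (1 / 10 ^+ 2)); last by lra.
have := sin_max (2 * fr * py (Gs v)); lra.
Qed.

(** With the weight [10 ^+ 4] the shear adds [101 / 10 ^+ 8] to the horizontal rate, which stays
    below [1 - 8 / 10 ^+ 6]; multiplied by [thx] this is still below 1. *)
Lemma weighted_contract (dx dy a b c d : R) : 0 <= a <= 1 - 92 / 10 ^+ 7 -> `|b| <= 101 / 10 ^+ 4 ->
  `|c| <= 1 / 10 ^+ 9 -> 0 <= d <= 1 - 2 / 10 ^+ 3 ->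
  thx R * nrm (pt (dx * a + dy * b) (dx * c + dy * d)) <= nrm (pt dx dy).
Proof.
move=> /andP[a0 a1] hb hc /andP[d0 d1]; rewrite /nrm !pE.
set m := Num.max `|dx| _.
have hx : `|dx| <= m by rewrite le_max lexx.
have hy : 10 ^+ 4 * `|dy| <= m by rewrite le_max lexx orbT.
have n1 := normr_ge0 dx; have n2 := normr_ge0 dy.
have h1 : `|dx * a| <= `|dx| * (1 - 92 / 10 ^+ 7) by rewrite normrM ler_wpM2l // ger0_norm.
have h2 : `|dy * b| <= `|dy| * (101 / 10 ^+ 4) by rewrite normrM ler_wpM2l.
have h3 : `|dx * c| <= `|dx| * (1 / 10 ^+ 9) by rewrite normrM ler_wpM2l.
have h4 : `|dy * d| <= `|dy| * (1 - 2 / 10 ^+ 3) by rewrite normrM ler_wpM2l // ger0_norm.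
have T1 := ler_normD (dx * a) (dy * b); have T2 := ler_normD (dx * c) (dy * d).
move: hx hy n1 n2 h1 h2 h3 h4 T1 T2; move: m; clear => m.
move: (`|dx * a|) (`|dy * b|) (`|dx * c|) (`|dy * d|) (`|dx * a + dy * b|) (`|dx * c + dy * d|) (`|dx|) (`|dy|).
move=> A B C D P Q X Y hx hy n1 n2 h1 h2 h3 h4 T1 T2.
have PM : P <= m * (1 - 8 / 10 ^+ 6) by lra.
have QM : 10 ^+ 4 * Q <= m * (1 - 8 / 10 ^+ 6) by lra.
have mx : Num.max P (10 ^+ 4 * Q) <= m * (1 - 8 / 10 ^+ 6) by rewrite ge_max PM.
apply: le_trans (_ : thx R * (m * (1 - 8 / 10 ^+ 6)) <= _).
  by rewrite ler_wpM2l // /thx; lra.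
by rewrite /thx; lra.
Qed.

Lemma px_seg (a b : V) s : px (a + s *: (b - a)) = px a + s * (px b - px a).
Proof. by rewrite pxD pxZ pxB. Qed.
Lemma py_seg (a b : V) s : py (a + s *: (b - a)) = py a + s * (py b - py a).
Proof. by rewrite pyD pyZ pyB. Qed.

Lemma sink_expand v w : box x0 t0 v -> box x0 t0 w -> thx R * nrm (v - w) <= nrm (Gs v - Gs w).
Proof.
move=> [v1 v2] [w1 w2]; have c0 := cc0.
have [nv1 nv2] := Gs_near v; have [nw1 nw2] := Gs_near w.
have bv1 : `|px (Gs v)| <= x0 + 18 * cc by have := ler_normD (px (Gs v) - px v) (px v); rewrite subrK; lra.
have bv2 : `|py (Gs v)| <= t0 + 2 * cc by have := ler_normD (py (Gs v) - py v) (py v); rewrite subrK; lra.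
have bw1 : `|px (Gs w)| <= x0 + 18 * cc by have := ler_normD (px (Gs w) - px w) (px w); rewrite subrK; lra.
have bw2 : `|py (Gs w)| <= t0 + 2 * cc by have := ler_normD (py (Gs w) - py w) (py w); rewrite subrK; lra.
have Hd u : is_diff u H (fun z => z *m DG g (u + sink_base)).
  have d1 : is_diff u (fun u : V => u + sink_base) id.
    by have := is_diffD (is_diff_id u) (is_diff_cst sink_base u); rewrite addr0.
  have := is_diffB (is_diff_comp d1 (G_diff gf (u + sink_base))) (is_diff_cst sink_base u).
  by rewrite subr0.
have [[s s01 E1] [s' s01' E2]] := mvt_components (Gs w) (Gs v) Hd.
rewrite !GsK in E1 E2; rewrite -[v - w]pt_eta -[Gs v - Gs w]pt_eta (pxB v) (pyB v) E1 E2.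
set u := _ + s *: _ in E1 *; set u' := _ + s' *: _ in E2 *.
have bx : `|px u| <= x0 + 18 * cc by rewrite /u px_seg; exact: segment_abs.
have by' : `|py u'| <= t0 + 2 * cc by rewrite /u' py_seg; exact: segment_abs.
have [a00 [a01 [a10 [a11 [[h1 _ h2 _] A00 _ A10 _]]]]] := DH_entries u.
have [b00 [b01 [b10 [b11 [[_ k1 _ k2] _ B01 _ B11]]]]] := DH_entries u'.
have q1 : 59 / 10 ^+ 2 <= cos (om * px u) <= 1 by rewrite cos_le1 (near_cos_x bx near18).
have q2 : 25 / 10 ^+ 2 <= cos (2 * fr * py u') <= 1 by rewrite cos_le1 cos_double_near.
have [e1 e2 e3] := contracting_entries q1 q2 (sin_max (2 * fr * py u)) h1 h2 k2.
by apply: weighted_contract; rewrite ?A00 ?A10 ?B01 ?B11.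
Qed.

Lemma sink_merging : merging K.
Proof.
have th1 : 1 < thx R by rewrite /thx; lra.
move=> C1 C1' C2 C2' b1 b2.
exact: (trap_merge (ll_gt0 R) (ll_le R) Gs_diff DGs_cts K_inv (cone_flat K_cone)
  (cone_top K_cone) (cone_bot K_cone) sink_disp sink_back sink_left
  (@nrm_ge R) (@nrm_box R) th1 sink_expand).
Qed.

End MergingSink.

(** * Ordinary differential equations *)

Section Picard.
Variable R : realType.
Implicit Types (t h : R).

Lemma geometric_limit (u : nat -> R) (a : R) : 0 <= a ->
  (forall n, `|u n.+1 - u n| <= a * 2^-1 ^+ n) ->
  exists l, forall n, `|l - u n| <= 2 * a * 2^-1 ^+ n.
Proof.
move=> a0 hu; pose r n := 2 * a * 2^-1 ^+ n : R.
have r0 n : 0 <= r n by rewrite /r mulr_ge0 ?mulr_ge0 // exprn_ge0.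
have rS n : r n = a * 2^-1 ^+ n + r n.+1 by rewrite /r exprS; field.
have lo n j : u n - r n <= u (n + j)%N - r (n + j)%N.
  elim: j => [|j IH]; first by rewrite addn0.
  apply: le_trans IH _; rewrite addnS; have := hu (n + j)%N; have := rS (n + j)%N.
  rewrite ler_norml; move: (_ * _) => q E /andP[? ?]; lra.
have hi n j : u (n + j)%N + r (n + j)%N <= u n + r n.
  elim: j => [|j IH]; first by rewrite addn0.
  apply: le_trans IH; rewrite addnS; have := hu (n + j)%N; have := rS (n + j)%N.
  rewrite ler_norml; move: (_ * _) => q E /andP[? ?]; lra.
have cross i j : u i - r i <= u j + r j.
  have [ij|/ltnW ji] := leqP i j.
    by have := lo i (j - i)%N; rewrite subnKC //; have := r0 j; lra.
  by have := hi j (i - j)%N; rewrite subnKC //; have := r0 i; lra.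
pose A := [set x | exists n, x = u n - r n].
have hA : has_sup A by split; [exists (u 0%N - r 0%N), 0%N|exists (u 0%N + r 0%N) => _ [n ->]].
exists (sup A) => n; rewrite -/(r n).
have h1 : u n - r n <= sup A by apply: ub_le_sup; [case: hA|exists n].
have h2 : sup A <= u n + r n by apply: ge_sup; [case: hA|move=> _ [i ->]].
by rewrite ler_norml; apply/andP; split; lra.
Qed.

Lemma half_pow_small (a e : R) : 0 <= a -> 0 < e -> exists n, a * 2^-1 ^+ n <= e.
Proof.
move=> a0 e_gt0; have h1 : 0 <= (2^-1 : R) < 1 by apply/andP; split; lra.
have h2 : 0 < e / (a + 1) by rewrite divr_gt0 // ltr_wpDl.
have [n Hn] := expr_small h1 h2; exists n; apply: le_trans (_ : a * (e / (a + 1)) <= _); first by rewrite ler_wpM2l // ltW.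
by rewrite mulrCA ler_piMr ?(ltW e_gt0) // ler_pdivrMr ?ltr_wpDl // mul1r; lra.
Qed.

Lemma is_derive_quadratic (y : R -> R) (t a C : R) :
  (forall h, `|y (t + h) - y t - h * a| <= C * h ^+ 2) -> is_derive t 1 y a.
Proof.
move=> H; have C0 : 0 <= C.
  by have := le_trans (normr_ge0 _) (H 1); rewrite expr1n mulr1.
have E : (fun h : R => h^-1 *: (y (h *: (1 : R) + t) - y t)) @ 0^' --> a.
  apply/cvgrPdist_le => e e0.
  have dp : 0 < e / (C + 1) by rewrite divr_gt0 // ltr_wpDl.
  near=> h.
  have h0 : h != 0 by near: h; exact: nbhs_dnbhs_neq.
  rewrite /GRing.scale /= mulr1 [h + t]addrC.
  have -> : a - h^-1 * (y (t + h) - y t) = - (h^-1 * (y (t + h) - y t - h * a)) by field.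
  rewrite normrN normrM normfV; apply: le_trans (_ : `|h|^-1 * (C * h ^+ 2) <= _).
    by rewrite ler_wpM2l // invr_ge0.
  rewrite -(real_normK (num_real h)).
  have -> : `|h|^-1 * (C * `|h| ^+ 2) = C * `|h| by field; rewrite normr_eq0.
  have : `|h| <= e / (C + 1) by near: h; exact: dnbhs0_le.
  rewrite ler_pdivlMr ?ltr_wpDl // => hh; have := normr_ge0 h; nra.
by apply: DeriveDef; [apply/cvg_ex; exists a|apply/cvg_lim].
Unshelve. all: by end_near. Qed.

Lemma expR_scaled (k t : R) : is_derive t 1 (fun u => expR (k * u)) (k * expR (k * t)).
Proof. exact: (is_derive_trig k t (@is_derive_expR R)). Qed.

Lemma nondecr_of_derive (f df : R -> R) (a b : R) : a <= b ->
  (forall t : R, is_derive t 1 f (df t)) -> (forall t, a <= t <= b -> 0 <= df t) -> f a <= f b.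
Proof.
move=> ab fd df0; have [eq_ab|neq] := eqVneq a b; first by rewrite eq_ab.
have ab' : a < b by rewrite lt_neqAle neq.
have [c [/andP[ac cb] E]] := mvt_all fd ab'.
by rewrite -subr_ge0 E mulr_ge0 ?subr_ge0 // df0 // !ltW.
Qed.

Variables (S : R -> R -> R) (L : R).
Hypothesis L0 : 0 < L.
Hypothesis S_lip : forall t t' y y', `|S t y - S t' y'| <= L * (`|t - t'| + `|y - y'|).
Hypothesis S_bnd : forall t y, `|S t y| <= 1.

Let W t := expR (2 * L * t) + expR (- (2 * L) * t).
Let Z t := expR (2 * L * t) - expR (- (2 * L) * t).

Let W_ge0 t : 0 <= W t. Proof. by rewrite /W addr_ge0 ?expR_ge0. Qed.

Let Z_le_W t : `|Z t| <= W t.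
Proof.
have := expR_ge0 (2 * L * t); have := expR_ge0 (- (2 * L) * t); rewrite /Z /W => ? ?.
by rewrite ler_norml; apply/andP; split; lra.
Qed.

Let Z_derive t : is_derive t 1 Z (2 * L * W t).
Proof.
have := is_derive_affine 0 1 (-1) (expR_scaled (2 * L) t) (expR_scaled (- (2 * L)) t).
rewrite (_ : (fun u => _) = Z); last by apply/funext => u; rewrite /Z; ring.
by rewrite (_ : _ + _ = 2 * L * W t) // /W; ring.
Qed.

(* The weight W turns the Picard operator into a contraction by 1/2. *)
Let weighted_step (d dd : R -> R) (q : R) : d 0 = 0 ->
  (forall t : R, is_derive t 1 d (dd t)) -> (forall t, `|dd t| <= L * (q * W t)) ->
  forall t, `|d t| <= q / 2 * W t.
Proof.
move=> d0 Hd Hdd t.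
have q0 : 0 <= q.
  have := le_trans (normr_ge0 _) (Hdd 0); rewrite pmulr_rge0 // pmulr_lge0 //.
  by rewrite /W !mulr0 expR0; lra.
have H1 (u : R) : is_derive u 1 (fun u => 0 + 1 * d u + q / 2 * Z u) (1 * dd u + q / 2 * (2 * L * W u)).
  exact: is_derive_affine.
have H2 (u : R) : is_derive u 1 (fun u => 0 + (-1) * d u + q / 2 * Z u) ((-1) * dd u + q / 2 * (2 * L * W u)).
  exact: is_derive_affine.
have P1 u : 0 <= 1 * dd u + q / 2 * (2 * L * W u).
  by have := Hdd u; rewrite ler_norml => /andP[? ?]; lra.
have P2 u : 0 <= (-1) * dd u + q / 2 * (2 * L * W u).
  by have := Hdd u; rewrite ler_norml => /andP[? ?]; lra.
have Z0 : Z 0 = 0 by rewrite /Z !mulr0 subrr.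
have zw := ler_wpM2l (_ : 0 <= q / 2) (Z_le_W t).
apply: le_trans (zw _); last by lra.
rewrite -[q / 2 in leRHS]ger0_norm; last by lra.
rewrite -normrM; have [tp|tn] := leP 0 t.
  have := nondecr_of_derive tp H1 (fun u _ => P1 u); have := nondecr_of_derive tp H2 (fun u _ => P2 u).
  rewrite d0 Z0 => h1 h2; rewrite [leRHS]ger0_norm; last by lra.
  by rewrite ler_norml; apply/andP; split; lra.
have := nondecr_of_derive (ltW tn) H1 (fun u _ => P1 u); have := nondecr_of_derive (ltW tn) H2 (fun u _ => P2 u).
rewrite d0 Z0 => h1 h2; rewrite [leRHS]ler0_norm; last by lra.
by rewrite ler_norml; apply/andP; split; lra.
Qed.

(** Consecutive iterates differ by at most [W t / (L * 2 ^+ n)], so they converge pointwise on the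
    whole line. That the limit is a solution follows without integrals: the mean value theorem for
    the iterates yields the error [2 * L * h ^+ 2] required by [is_derive_quadratic]. *)
Lemma picard (y0 : R) : exists y : R -> R, y 0 = y0 /\ forall t : R, is_derive t 1 y (S t (y t)).
Proof.
have next (y : R -> R) : continuous y -> exists z : R -> R, z 0 = y0 /\
    forall t : R, is_derive t 1 z (S t (y t)).
  move=> yc; have Sc : continuous (fun t => S t (y t)).
    move=> t; apply/cvgrPdist_le => e e0.
    have d0 : 0 < e / (2 * L) by rewrite divr_gt0 // mulr_gt0.
    near=> u; apply: le_trans (S_lip _ _ _ _) _.
    have h1 : `|t - u| <= e / (2 * L) by near: u; apply: cvgr_dist_le => //; exact: cvg_id.
    have h2 : `|y t - y u| <= e / (2 * L) by near: u; apply: cvgr_dist_le => //; exact: yc.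
    have E : L * (e / (2 * L) + e / (2 * L)) = e by field; rewrite gt_eqF.
    by rewrite -E ler_pM2l // lerD.
  have [F [F0 HF]] := antiderivative Sc.
  exists (fun t => y0 + 1 * F t + 0 * F t); split; first by rewrite F0; ring.
  move=> t; have := is_derive_affine y0 1 0 (HF t) (HF t).
  by rewrite mul1r mul0r addr0.
have /choice[nxt Hn] : forall y : R -> R, exists z : R -> R, continuous y -> z 0 = y0 /\
    forall t : R, is_derive t 1 z (S t (y t)).
  by move=> y; have [yc|nyc] := pselect (continuous y); [have [z Hz] := next y yc; exists z|exists y].
pose Y := fix Y n := if n is k.+1 then nxt (Y k) else (fun _ : R => y0).
have Yc n : continuous (Y n).
  elim: n => [|n IH]; first exact: cst_continuous.
  by move=> t; have [_ H] := Hn _ IH; exact: is_derive_cts (H t).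
have Y0 n : Y n 0 = y0 by case: n => [|n] //=; have [] := Hn _ (Yc n).
have Yd n (t : R) : is_derive t 1 (Y n.+1) (S t (Y n t)) by have [_] := Hn _ (Yc n); apply.
have Y_lip n s t : `|Y n s - Y n t| <= `|s - t|.
  case: n => [|n]; first by rewrite subrr normr0.
  by rewrite -[leRHS]mul1r; exact: lip_of_derive (Yd n) (fun t => S_bnd _ _).
have L1 : 0 < L^-1 by rewrite invr_gt0.
have dist n t : `|Y n.+1 t - Y n t| <= L^-1 * 2^-1 ^+ n * W t.
  elim: n t => [|n IH] t.
    have H (u : R) : is_derive u 1 (fun u => - y0 + 1 * Y 1%N u + 0 * Y 1%N u) (1 * S u y0 + 0 * S u y0).
      by have := Yd 0%N u => ?; exact: is_derive_affine.
    have := @weighted_step _ _ L^-1 _ H _ t; rewrite Y0 => P.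
    apply: le_trans (_ : `|- y0 + 1 * Y 1%N t + 0 * Y 1%N t| <= _).
      by rewrite le_eqVlt; apply/orP; left; apply/eqP; congr (`|_|); rewrite /=; ring.
    apply: le_trans (P _ _) _; first by ring.
      move=> u; rewrite mul1r mul0r addr0 mulrA mulfV ?gt_eqF // mul1r.
      apply: le_trans (S_bnd _ _) _; rewrite /W.
      have := expR_ge1Dx (2 * L * u); have := expR_ge1Dx (- (2 * L) * u); lra.
    by rewrite expr0 mulr1 ler_wpM2r //; lra.
  have H (u : R) : is_derive u 1 (fun u => 0 + 1 * Y n.+2 u + (-1) * Y n.+1 u)
      (1 * S u (Y n.+1 u) + (-1) * S u (Y n u)).
    by have := Yd n.+1 u => ?; have := Yd n u => ?; exact: is_derive_affine.
  have := @weighted_step _ _ (L^-1 * 2^-1 ^+ n) _ H _ t; rewrite !Y0 => P.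
  apply: le_trans (_ : `|0 + 1 * Y n.+2 t + (-1) * Y n.+1 t| <= _).
    by rewrite le_eqVlt; apply/orP; left; apply/eqP; congr (`|_|); ring.
  apply: le_trans (P _ _) _; first by ring.
    move=> u; rewrite mul1r mulN1r; apply: le_trans (S_lip _ _ _ _) _.
    by rewrite subrr normr0 add0r ler_pM2l.
  by rewrite exprS le_eqVlt; apply/orP; left; apply/eqP; field; rewrite gt_eqF.
have /choice[y Hy] : forall t, exists l, forall n, `|l - Y n t| <= 2 * (L^-1 * W t) * 2^-1 ^+ n.
  move=> t; apply: geometric_limit; first by rewrite mulr_ge0 // ltW.
  by move=> n; apply: le_trans (dist n t) _; rewrite mulrAC.
exists y; split.
  apply/eqP; rewrite -subr_eq0 -normr_le0; apply/ler_addgt0Pr => e e0; rewrite add0r.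
  have a0 : 0 <= 2 * (L^-1 * W 0) by rewrite !mulr_ge0 // ltW.
  by have [n Hn'] := half_pow_small a0 e0; have := Hy 0 n; rewrite Y0; lra.
move=> t; apply: (@is_derive_quadratic y t _ (2 * L)) => h.
apply/ler_addgt0Pr => e e0.
have a1 : 0 <= 2 * (L^-1 * W t) by rewrite !mulr_ge0 // ltW.
have a2 : 0 <= 2 * (L^-1 * W (t + h)) by rewrite !mulr_ge0 // ltW.
pose e' := e / (4 * (1 + L * `|h|)).
have lh : 0 <= L * `|h| by rewrite mulr_ge0 // ltW.
have e'0 : 0 < e' by rewrite divr_gt0 // mulr_gt0 //; lra.
have [n1 Hn1] := half_pow_small a1 e'0; have [n2 Hn2] := half_pow_small a2 e'0.
pose n := maxn n1 n2.
have pw i j : (i <= j)%N -> 2^-1 ^+ j <= 2^-1 ^+ i :> R.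
  by move=> ij; apply: ler_wiXn2l => //; lra.
have c1 m : (n <= m)%N -> `|y t - Y m t| <= e'.
  move=> nm; apply: le_trans (Hy t m) _; apply: le_trans Hn1; rewrite ler_wpM2l // pw //.
  by apply: leq_trans nm; exact: leq_maxl.
have c2 m : (n <= m)%N -> `|y (t + h) - Y m (t + h)| <= e'.
  move=> nm; apply: le_trans (Hy (t + h) m) _; apply: le_trans Hn2; rewrite ler_wpM2l // pw //.
  by apply: leq_trans nm; exact: leq_maxr.
have [xi [hxi E]] : exists xi, `|xi - t| <= `|h| /\ Y n.+1 (t + h) - Y n.+1 t = h * S xi (Y n xi).
  have [hp|hn|<-] := ltgtP 0 h; last by exists t; rewrite addr0 !subrr normr0 mul0r.
    have th : t < t + h by rewrite ltrDl.
    have [c [/andP[h1 h2] Ec]] := mvt_all (Yd n) th.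
    exists c; split; last by rewrite Ec; ring.
    by rewrite gtr0_norm ?subr_gt0 // gtr0_norm //; lra.
  have th : t + h < t by rewrite gtrDl.
  have [c [/andP[h1 h2] Ec]] := mvt_all (Yd n) th.
  exists c; split; first by rewrite ltr0_norm ?subr_lt0 // ltr0_norm //; lra.
  by rewrite -opprB Ec; ring.
have b1 : `|S xi (Y n xi) - S t (y t)| <= L * (2 * `|h| + e').
  apply: le_trans (S_lip _ _ _ _) _; rewrite ler_pM2l //.
  have k1 : `|Y n xi - y t| <= `|Y n xi - Y n t| + `|y t - Y n t|.
    rewrite [`|y t - _|]distrC; have -> : Y n xi - y t = (Y n xi - Y n t) + (Y n t - y t) by ring.
    exact: ler_normD.
  by have := Y_lip n xi t; have := c1 n (leqnn n); lra.
have b2 : `|h * (S xi (Y n xi) - S t (y t))| <= `|h| * (L * (2 * `|h| + e')).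
  by rewrite normrM ler_wpM2l.
have -> : y (t + h) - y t - h * S t (y t) = (y (t + h) - Y n.+1 (t + h)) - (y t - Y n.+1 t)
    + h * (S xi (Y n xi) - S t (y t)).
  by rewrite mulrBr -E; ring.
apply: le_trans (ler_normD _ _) _; apply: le_trans (lerD (ler_normB _ _) b2) _.
have := c1 n.+1 (leqnSn n); have := c2 n.+1 (leqnSn n).
have Ee : e' * (4 * (1 + L * `|h|)) = e by rewrite /e' divfK // gt_eqF // mulr_gt0 //; lra.
rewrite -(real_normK (num_real h)) expr2 => k1 k2.
have p1 : 0 <= e' * (L * `|h|) by rewrite mulr_ge0 // ltW.
by move: k1 k2 Ee p1; move: (`|y (t + h) - _|) (`|y t - _|) (`|h|) => A B H; nra.
Unshelve. all: by end_near. Qed.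

(** The function [(y t - z t) ^+ 2 * expR (2 * L * t)] is nondecreasing, so vanishing at the later
    time [T] forces it to vanish at 0. Uniqueness is needed in this backward direction, from the
    merging point to the start. *)
Lemma ode_unique (y z : R -> R) (T : R) : (forall t : R, is_derive t 1 y (S t (y t))) ->
  (forall t : R, is_derive t 1 z (S t (z t))) -> 0 <= T -> y T = z T -> y 0 = z 0.
Proof.
move=> Hy Hz T0 E.
pose u t := (y t - z t) ^+ 2 * expR (2 * L * t).
pose du t := (2 * (y t - z t) * (S t (y t) - S t (z t)) + 2 * L * (y t - z t) ^+ 2) * expR (2 * L * t).
have ud (t : R) : is_derive t 1 u (du t).
  have h1 := is_derive_affine 0 1 (-1) (Hy t) (Hz t).
  have h2 := is_deriveM h1 h1.
  have h3 := is_deriveM h2 (expR_scaled (2 * L) t).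
  rewrite (_ : u = ((fun u => 0 + 1 * y u + (-1) * z u) * (fun u => 0 + 1 * y u + (-1) * z u)) * (fun u => expR (2 * L * u))).
    rewrite (_ : du t = ((0 + 1 * y t + (-1) * z t) * (0 + 1 * y t + (-1) * z t)) *: (2 * L * expR (2 * L * t)) +
      expR (2 * L * t) *: ((0 + 1 * y t + (-1) * z t) *: (1 * S t (y t) + (-1) * S t (z t)) + (0 + 1 * y t + (-1) * z t) *: (1 * S t (y t) + (-1) * S t (z t)))); first exact: h3.
    by rewrite /du /GRing.scale /=; ring.
  by apply/funext => s; rewrite /u !fctE; ring.
have du0 t : 0 <= du t.
  apply: mulr_ge0; last exact: expR_ge0.
  have := S_lip t t (y t) (z t); rewrite subrr normr0 add0r => h.
  have : `|(y t - z t) * (S t (y t) - S t (z t))| <= `|y t - z t| * (L * `|y t - z t|).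
    by rewrite normrM ler_wpM2l.
  rewrite mulrCA -expr2 real_normK ?num_real // ler_norml => /andP[? ?]; lra.
have := nondecr_of_derive T0 ud (fun t _ => du0 t).
rewrite /u E subrr expr0n mul0r mulr0 expR0 mulr1 => h.
by apply/eqP; rewrite -subr_eq0 -sqrf_eq0 eq_le h sqr_ge0.
Qed.

End Picard.

(** * Leaves *)

Section Leaves.
Variable R : realType.
Notation V := 'rV[R]_2.
Notation T := (torus R).
Implicit Types (v w k : V) (p q : T) (L : set T).

Local Notation x0 := (x0 R). Local Notation t0 := (t0 R). Local Notation cc := (cc R).

Variables (z0 : V) (E : T -> {vspace V}).

(** Coordinates centred at the box in question: [z0] is 0 for [E] and [sink_base] for [F]. *)
Definition shifted v := tproj (v + z0).
Local Notation q := shifted.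
Definition along v w : Prop := w \in E (q v).

Lemma shifted_continuous : continuous q.
Proof.
move=> v; apply: (@continuous_comp _ _ _ (fun v => v + z0) (@tproj R)); last exact: tproj_continuous.
exact: (cvgD (@cvg_id _ (nbhs v)) (@cvg_cst _ z0 _ _ _)).
Qed.

Lemma shifted_eq v w : q v = q w <-> lattice (v - w).
Proof.
by rewrite /shifted tproj_eq (_ : v + z0 - (w + z0) = v - w) // opprD addrACA subrr addr0.
Qed.

Lemma shifted_lattice v k : lattice k -> q (v + k) = q v.
Proof. by move=> kl; apply/shifted_eq; rewrite addrC addKr. Qed.

Lemma shifted_inj_small v w : q v = q w -> `|px v - px w| < 1 -> `|py v - py w| < 1 -> v = w.
Proof.
move=> /shifted_eq l h1 h2; apply/subr0_eq/lattice_small => //.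
by rewrite norm_lt // !pE h1.
Qed.

Definition leaf_param L (C C' : R -> V) := [/\
  forall t : R, is_derive t 1 C (C' t), continuous C',
  forall t, C' t != 0 /\ along (C t) (C' t),
  forall p, L p <-> exists t, q (C t) = p &
  injective (q \o C) \/ (exists2 T : R, 0 < T & forall s t,
    q (C s) = q (C t) <-> exists k : int, s - t = k%:~R * T)].

Lemma leaf_param_exists L : integral_submanifold E L -> exists C C', leaf_param L C C'.
Proof.
move=> [c [c' [[Hc c'0] inj cL cE]]].
have [v0 v0c] := tproj_surj (c 0).
have [C [_ qC dC]] := path_lift Hc v0c.
have e t : q (C t - z0) = c t by rewrite /shifted subrK.
exists (fun t => C t - z0), c'; split.
- move=> t; apply/curve_components; have /curve_components[h1 h2] := dC t.
  split.
    have := is_derive_affine (- px z0) 1 0 h1 h1; rewrite mul0r addr0 mul1r.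
    by congr (is_derive _ _ _ _); apply/funext => u /=; rewrite !pE; ring.
  have := is_derive_affine (- py z0) 1 0 h2 h2; rewrite mul0r addr0 mul1r.
  by congr (is_derive _ _ _ _); apply/funext => u /=; rewrite !pE; ring.
- have [_ /(_ 1)] := Hc; rewrite (_ : (fun t => 1 *: c' t) = c') //.
  by apply/funext => t; rewrite scale1r.
- by move=> t; split => //; rewrite /along e -cE memv_line.
- move=> p; rewrite -cL; split=> [[t _ <-]|[t <-]]; first by exists t; rewrite e.
  by rewrite e; exists t.
- have -> : q \o (fun t => C t - z0) = c by apply/funext => t; exact: e.
  case: inj => [|[T T0 HT]]; [by left|right; exists T => // s t].
  by rewrite !e.
Qed.

(** The number [e] is 1 or -1. Moving the origin of time, reversing it and changing the lift makes a
    leaf start at a prescribed point of the plane and run to the left. *)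
Lemma leaf_param_affine L C C' (s e : R) k : leaf_param L C C' -> e ^+ 2 = 1 -> lattice k ->
  leaf_param L (fun t => C (s + e * t) + k) (fun t => e *: C' (s + e * t)).
Proof.
move=> [dC C'c CE CL inj] e1 kl.
have e0 : e != 0 by apply/eqP => h; move: e1; rewrite h expr0n => /eqP; rewrite eq_sym oner_eq0.
have qe u : q (C u + k) = q (C u) by exact: shifted_lattice.
have dl (t : R) : is_derive t 1 (fun t => s + e * t) e.
  have h := is_derive_id t (1 : R).
  have := is_derive_affine s e 0 h h; rewrite mul0r addr0 mulr1.
  by congr (is_derive _ _ _ _); apply/funext => u /=; rewrite mul0r addr0.
have lc t : {for t, continuous (fun t => s + e * t)} by exact: is_derive_cts (dl t).
have sur t : t = s + e * (e * (t - s)) by rewrite mulrA -expr2 e1; ring.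
split.
- move=> t; have h := chain_curve (dl t) (is_derive_diff (dC (s + e * t))).
  have /curve_components[h1 h2] := h.
  apply/curve_components; split.
    have := is_derive_affine (px k) 1 0 h1 h1; rewrite mul0r addr0 mul1r.
    by congr (is_derive _ _ _ _); apply/funext => u /=; rewrite !pE; ring.
  have := is_derive_affine (py k) 1 0 h2 h2; rewrite mul0r addr0 mul1r.
  by congr (is_derive _ _ _ _); apply/funext => u /=; rewrite !pE; ring.
- move=> t; apply: cvgZr; exact: (continuous_comp (lc t) (C'c _)).
- move=> t; have [h1 h2] := CE (s + e * t); split; first by rewrite scaler_eq0 negb_or e0.
  by rewrite /along qe memvZ.
- move=> p; rewrite CL; split=> -[t <-].
    by exists (e * (t - s)); rewrite qe -sur.
  by exists (s + e * t); rewrite qe.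
- case: inj => [inj|[T T0 HT]]; [left|right; exists T => //].
    move=> a b /=; rewrite !qe => /inj /addrI; exact: mulfI.
  move=> a b; rewrite !qe HT.
  have -> : s + e * a - (s + e * b) = e * (a - b) by ring.
  have sg : e = 1 \/ e = -1 by move/eqP: e1; rewrite sqrf_eq1 => /orP[/eqP|/eqP]; [left|right].
  case: sg => ->; first by rewrite mul1r.
  rewrite mulN1r; split=> -[j Hj]; exists (- j); first by rewrite -[LHS]opprK Hj rmorphN /= mulNr.
  by rewrite Hj rmorphN /= mulNr.
Qed.

(** Two passages through the same point differ by a period of the parametrization, possibly zero. *)
Lemma leaf_param_shift L C C' a b : leaf_param L C C' -> q (C a) = q (C b) ->
  forall u, q (C (a + u)) = q (C (b + u)).
Proof.
move=> [_ _ _ _ [inj|[T T0 HT]]].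
  by move=> /inj -> u.
move=> /HT [j Hj] u; apply/HT; exists j; rewrite -Hj; ring.
Qed.

Hypothesis K_cone : in_cone along.

Lemma leaf_px_neq0 L C C' t v : leaf_param L C C' -> q (C t) = q v -> `|py v| <= t0 + 2 * cc ->
  px (C' t) != 0.
Proof.
move=> [_ _ H _ _] e hv; have [C'0 KC] := H t.
have KC' : along v (C' t) by rewrite /along -e.
apply/eqP => p0; move/eqP: C'0; apply; apply: plane_ext; rewrite ?p0 ?px0 //.
have [C'0 _] := H t.
have := cone_flat_near K_cone hv KC' C'0; rewrite p0 normr0 normr_le0 => /eqP ->.
by rewrite py0.
Qed.

(* A transversal cannot stay inside a leaf: the leaf crosses a vertical line at isolated
   parameters, hence countably often. *)
Lemma leaf_not_vertical L C C' v (d : R) : leaf_param L C C' -> 0 < d ->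
  (forall y, `|y| < d -> `|py v + y| <= t0 + 2 * cc /\ L (q (v + pt 0 y))) -> False.
Proof.
move=> lC d0 Hy; have [dC C'c CE CL _] := lC.
pose d1 := Num.min d (1 / 2).
have d1p : 0 < d1 by rewrite lt_min d0 divr_gt0.
have d1d : d1 <= d by rewrite ge_min lexx.
pose A := [set y : R | `|y| < d1].
have /choice[s Hs] : forall y, exists t, A y -> q (C t) = q (v + pt 0 y).
  move=> y; have [Ay|nA] := pselect (A y); last by exists 0.
  have [_ /CL[t Ht]] := Hy y (lt_le_trans Ay d1d).
  by exists t.
have ys y : A y -> `|py (v + pt 0 y)| <= t0 + 2 * cc.
  by move=> Ay; have [] := Hy y (lt_le_trans Ay d1d); rewrite !pE.
have s_inj y y' : A y -> A y' -> s y = s y' -> y = y'.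
  move=> Ay Ay' e; have := Hs _ Ay; rewrite e Hs // => h.
  have hy : `|y' - y| < 1.
    have a1 : `|y| < 1 / 2 by apply: lt_le_trans Ay _; rewrite ge_min lexx orbT.
    have a2 : `|y'| < 1 / 2 by apply: lt_le_trans Ay' _; rewrite ge_min lexx orbT.
    by apply: le_lt_trans (ler_normB _ _) _; lra.
  have := shifted_inj_small h; rewrite !pE !addr0 subrr normr0.
  rewrite (_ : py v + y' - (py v + y) = y' - y); last by ring.
  by move=> /(_ ltr01 hy) /(congr1 py); rewrite !pE => /addrI.
(* All lifts [C (s y')] have the abscissa of [v] modulo 1, and the same abscissa if their parameters
   are close. Since [px (C' _)] does not vanish near [s y], Rolle's theorem forbids two such
   parameters. *)
have iso y : exists n : nat, A y -> forall y', A y' -> `|s y - s y'| < 2 / n.+1%:R -> y = y'.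
  have [Ay|nA] := pselect (A y); last by exists 0%N.
  have px_ne := leaf_px_neq0 lC (Hs y Ay) (ys y Ay).
  have cP (t : R) : {for t, continuous (px \o C)} by exact: is_derive_cts ((curve_components _ _ _).1 (dC t)).1.
  have cP' : continuous (px \o C') by move=> t; exact: (continuous_comp (C'c t) (@px_continuous _ _)).
  have near1 : \forall u \near s y, px (C' u) != 0.
    have /cvgr_neq0 := cP' (s y); exact.
  have near2 : \forall u \near s y, `|px (C (s y)) - px (C u)| < 1.
    by have /cvgrPdist_lt := cP (s y); apply.
  have /near_dist[e e0 He] : \forall u \near s y, px (C' u) != 0 /\ `|px (C (s y)) - px (C u)| < 1.
    by near=> u; split; near: u.
  have [n Hn] : exists n : nat, 2 / n.+1%:R < e.
    have h2 : 0 <= 2 / e by rewrite divr_ge0 // ltW.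
    exists (Num.bound (2 / e)); rewrite ltr_pdivrMr ?ltr0n // mulrC -ltr_pdivrMr //.
    have := archi_boundP h2; move/lt_trans; apply; by rewrite ltr_nat.
  exists n => _ y' Ay' hd; apply: s_inj => //; apply/eqP; apply: contrapT => /negP ne.
  have hs : `|s y' - s y| < e by rewrite distrC; exact: lt_trans Hn.
  have [_ h1] := He _ hs.
  have px_eq : px (C (s y)) = px (C (s y')).
    have e1 := Hs _ Ay; have e2 := Hs _ Ay'.
    move/shifted_eq: e1 => /andP[i1 _]; move/shifted_eq: e2 => /andP[i2 _].
    apply: subr0_eq; apply: int_small => //.
    have -> : px (C (s y)) - px (C (s y')) = px (C (s y) - (v + pt 0 y)) - px (C (s y') - (v + pt 0 y')).
      by rewrite !pE; ring.
    exact: rpredB.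
  have dx (t : R) : is_derive t 1 (px \o C) (px (C' t)) by exact: ((curve_components _ _ _).1 (dC t)).1.
  have rolle a b : `|a - s y| < e -> `|b - s y| < e -> px (C a) = px (C b) -> ~ a < b.
    move=> ha hb eab ab; have [c [/andP[ac cb] /eqP]] := mvt_all dx ab.
    rewrite /= eab subrr eq_sym mulf_eq0 subr_eq0 (gt_eqF ab) orbF => /eqP c0.
    have [] := He c _; last by rewrite c0 eqxx.
    by move: ha hb; rewrite !ltr_norml => /andP[? ?] /andP[? ?]; apply/andP; split; lra.
  have hs0 : `|s y - s y| < e by rewrite subrr normr0.
  by case/orP: (lt_total ne) => h; [apply: rolle h|apply: rolle h] => //.
have /choice[n Hn] := iso.
(* The pair [(n y, r y)] determines [y], so [A] would be countable; but it is an interval of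
   positive length. *)
have /choice[r Hr] : forall y, exists r : rat, `|s y - ratr r| < 1 / (n y).+1%:R.
  move=> y; have p : 0 < 1 / (n y).+1%:R :> R by rewrite divr_gt0 // ltr0n.
  have [|r] := @rat_in_itvoo R (s y - 1 / (n y).+1%:R) (s y + 1 / (n y).+1%:R).
    by rewrite ltrBlDr -addrA ltrDl addr_gt0.
  rewrite in_itv /= => /andP[h1 h2]; exists r.
  by rewrite ltr_distlC h1.
have cA : countable A.
  apply/countable_injP; exists (fun y => pickle (n y, r y)) => y y' /set_mem Ay /set_mem Ay'.
  move=> /(pcan_inj (@pickleK _)) [en er].
  apply: Hn => //.
  have := Hr y; have := Hr y'; rewrite -en -er => h1 h2.
  have -> : s y - s y' = (s y - ratr (r y)) - (s y' - ratr (r y)) by ring.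
  apply: le_lt_trans (ler_normB _ _) _.
  by rewrite (_ : 2 / _ = 1 / (n y).+1%:R + 1 / (n y).+1%:R) ?ltrD // -mulrDl.
have := countable_lebesgue_measure0 cA.
have -> : A = `]- d1, d1[%classic.
  by rewrite /A; apply/seteqP; split => y /=; rewrite in_itv /= ltr_norml.
rewrite lebesgue_measure_itv /= lte_fin ifT; last by lra.
by move=> /eqP; rewrite eqe opprK => /eqP; lra.
Unshelve. all: by end_near. Qed.

End Leaves.

(** * Leaves cannot stay in the box *)

Section Completeness.
Variable R : realType.
Notation V := 'rV[R]_2.
Notation T := (torus R).
Implicit Types (v w k : V) (p : T) (L : set T).

Local Notation x0 := (x0 R). Local Notation t0 := (t0 R). Local Notation cc := (cc R).

Lemma half_lt (d : R) : 0 < d -> d / 2 < d.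
Proof. by move=> d0; lra. Qed.

Lemma nonincreasing_limit (f : R -> R) (m : R) : (forall s t, 0 <= s -> s <= t -> f t <= f s) ->
  (forall t, 0 <= t -> m <= f t) ->
  exists l, (forall t, 0 <= t -> l <= f t) /\ f t @[t --> +oo] --> l.
Proof.
move=> fd fm; pose A := [set y | exists2 t, 0 <= t & y = f t].
have hA : has_inf A.
  by split; [exists (f 0), 0|exists m => _ [t t0_ ->]; exact: fm].
have le_f t : 0 <= t -> inf A <= f t by move=> ht; apply: ge_inf; [case: hA|exists t].
exists (inf A); split => //; apply/cvgrPdist_le => e e0.
have [_ [s s0 ->] hs] := inf_adherent e0 hA.
near=> t; have st : s <= t by near: t; apply: nbhs_pinfty_ge; exact: num_real.
have h1 := fd _ _ s0 st; have h2 := le_f t (le_trans s0 st).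
by rewrite distrC ger0_norm ?subr_ge0 // lerBlDl; apply: le_trans h1 (ltW hs).
Unshelve. all: by end_near. Qed.

Lemma fst_cts : continuous (@fst R R). Proof. move=> [a b]; exact: cvg_fst. Qed.
Lemma snd_cts : continuous (@snd R R). Proof. move=> [a b]; exact: cvg_snd. Qed.

Variables (z0 : V) (E : T -> {vspace V}) (P : set (set T)).
Hypothesis P_part : continuous_partition P.
Local Notation q := (shifted z0).
Local Notation along := (along z0 E).
Hypothesis K_cone : in_cone along.

Lemma same_leaf L L' p : P L -> P L' -> L p -> L' p -> L = L'.
Proof.
move=> PL PL' Lp L'p; have [_ [/(_ p)[M [_ HM]] _]] := P_part.
by rewrite -(HM L) // -(HM L').
Qed.

Section Chart.
Variables (phi : R * R -> T) (psi : T -> R * R).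
Hypothesis phi_open : forall A : set (R * R), open A -> open (phi @` A).
Hypothesis phi_leaf : forall t, exists2 L, P L & forall s, L (phi (s, t)).
Hypothesis phiK : cancel phi psi.

Lemma psi_continuous p : range phi p -> {for p, continuous psi}.
Proof.
move=> [x _ <-] A; rewrite /= phiK nbhsE => -[B [oB Bx] BA].
rewrite nbhsE; exists (phi @` B); first by split; [exact: phi_open|exists x].
by move=> _ [y By <-]; rewrite /= phiK; exact: BA.
Qed.

Lemma leaf_horizontal L p t : P L -> L p -> range phi p -> (psi p).2 = t -> forall s, L (phi (s, t)).
Proof.
move=> PL Lp [[a b] _ xp] <- s; rewrite -xp phiK /=.
have [L' PL' HL'] := phi_leaf b.
by rewrite (same_leaf PL PL' Lp) // -xp.
Qed.

Variables (L : set T) (C C' : R -> V).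
Hypothesis PL : P L.
Hypothesis lC : leaf_param z0 E L C C'.

Let dC : forall t : R, is_derive t 1 C (C' t). Proof. by case: lC. Qed.

Lemma leaf_chart_continuous t : range phi (q (C t)) -> {for t, continuous (psi \o q \o C)}.
Proof.
move=> Ht; have h1 := psi_continuous Ht.
have h2 : {for C t, continuous (psi \o q)} by exact: (continuous_comp (@shifted_continuous _ z0 (C t)) h1).
exact: (continuous_comp (is_derive_cts (dC t)) h2).
Qed.

Lemma leaf_chart_component (i : R * R -> R) a b : continuous i ->
  (forall t, a <= t <= b -> range phi (q (C t))) ->
  {within `[a, b], continuous (fun t => i (psi (q (C t))))}.
Proof.
move=> ci H; apply: continuous_in_subspaceT => t /set_mem /=; rewrite in_itv /= => /H /leaf_chart_continuous h.
exact: (continuous_comp h (ci _)).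
Qed.

(* Otherwise the leaf would contain an open set, hence a vertical segment. *)
Lemma leaf_plaque k a b : lattice k -> a <= b ->
  (forall t, a <= t <= b -> range phi (q (C t)) /\ `|py (C t + k)| <= t0 + cc) ->
  (psi (q (C a))).2 = (psi (q (C b))).2.
Proof.
move=> kl ab H; pose f t := (psi (q (C t))).2.
have fc : {within `[a, b], continuous f}.
  by apply: leaf_chart_component => [|t /H[]//]; exact: snd_cts.
apply/eqP; apply: contrapT => /negP ne; rewrite -/(f a) -/(f b) in ne.
(* By the intermediate value theorem the arc meets every horizontal line of the chart between the
   heights [lo] and [hi], so the leaf contains that whole strip. *)
have [lo [hi [lohi Elo Ehi]]] : exists lo hi, [/\ lo < hi, Num.min (f a) (f b) = lo & Num.max (f a) (f b) = hi].
  exists (Num.min (f a) (f b)), (Num.max (f a) (f b)); split => //.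
  by case/orP: (lt_total ne) => h; rewrite lt_max !gt_min h ?orbT.
have ivt y : lo <= y <= hi -> exists2 c, a <= c <= b & f c = y.
  by rewrite -Elo -Ehi => /(IVT ab fc)[c]; rewrite in_itv /=; exists c.
pose y := (lo + hi) / 2; have [|c cab fcy] := ivt y; first by apply/andP; split; rewrite /y; lra.
have CL p : L p <-> exists t, q (C t) = p by case: lC.
have [[x _ phx] hk] := H c cab.
pose A := [set x : R * R | `|x.2 - y| < (hi - lo) / 2].
have oA : open A.
  rewrite (_ : A = snd @^-1` [set z | `|z - y| < (hi - lo) / 2]) //.
  apply: open_comp; first by move=> ? _; exact: snd_cts.
  rewrite (_ : [set z | _] = ball y ((hi - lo) / 2)); first exact: ball_open.
  by apply/seteqP; split => z /=; rewrite /ball /= distrC.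
have Ax : A x.
  by rewrite /A /=; move: fcy; rewrite /f -phx phiK => ->; rewrite subrr normr0; lra.
have AL : phi @` A `<=` L.
  move=> _ [[u1 u2] /= Au <-].
  have [|c' cab' fc'] := ivt u2.
    by move: Au; rewrite /A /= ltr_norml /y => /andP[? ?]; apply/andP; split; lra.
  apply: (leaf_horizontal PL _ (H c' cab').1 fc').
  by apply/CL; exists c'.
pose v := C c + k.
have [d d0 Hd] : exists2 d, 0 < d & forall w, `|w - v| < d -> L (q w).
  have : \forall w \near v, (phi @` A) (q w).
    apply: shifted_continuous; apply: open_nbhs_nbhs; split; first exact: phi_open.
    by exists x => //; rewrite phx /v shifted_lattice.
  move=> /nbhs_ballP[d /= d0 dP]; exists d => // w wd; apply: AL; apply: dP => /=.
  by rewrite -ball_normE /= distrC.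
have c0 := cc_gt0 R.
apply: (@leaf_not_vertical _ z0 E K_cone _ _ _ v (Num.min d cc) lC).
  by rewrite lt_min d0.
move=> s; rewrite lt_min => /andP[s1 s2]; split.
  by apply: le_trans (ler_normD _ _) _; rewrite -/v in hk; lra.
apply: Hd; rewrite addrC addKr norm_lt // !pE normr0 d0 /=; exact: s1.
Qed.

End Chart.

(* A leaf staying in the box would converge. In a chart around the limit point its tail and an
   arc of the leaf through that point would lie in the same horizontal line, so that the tail
   would meet the arc, against the injectivity of the parametrization. *)
Lemma leaf_leaves_box L C C' : P L -> leaf_param z0 E L C C' -> px (C' 0) < 0 ->
  (forall t, 0 <= t -> box x0 t0 (C t)) -> False.
Proof.
move=> PL lC C'0 Hbox; have [dC C'c CE CL inj] := lC.
have c0 := cc_gt0 R; have /andP[x0p x0h] := x0_bounds R.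
have /andP[t0p t0h] := t0_bounds R.
have cP' : continuous (px \o C') by move=> t; exact: (continuous_comp (C'c t) (@px_continuous _ _)).
have neg u : 0 <= u -> px (C' u) < 0.
  move=> u0; apply: (@nonvanishing_neg _ (px \o C') 0 u) => //; last by rewrite u0 lexx.
  move=> s /andP[s0 _]; apply: (leaf_px_neq0 K_cone lC (erefl (q (C s)))).
  by have [_ h] := Hbox s s0; lra.
have dx (t : R) := ((curve_components _ _ _).1 (dC t)).1.
have dy (t : R) := ((curve_components _ _ _).1 (dC t)).2.
have px_decr s t : 0 <= s -> s < t -> px (C t) < px (C s).
  move=> s0 st; have [c [/andP[sc _] Ec]] := mvt_all dx st.
  rewrite -subr_lt0 [X in X < _]Ec nmulr_rlt0 ?subr_gt0 //.
  by apply: neg; apply: le_trans s0 (ltW sc).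
have flat u : 0 <= u -> `|py (C' u)| <= - px (C' u).
  move=> u0; rewrite -[leRHS]ltr0_norm ?neg //.
  by have [n0 kc] := CE u; apply: (cone_flat K_cone (Hbox u u0)).
(* For [e] equal to 1 and -1: as the curve is flat and runs to the left, [px + py] and [px - py]
   both decrease. Being bounded they converge, and so does the curve. *)
have mono (e : R) : `|e| <= 1 -> forall s t, 0 <= s -> s <= t ->
    0 + 1 * px (C t) + e * py (C t) <= 0 + 1 * px (C s) + e * py (C s).
  move=> e1 s t s0 st.
  have D (u : R) : is_derive u 1 (fun u => 0 + (-1) * px (C u) + (- e) * py (C u))
      ((-1) * px (C' u) + (- e) * py (C' u)) by exact: is_derive_affine.
  have := nondecr_of_derive st D; rewrite !mulN1r !mulNr !mul1r => H.
  suff : 0 - px (C s) - e * py (C s) <= 0 - px (C t) - e * py (C t) by lra.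
  apply: H => u /andP[su _].
  have h1 := flat u (le_trans s0 su).
  have : `|e * py (C' u)| <= - px (C' u).
    by rewrite normrM; apply: le_trans h1; rewrite ler_piMl.
  by rewrite ler_norml => /andP[? ?]; lra.
have bnd (e : R) : `|e| <= 1 -> forall t, 0 <= t -> - 2 <= 0 + 1 * px (C t) + e * py (C t).
  move=> e1 t ht; have [b1 b2] := Hbox t ht.
  have : `|e * py (C t)| <= 1 by rewrite normrM; apply: le_trans (ler_piMl _ e1) _ => //; lra.
  by move: b1; rewrite !ler_norml => /andP[? ?] /andP[? ?]; lra.
have n1 : `|1 : R| <= 1 by rewrite normr1.
have nN1 : `|-1 : R| <= 1 by rewrite normrN1.
have [lp [lp_le lp_cvg]] := nonincreasing_limit (mono _ n1) (bnd _ n1).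
have [lm [lm_le lm_cvg]] := nonincreasing_limit (mono _ nN1) (bnd _ nN1).
pose w := pt ((lp + lm) / 2) ((lp - lm) / 2).
have Cw : C t @[t --> +oo] --> w.
  have -> : C = fun t => pt (((0 + 1 * px (C t) + 1 * py (C t)) + (0 + 1 * px (C t) + (-1) * py (C t))) / 2)
      (((0 + 1 * px (C t) + 1 * py (C t)) - (0 + 1 * px (C t) + (-1) * py (C t))) / 2).
    by apply/funext => t; apply: plane_ext; rewrite !pE; lra.
  apply: pt_cvg; (apply: cvgM; last exact: cvg_cst).
    exact: (cvgD lp_cvg lm_cvg).
  exact: (cvgB lp_cvg lm_cvg).
have w_lt t : 0 <= t -> px w < px (C t).
  move=> ht; have [] := (lp_le (t + 1), lm_le (t + 1)).
  rewrite !pE => h1 h2; have ht1 : 0 <= t + 1 by lra.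
  have := h1 ht1; have := h2 ht1.
  have : px (C (t + 1)) < px (C t) by apply: px_decr => //; lra.
  lra.
have [phi [phi0 phi_inj phi_cts phi_open phi_leaf]] := P_part.2.2 (q w).
(* Off the range of the chart this inverse has the default value [(0, 0)], hence the range
   conditions carried along below. *)
have [psi phiK] : exists psi, cancel phi psi.
  have /choice[psi Hpsi] : forall p, exists x, range phi p -> phi x = p.
    by move=> p; have [[x _ <-]|np] := pselect (range phi p); [exists x|exists (0, 0)].
  by exists psi => x; apply: phi_inj; apply: Hpsi; exists x.
have psi0 : psi (q w) = (0, 0) by rewrite -phi0 phiK.
have [d d0 Hd] : exists2 d, 0 < d & forall v, `|v - w| < d -> range phi (q v).
  have : \forall v \near w, range phi (q v).
    apply: shifted_continuous; apply: open_nbhs_nbhs; split; first by apply: phi_open; exact: openT.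
    by exists (0, 0).
  move=> /nbhs_ballP[d /= d0 dP]; exists d => // v vd; apply: dP => /=.
  by rewrite -ball_normE /= distrC.
pose d' := Num.min d (cc / 2).
have d'0 : 0 < d' by rewrite lt_min d0 divr_gt0.
have [t1 t1_0 Ht1] : exists2 t1, 0 <= t1 & forall t, t1 <= t -> `|C t - w| < d'.
  have /cvgrPdist_lt/(_ d' d'0)[M [_ HM]] := Cw.
  exists (Num.max 0 (M + 1)); first by rewrite le_max lexx.
  by move=> t; rewrite ge_max => /andP[_ Mt]; rewrite distrC; apply: HM; lra.
have w_py : `|py w| <= t0 + cc / 2.
  have := Ht1 t1 (lexx _); rewrite norm_lt // pyB => /andP[_].
  rewrite lt_min => /andP[_ h]; have [_ b2] := Hbox t1 t1_0.
  have -> : py w = py (C t1) - (py (C t1) - py w) by ring.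
  by apply: le_trans (ler_normB _ _) _; lra.
have in_chart t : t1 <= t -> range phi (q (C t)).
  by move=> /Ht1; rewrite lt_min => /andP[h _]; exact: Hd.
have lattice0 : lattice (0 : V) by rewrite /lattice px0 py0 rpred0.
have cst t : t1 <= t -> (psi (q (C t1))).2 = (psi (q (C t))).2.
  move=> ht; apply: (leaf_plaque phi_open phi_leaf phiK PL lC lattice0 ht) => s /andP[h1 h2].
  split; first exact: in_chart.
  by rewrite addr0; have [_ b] := Hbox s (le_trans t1_0 h1); lra.
have psi_cvg : psi (q (C t)) @[t --> +oo] --> (0, 0).
  rewrite -psi0; apply: (@continuous_cvg _ _ _ _ _ _ (psi \o q)) => //.
  apply: continuous_comp; first exact: shifted_continuous.
  by apply: (psi_continuous phi_open phiK); exists (0, 0).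
have tau0 t : t1 <= t -> (psi (q (C t))).2 = 0.
  move=> ht; rewrite -(cst t ht); symmetry.
  have h2 : (psi (q (C t))).2 @[t --> +oo] --> (0 : R) by exact: (@continuous_cvg _ _ _ _ _ _ snd _ (@snd_cts _) psi_cvg).
  apply: norm_cvg_unique h2 _.
  apply: cvg_near_cst; near=> s; rewrite (cst s) //; near: s; apply: nbhs_pinfty_ge; exact: num_real.
have Lz : L (q w).
  rewrite -phi0; apply: (leaf_horizontal phi_leaf phiK PL _ (in_chart t1 (lexx _)) (tau0 _ (lexx _))).
  by apply/CL; exists t1.
(* A closed leaf is excluded: after one period [px] would have decreased strictly, while two points
   of the box over the same point of the torus are equal. *)
have C_inj : injective (q \o C).
  case: inj => // -[S S0 HS]; exfalso.
  have : q (C 0) = q (C S) by apply/HS; exists (-1); rewrite sub0r mulN1r.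
  have [a1 a2] := Hbox 0 (lexx _); have [b1 b2] := Hbox S (ltW S0).
  move=> /shifted_inj_small e; have := px_decr 0 S (lexx _) S0; rewrite -e ?ltxx //.
    by apply: le_lt_trans (ler_normB _ _) _; lra.
  by apply: le_lt_trans (ler_normB _ _) _; lra.
have [s0 Hs0] := (CL _).1 Lz.
(* The leaf passes through the limit point at the parameter [s0], but perhaps with another lift; [k]
   brings this arc next to the box, as [leaf_plaque] requires. *)
pose k := w - C s0.
have kl : lattice k by apply/(shifted_eq z0).
have qk s : q (C s + k) = q (C s) by exact: shifted_lattice.
have [d1 d1_0 Hd1] : exists2 d1, 0 < d1 & forall s, `|s - s0| < d1 -> `|C s + k - w| < d'.
  apply: near_dist; have /cvgrPdist_lt := is_derive_cts (dC s0).
  move=> /(_ d' d'0); apply: filterS => s; rewrite distrC.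
  have -> : C s + k - w = C s - C s0 by rewrite /k addrA addrAC addrK.
  by [].
pose a := s0 - d1 / 2; pose b := s0 + d1 / 2.
have near_s0 s : a <= s <= b -> range phi (q (C s)) /\ `|py (C s + k)| <= t0 + cc.
  move=> /andP[h1 h2]; have hs : `|C s + k - w| < d'.
    apply: Hd1; apply: le_lt_trans (half_lt d1_0).
    by rewrite ler_distl h1.
  move: hs; rewrite lt_min => /andP[hs1 hs2]; split; first by rewrite -qk; exact: Hd.
  have := py_le_norm (C s + k - w); rewrite pyB => h3.
  have -> : py (C s + k) = (py (C s + k) - py w) + py w by ring.
  by apply: le_trans (ler_normD _ _) _; lra.
have as0 : a < s0 by rewrite ltrBlDr ltrDl divr_gt0.
have s0b : s0 < b by rewrite ltrDl divr_gt0.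
have ab : a <= b by rewrite ltW // (lt_trans as0).
have psi_s0 : psi (q (C s0)) = (0, 0) by rewrite Hs0.
have tau_s0 s : a <= s <= b -> (psi (q (C s))).2 = 0.
  have pl s' t : a <= s' -> s' <= t -> t <= b -> (psi (q (C s'))).2 = (psi (q (C t))).2.
    move=> h1 h2 h3; apply: (leaf_plaque phi_open phi_leaf phiK PL lC kl h2) => u /andP[h4 h5].
    by apply: near_s0; rewrite (le_trans h1) //= (le_trans h5).
  move=> /andP[h1 h2]; have [h|/ltW h] := leP s s0.
    by rewrite (pl s s0) ?psi_s0 // ltW.
  by rewrite -(pl s0 s) ?psi_s0 // ltW.
pose sg s := (psi (q (C s))).1.
have sg_eq s t : range phi (q (C s)) -> range phi (q (C t)) -> (psi (q (C s))).2 = 0 ->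
    (psi (q (C t))).2 = 0 -> sg s = sg t -> s = t.
  move=> [x _ xs] [y _ yt] e1 e2 e3; apply: C_inj => /=.
  move: e1 e2 e3; rewrite /sg -xs -yt !phiK; case: x {xs} => x1 x2; case: y {yt} => y1 y2 /=.
  by move=> -> -> ->.
have sgc : {within [set` `[a, b]], continuous sg}.
  by apply: (leaf_chart_component phi_open phiK lC) => [|t /near_s0[]//]; exact: fst_cts.
have sg_inj : {in `[a, b] &, injective sg}.
  move=> s t; rewrite !in_itv /= => hs ht; apply: sg_eq;
    by [have [] := near_s0 _ hs|have [] := near_s0 _ ht|exact: tau_s0].
have sg0 : sg s0 = 0 by rewrite /sg psi_s0.
(* A continuous injective function on an interval is monotone, so [sg] changes sign at the inner
   point [s0]: the arc covers a neighbourhood of 0 in its horizontal line. *)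
have sgn : Num.min (sg a) (sg b) < 0 < Num.max (sg a) (sg b).
  have ia : a \in `[a, b] by rewrite in_itv /= lexx.
  have ib : b \in `[a, b] by rewrite in_itv /= lexx andbT.
  have is0 : s0 \in `[a, b] by rewrite in_itv /= !ltW.
  have [m|m] := itv_continuous_inj_mono sgc sg_inj.
    have := m _ _ ia is0 as0; have := m _ _ is0 ib s0b; rewrite sg0 => h1 h2.
    by rewrite gt_min h2 lt_max h1 orbT.
  have := m _ _ is0 ia as0; have := m _ _ ib is0 s0b; rewrite sg0 => h1 h2.
  by rewrite gt_min h1 orbT lt_max h2.
have sg_cvg : sg t @[t --> +oo] --> (0 : R).
  exact: (@continuous_cvg _ _ _ _ _ _ fst _ (@fst_cts _) psi_cvg).
have /andP[m0 M0] := sgn.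
(* A parameter of the tail beyond the arc, hence [b < t], but with horizontal coordinate in the
   range of the arc. *)
have /filter_ex[t [ht1 [ht2 [ht3 ht4]]]] : \forall t \near +oo, t1 <= t /\ b < t /\
    Num.min (sg a) (sg b) < sg t /\ sg t < Num.max (sg a) (sg b).
  near=> t; split; [|split; [|split]]; near: t.
  - by apply: nbhs_pinfty_ge; exact: num_real.
  - by apply: nbhs_pinfty_gt; exact: num_real.
  - exact: (cvgr_gt _ sg_cvg).
  - exact: (cvgr_lt _ sg_cvg).
have [|c] := IVT ab sgc (v := sg t); first by rewrite !ltW.
rewrite in_itv /= => hc Ec.
have e : c = t.
  apply: sg_eq => //; [by have [] := near_s0 _ hc|exact: in_chart|exact: tau_s0|exact: tau0].
by move: hc; rewrite e => /andP[_]; rewrite leNgt ht2.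
Unshelve. all: by end_near. Qed.

End Completeness.

(** * Merging contradicts integrability *)

Section NotIntegrable.
Variable R : realType.
Notation V := 'rV[R]_2.
Notation T := (torus R).
Implicit Types (v w k : V) (p : T) (L : set T).

Local Notation x0 := (x0 R). Local Notation t0 := (t0 R). Local Notation cc := (cc R).

Variables (z0 : V) (E : T -> {vspace V}).
Local Notation q := (shifted z0).
Local Notation along := (along z0 E).
Hypothesis K_cone : in_cone along.

Lemma leaf_param_Ecurve L C C' : leaf_param z0 E L C C' -> Ecurve x0 t0 along C C'.
Proof. by move=> [dC C'c CE _ _]; split. Qed.

Lemma leaf_param_start P L C C' v : continuous_partition P -> P L -> leaf_param z0 E L C C' ->
  L (q v) -> `|py v| <= t0 ->
  exists (s e : R) k, let D t := C (s + e * t) + k in let D' t := e *: C' (s + e * t) in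
    [/\ e ^+ 2 = 1, lattice k, leaf_param z0 E L D D', D 0 = v /\ px (D' 0) < 0 &
      exists2 b, 0 <= b & ~ box x0 t0 (D b)].
Proof.
move=> P_part PL lC Lv pv; have [_ _ _ CL _] := lC.
have [s Hs] := (CL _).1 Lv.
have px_ne : px (C' s) != 0.
  by apply: (leaf_px_neq0 K_cone lC Hs); have := cc_gt0 R; lra.
(* The direction in which the parametrization runs to the left. *)
pose e : R := if px (C' s) < 0 then 1 else - 1.
have e2 : e ^+ 2 = 1 by rewrite /e; case: ifP; rewrite ?sqrrN expr1n.
have kl : lattice (v - C s) by apply/(shifted_eq z0).
have lD := leaf_param_affine s lC e2 kl.
have px_lt : px (e *: C' (s + e * 0)) < 0.
  rewrite mulr0 addr0 pxZ /e; case: ifP => [h|h]; first by rewrite mul1r.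
  by rewrite mulN1r oppr_lt0 lt_neqAle eq_sym px_ne /= leNgt h.
exists s, e, (v - C s); split => //.
  by split => //; rewrite mulr0 addr0 addrC subrK.
apply: contrapT => nex; apply: (leaf_leaves_box P_part K_cone PL lD px_lt) => t ht.
by apply: contrapT => nb; apply: nex; exists t.
Qed.

Hypothesis K_merge : merging along.

Lemma merging_leaves P L1 L2 C1 C1' C2 C2' v1 v2 : continuous_partition P ->
  P L1 -> leaf_param z0 E L1 C1 C1' -> L1 (q v1) -> px v1 = x0 -> `|py v1| <= t0 ->
  P L2 -> leaf_param z0 E L2 C2 C2' -> L2 (q v2) -> px v2 = x0 -> `|py v2| <= t0 ->
  exists (s1 e1 : R) k1 (s2 e2 : R) k2 (T1 T2 : R),
    let D1 t := C1 (s1 + e1 * t) + k1 in let D1' t := e1 *: C1' (s1 + e1 * t) in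
    let D2 t := C2 (s2 + e2 * t) + k2 in let D2' t := e2 *: C2' (s2 + e2 * t) in
    [/\ [/\ e1 ^+ 2 = 1, e2 ^+ 2 = 1, lattice k1 & lattice k2],
        D1 0 = v1 /\ D2 0 = v2, 0 <= T1 /\ 0 <= T2,
        (forall u, 0 <= u <= T1 -> px (D1' u) < 0) /\ (forall u, 0 <= u <= T2 -> px (D2' u) < 0) &
        D1 T1 = D2 T2].
Proof.
move=> P_part PL1 l1 Lv1 x1 y1 PL2 l2 Lv2 x2 y2.
have [s1 [e1 [k1 [e11 kl1 lD1 [D10 D1n] [b1 b1_0 nb1]]]]] := leaf_param_start P_part PL1 l1 Lv1 y1.
have [s2 [e2 [k2 [e22 kl2 lD2 [D20 D2n] [b2 b2_0 nb2]]]]] := leaf_param_start P_part PL2 l2 Lv2 y2.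
have E1 := leaf_param_Ecurve lD1; have E2 := leaf_param_Ecurve lD2.
have a1 : px (C1 (s1 + e1 * 0) + k1) = x0 by rewrite D10.
have a2 : `|py (C1 (s1 + e1 * 0) + k1)| <= t0 by rewrite D10.
have c1 : px (C2 (s2 + e2 * 0) + k2) = x0 by rewrite D20.
have c2 : `|py (C2 (s2 + e2 * 0) + k2)| <= t0 by rewrite D20.
have [T1 [T2 [T10 T20 H1 H2 HT]]] := K_merge E1 b1_0 a1 a2 D1n nb1 E2 b2_0 c1 c2 D2n nb2.
exists s1, e1, k1, s2, e2, k2, T1, T2; split => //.
by split=> u hu; [have [] := H1 u hu|have [] := H2 u hu].
Qed.

Lemma leaf_derive_eq (f g : R -> V) (t : R) w w' : is_derive t 1 f w -> is_derive t 1 g w' ->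
  (forall s, f s = g s) -> w = w'.
Proof.
move=> [_ <-] [_ <-] e; suff -> : f = g by [].
by apply/funext.
Qed.

Lemma px_curve_decreasing (D D' : R -> V) (a b : R) : (forall t : R, is_derive t 1 D (D' t)) ->
  (forall u, 0 <= u <= b -> px (D' u) < 0) -> 0 <= a -> a < b -> px (D b) < px (D a).
Proof.
move=> dD Hn a0 ab.
have dx (t : R) := ((curve_components _ _ _).1 (dD t)).1.
have [c [/andP[ac cb] Ec]] := mvt_all dx ab.
rewrite -subr_lt0 [X in X < _]Ec nmulr_rlt0 ?subr_gt0 //.
by apply: Hn; rewrite (ltW (le_lt_trans a0 ac)) ltW.
Qed.

(* Two leaves that merge coincide. The lifts of their parametrizations then agree around the
   merging point, up to the direction in which they run through the leaf. Opposite directions are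
   impossible since both lifts run to the left, and equal ones since the starting points differ. *)
Lemma merging_not_integrable : ~ integrable_bundle E.
Proof.
move=> [P [P_part PE]].
have /andP[t0p _] := t0_bounds R; have /andP[x0p _] := x0_bounds R.
pose v1 := pt x0 0 : V; pose v2 := pt x0 t0 : V.
have x1 : px v1 = x0 by rewrite px_pt.
have x2 : px v2 = x0 by rewrite px_pt.
have y1 : `|py v1| <= t0 by rewrite py_pt normr0 ltW.
have y2 : `|py v2| <= t0 by rewrite py_pt ger0_norm // ltW.
have [L1 [[PL1 Lv1] _]] := P_part.2.1 (q v1).
have [L2 [[PL2 Lv2] _]] := P_part.2.1 (q v2).
have [C [C' lC]] := leaf_param_exists z0 (PE _ PL1).
have [C2 [C2' lC2]] := leaf_param_exists z0 (PE _ PL2).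
have L12 : L1 = L2.
  have [s1 [e1 [k1 [s2 [e2 [k2 [T1 [T2 /= [[_ _ kl1 kl2] _ _ _ HT]]]]]]]]] :=
    merging_leaves P_part PL1 lC Lv1 x1 y1 PL2 lC2 Lv2 x2 y2.
  apply: (same_leaf P_part PL1 PL2 (p := q (C (s1 + e1 * T1)))).
    by have [_ _ _ -> _] := lC; exists (s1 + e1 * T1).
  have [_ _ _ -> _] := lC2; exists (s2 + e2 * T2).
  by rewrite -(shifted_lattice z0 (C (s1 + e1 * T1)) kl1) HT shifted_lattice.
rewrite -L12 in Lv2.
(* This second application takes the same parametrization [C] for both starting points, so that the
   lifts can be compared by [leaf_param_shift]. *)
have [s1 [e1 [k1 [s2 [e2 [k2 [T1 [T2 /= [[e11 e22 kl1 kl2] [D10 D20] [T10 T20] [n1 n2] HT]]]]]]]]] :=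
  merging_leaves P_part PL1 lC Lv1 x1 y1 PL1 lC Lv2 x2 y2.
have lD1 := leaf_param_affine s1 lC e11 kl1; have lD2 := leaf_param_affine s2 lC e22 kl2.
have [dD1 _ _ _ _] := lD1; have [dD2 _ _ _ _] := lD2.
have [dC _ _ _ _] := lC.
pose a := s1 + e1 * T1; pose b := s2 + e2 * T2.
have qab : q (C a) = q (C b).
  by rewrite -(shifted_lattice z0 (C a) kl1) HT shifted_lattice.
have qs := leaf_param_shift lC qab.
have shift (c : R) k : continuous (fun u => C (c + u) + k).
  move=> u; apply: cvgD; last exact: cvg_cst.
  apply: (@continuous_comp _ _ _ (fun u => c + u) C); last exact: is_derive_cts (dC (c + u)).
  exact: (cvgD (@cvg_cst _ c _ _ _) (@cvg_id _ (nbhs u))).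
have eqC u : C (a + u) + k1 = C (b + u) + k2.
  apply: (lift_unique (shift a k1) (shift b k2)); last by rewrite !addr0.
  have kk : lattice (k2 - k1) by exact: lattice_sub.
  move=> t; apply/tproj_eq; rewrite opprD addrACA -(opprB k2).
  by apply: lattice_sub => //; apply/(shifted_eq z0).
have eqD u : C (s1 + e1 * (T1 + e1 * u)) + k1 = C (s2 + e2 * (T2 + e2 * u)) + k2.
  rewrite !mulrDr !mulrA -!expr2 e11 e22 !mul1r !addrA; exact: eqC.
have sg e : e ^+ 2 = 1 -> e = 1 \/ e = -1 :> R.
  by move/eqP; rewrite sqrf_eq1 => /orP[/eqP|/eqP]; [left|right].
have v12 : v1 <> v2 by move=> /(congr1 py); rewrite !py_pt => e; move: t0p; rewrite -e ltxx.
have [ee|ee] : e1 = e2 \/ e1 = - e2.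
  by case: (sg _ e11) => ->; case: (sg _ e22) => ->; rewrite ?opprK; [left|right|right|left].
- rewrite -ee in n2 D20 dD2.
  case: (ltgtP T1 T2) => [h|h|h].
  (* At time [T2 - T1] the second lift is at [v1]: it would have returned to the abscissa [x0] from
     which it started, although it runs to the left. *)
  + have h0 : 0 < T2 - T1 by rewrite subr_gt0.
    have Hn u : 0 <= u <= T2 - T1 -> px (e1 *: C' (s2 + e1 * u)) < 0.
      by move=> /andP[u0 uT]; apply: n2; rewrite u0 /=; lra.
    have := px_curve_decreasing dD2 Hn (lexx 0) h0.
    have := eqD (- (e1 * T1)); rewrite -ee mulrN mulrA -expr2 e11 mul1r subrr D10 => <-.
    by rewrite D20 x1 x2 ltxx.
  + have h0 : 0 < T1 - T2 by rewrite subr_gt0.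
    have Hn u : 0 <= u <= T1 - T2 -> px (e1 *: C' (s1 + e1 * u)) < 0.
      by move=> /andP[u0 uT]; apply: n1; rewrite u0 /=; lra.
    have := px_curve_decreasing dD1 Hn (lexx 0) h0.
    have := eqD (- (e1 * T2)); rewrite -ee mulrN mulrA -expr2 e11 mul1r subrr D20 => ->.
    by rewrite D10 x1 x2 ltxx.
  + apply: v12; rewrite -D10 -D20; have := eqD (- (e1 * T1)).
    by rewrite -ee -h !mulrN !mulrA -!expr2 e11 !mul1r !subrr.
- have Caeb : C' a = C' b.
    have l1 : (1 : R) ^+ 2 = 1 by rewrite expr1n.
    have [da _ _ _ _] := leaf_param_affine a lC l1 kl1.
    have [db _ _ _ _] := leaf_param_affine b lC l1 kl2.
    have := leaf_derive_eq (da 0) (db 0); rewrite !mulr0 !addr0 !scale1r; apply => u.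
    by rewrite !mul1r.
  have m1 : px (e1 *: C' a) < 0 by apply: n1; rewrite T10 lexx.
  have m2 : px (e2 *: C' b) < 0 by apply: n2; rewrite T20 lexx.
  by move: m1 m2; rewrite Caeb ee scaleNr pxN; lra.
Qed.

End NotIntegrable.

(** * Merging contradicts the Lipschitz property *)

Section NotLipschitz.
Variable R : realType.
Notation V := 'rV[R]_2.
Notation T := (torus R).
Implicit Types (v w k : V) (p : T).

Local Notation x0 := (x0 R). Local Notation t0 := (t0 R). Local Notation cc := (cc R).

(** Retraction of the line onto an interval. Composed with it, the slope, which is controlled only
    in the box, becomes bounded and Lipschitz on the whole plane. *)
Definition clamp (m z : R) := Num.max (- m) (Num.min m z).

Lemma clamp_le m z : 0 <= m -> `|clamp m z| <= m.
Proof.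
move=> m0; rewrite ler_norml /clamp le_max lexx ge_max ge_min lexx /= andbT.
by lra.
Qed.

Lemma clamp_id m z : `|z| <= m -> clamp m z = z.
Proof.
by rewrite ler_norml /clamp => /andP[h1 h2]; rewrite (min_r h2) max_r.
Qed.

Lemma clamp_lip m u z : `|clamp m u - clamp m z| <= `|u - z|.
Proof.
rewrite /clamp; have := ler_norm (u - z); have := ler_norm (z - u); rewrite (distrC z u).
move: (`|u - z|) => n h1 h2.
have n0 : 0 <= n by lra.
rewrite ler_norml; apply/andP; split; rewrite /Num.max /Num.min;
  repeat case: ifP => //; repeat (move/negbT || rewrite -leNgt); lra.
Qed.

Variables (z0 : V) (E : T -> {vspace V}).
Local Notation q := (shifted z0).
Local Notation along := (along z0 E).
Hypothesis K_cone : in_cone along.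
Hypothesis E_dim : forall p, \dim (E p) = 1%N.

Definition slope v := py (vpick (E (q v))) / px (vpick (E (q v))).

Lemma vpick_along v : vpick (E (q v)) != 0 /\ along v (vpick (E (q v))).
Proof.
split; last exact: memv_pick.
by rewrite vpick0 -dimv_eq0 E_dim.
Qed.

Lemma along_multiple v w : along v w -> exists a, w = a *: vpick (E (q v)).
Proof.
move=> Ew; have [n0 b] := vpick_along v.
have : E (q v) = <[vpick (E (q v))]>%VS.
  by apply/esym/eqP; rewrite eqEdim -memvE b dim_vline n0 E_dim.
by move=> e; move: Ew; rewrite /along e => /vlineP[a ->]; exists a; rewrite -e.
Qed.

Lemma vpick_px v : box x0 t0 v -> px (vpick (E (q v))) != 0.
Proof.
move=> bv; have [n0 b] := vpick_along v; apply/negP => /eqP h.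
have := cone_flat K_cone bv b n0; rewrite h normr0 normr_le0 => /eqP h'.
case/negP: n0.
by apply/eqP/plane_ext; rewrite ?px0 ?py0.
Qed.

Lemma slope_le1 v : box x0 t0 v -> `|slope v| <= 1.
Proof.
move=> bv; have [n0 b] := vpick_along v; have := cone_flat K_cone bv b n0.
by rewrite /slope normrM normfV ler_pdivrMr ?normr_gt0 ?vpick_px // mul1r.
Qed.

Lemma slopeP v w : box x0 t0 v -> along v w -> py w = slope v * px w.
Proof.
move=> bv /along_multiple[a ->]; rewrite !pE /slope mulrCA; congr (_ * _).
by rewrite divfK // vpick_px.
Qed.

Lemma slope_along v a : box x0 t0 v -> along v (pt a (slope v * a)).
Proof.
move=> bv; have [_ b] := vpick_along v; have n := vpick_px bv.
rewrite (_ : pt _ _ = (a / px (vpick (E (q v)))) *: vpick (E (q v))); first exact: memvZ.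
apply: plane_ext; rewrite !pE; first by rewrite divfK.
by rewrite /slope mulrC mulrAC mulrA.
Qed.

(** Slopes at most 1 give unit vectors [u], [u'] with [px u ^+ 2] and [px u' ^+ 2] at least 1/2. The
    difference of the slopes times [px u * px u'] is a determinant, at most [2 * enorm (u - u')];
    hence the constant 4. *)
Lemma slope_line_dist v v' : box x0 t0 v -> box x0 t0 v' ->
  `|slope v - slope v'| <= 4 * line_dist (E (q v)) (E (q v')).
Proof.
move=> bv bv'; rewrite mulrC -ler_pdivrMr //; apply: lb_le_inf.
  have [n0 b] := vpick_along v; have [n0' b'] := vpick_along v'.
  have U u : u != 0 :> V -> enorm ((enorm u)^-1 *: u) = 1.
    move=> nu; have e0 : enorm u != 0.
      apply: contra nu => /eqP e; rewrite -normr_le0 -e; exact: norm_le_enorm.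
    by rewrite enormZ normfV ger0_norm ?enorm_ge0 // mulVf.
  eexists; exists ((enorm (vpick (E (q v))))^-1 *: vpick (E (q v))).
  exists ((enorm (vpick (E (q v'))))^-1 *: vpick (E (q v'))).
  by split; [exact: memvZ|exact: memvZ|exact: U|exact: U|reflexivity].
move=> _ [u [u' [Eu Eu' nu nu' ->]]]; rewrite ler_pdivrMr //.
have su := slopeP bv Eu; have su' := slopeP bv' Eu'.
have l1 := slope_le1 bv; have l1' := slope_le1 bv'.
have half (w : V) (s : R) : enorm w = 1 -> py w = s * px w -> `|s| <= 1 -> 1 / 2 <= `|px w| ^+ 2 /\ `|px w| <= 1.
  move=> nw sw ls; split; last by rewrite -nw; exact: px_le_enorm.
  have := enorm_sqr w; rewrite nw sw expr1n exprMn real_normK ?num_real //.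
  have : s ^+ 2 <= 1 by rewrite -(real_normK (num_real s)) expr_le1.
  move: (s ^+ 2) => s2 h; have := sqr_ge0 (px w); nra.
have [h1 h1'] := half _ _ nu su l1; have [h2 h2'] := half _ _ nu' su' l1'.
have dx := px_le_enorm (u - u'); have dy := py_le_enorm (u - u').
have d0 := enorm_ge0 (u - u').
have pyu : `|py u| <= 1 by rewrite -nu; exact: py_le_enorm.
have E1 : (slope v - slope v') * (px u * px u') = - py u * px (u - u') + px u * py (u - u').
  by rewrite !pE su su'; ring.
have : `|slope v - slope v'| * (`|px u| * `|px u'|) <= 2 * enorm (u - u').
  rewrite -!normrM E1; apply: le_trans (ler_normD _ _) _; rewrite !normrM normrN.
  have : `|py u| * `|px (u - u')| <= 1 * enorm (u - u') by apply: ler_pM.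
  have : `|px u| * `|py (u - u')| <= 1 * enorm (u - u') by apply: ler_pM.
  lra.
have : 1 / 2 <= `|px u| * `|px u'|.
  have [] := (normr_ge0 (px u), normr_ge0 (px u')).
  move: h1 h2 h1' h2'; move: (`|px u|) (`|px u'|) => a a' k1 k2 k3 k4 k5 k6.
  rewrite -(@ler_pXn2r _ 2) ?nnegrE ?mulr_ge0 //.
  rewrite exprMn; have : 1 / 2 * (1 / 2) <= a ^+ 2 * a' ^+ 2 by apply: ler_pM => //; lra.
  lra.
have := normr_ge0 (slope v - slope v').
move: (`|slope v - slope v'|) (`|px u| * `|px u'|) (enorm (u - u')) => A B D; nra.
Qed.

Hypothesis K_merge : merging along.

Lemma merging_not_lipschitz : ~ lipschitz_bundle E.
Proof.
move=> [k Hk]; have /andP[x0p x0h] := x0_bounds R; have /andP[t0p t0h] := t0_bounds R.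
pose L := 4 * (`|k| + 1).
have L0 : 0 < L by rewrite mulr_gt0 // ltr_wpDl.
pose cp (t y : R) : V := pt (clamp x0 (x0 - t)) (clamp t0 y).
have cp_box t y : box x0 t0 (cp t y).
  by split; rewrite ?px_pt ?py_pt clamp_le // ltW.
(* The curves are graphs run through to the left, with abscissa [x0 - t] at time [t]; hence the
   sign. *)
pose S t y := - slope (cp t y).
have S_bnd t y : `|S t y| <= 1 by rewrite normrN slope_le1.
have S_lip t t' y y' : `|S t y - S t' y'| <= L * (`|t - t'| + `|y - y'|).
  rewrite /S -opprD normrN; apply: le_trans (slope_line_dist (cp_box _ _) (cp_box _ _)) _.
  rewrite /L -mulrA ler_pM2l //; apply: le_trans (Hk _ _) _.
  have h1 : tdist (q (cp t y)) (q (cp t' y')) <= `|t - t'| + `|y - y'|.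
    apply: le_trans (tdist_le _ _) _; rewrite opprD addrACA subrr addr0.
    apply: le_trans (enorm_le_add _) _; rewrite !pE; apply: lerD; last exact: clamp_lip.
    apply: le_trans (clamp_lip _ _ _) _; rewrite distrC.
    by rewrite (_ : x0 - t' - (x0 - t) = t - t') //; ring.
  have := tdist_ge0 (q (cp t y)) (q (cp t' y')).
  move: h1; move: (tdist _ _) (_ + _ : R) => a b ab a0.
  have := ler_norm k; have := normr_ge0 k; move: (`|k|) => k' k0 kk.
  apply: le_trans (_ : k' * a <= _); first by rewrite ler_wpM2r.
  by apply: ler_pM => //; lra.
have curve y0 : exists y : R -> R, y 0 = y0 /\ (forall t : R, is_derive t 1 y (S t (y t))) /\
    Ecurve x0 t0 along (fun t => pt (x0 - t) (y t)) (fun t => pt (-1) (S t (y t))).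
  have [y [y_0 dy]] := picard L0 S_lip S_bnd y0; exists y; split => //; split => //; split.
  - move=> t; apply/curve_components; rewrite px_pt py_pt; split.
      have h := is_derive_id t (1 : R).
      have := is_derive_affine x0 (-1) 0 h h; rewrite mul0r addr0 mulr1.
      by congr (is_derive _ _ _ _); apply/funext => u /=; rewrite px_pt; ring.
    by rewrite (_ : py \o _ = y) //; apply/funext => u /=; rewrite py_pt.
  - move=> t; apply: pt_cvg; first exact: cvg_cst.
    apply/cvgrPdist_le => e e0.
    have d0 : 0 < e / (2 * L) by rewrite divr_gt0 // mulr_gt0.
    near=> u; apply: le_trans (S_lip _ _ _ _) _.
    have h1 : `|t - u| <= e / (2 * L) by near: u; apply: cvgr_dist_le => //; exact: cvg_id.
    have h2 : `|y t - y u| <= e / (2 * L).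
      by near: u; apply: cvgr_dist_le => //; exact: (is_derive_cts (dy t)).
    have Ee : L * (e / (2 * L) + e / (2 * L)) = e by field; rewrite gt_eqF.
    by rewrite -Ee ler_pM2l // lerD.
  - move=> t _ bt; split.
      by apply/eqP => /(congr1 px); rewrite px_pt px0; lra.
    have [b1 b2] := bt; rewrite px_pt in b1; rewrite py_pt in b2.
    have -> : S t (y t) = slope (pt (x0 - t) (y t)) * (-1).
      by rewrite /S /cp (clamp_id b1) (clamp_id b2) mulrN1.
    exact: slope_along.
(* At this time the abscissa is [- x0 - 1], whatever the height. *)
have exit (y : R -> R) : ~ box x0 t0 (pt (x0 - (2 * x0 + 1)) (y (2 * x0 + 1))).
  by move=> [+ _]; rewrite px_pt ler_norml => /andP[? ?]; lra.
have b0 : 0 <= 2 * x0 + 1 by lra.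
have [y1 [y10 [dy1 E1]]] := curve 0; have [y2 [y20 [dy2 E2]]] := curve t0.
have P1 : px (pt (x0 - 0) (y1 0)) = x0 by rewrite px_pt subr0.
have P2 : px (pt (x0 - 0) (y2 0)) = x0 by rewrite px_pt subr0.
have Q1 : `|py (pt (x0 - 0) (y1 0))| <= t0 by rewrite py_pt y10 normr0 ltW.
have Q2 : `|py (pt (x0 - 0) (y2 0))| <= t0 by rewrite py_pt y20 ger0_norm // ltW.
have N s : px (pt (-1) s) < 0 :> R by rewrite px_pt ltrN10.
have [T1 [T2 [T10 T20 _ _ e]]] := K_merge E1 b0 P1 Q1 (N _) (exit y1) E2 b0 P2 Q2 (N _) (exit y2).
have eT : T1 = T2 by move/(congr1 px): e; rewrite !px_pt; lra.
have ey : y1 T2 = y2 T2 by move/(congr1 py): e; rewrite !py_pt eT.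
have := ode_unique S_lip dy1 dy2 T20 ey; rewrite y10 y20 => e0.
by move: t0p; rewrite -e0 ltxx.
Unshelve. all: by end_near. Qed.

End NotLipschitz.

(** * Application to the two bundles *)

Section Bundles.
Variable R : realType.
Notation V := 'rV[R]_2.
Notation T := (torus R).
Implicit Types (v w : V).
Variables (g : diffeo R) (E : T -> {vspace V}).
Hypothesis E_inv : invariant_bundle g E.

Lemma invariant_image p w : w \in E p -> w *m diffeo_diff g p \in E (g p).
Proof.
move=> Ew; rewrite -E_inv.
by have := memv_img (linfun (mulmxr (diffeo_diff g p))) Ew; rewrite lfunE.
Qed.

Hypothesis gf : C1_close (e0 R) (fdiffeo R) g.

Lemma along_image v w : along 0 E v w -> along 0 E (G gf v) (w *m DG g v).
Proof. by rewrite /along /shifted !addr0 tproj_G; exact: invariant_image. Qed.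

Lemma along_preimage v w : along (sink_base R) E v w ->
  along (sink_base R) E (Gs gf v) (w *m DGs g v).
Proof.
rewrite /along /shifted /Gs /DGs subrK; set v' := v + sink_base R.
rewrite -{1}[v'](GinvK gf) tproj_G -E_inv => /memv_imgP[u Eu ->].
rewrite lfunE /=; have := DGK gf (Ginv gf v') u; rewrite GinvK /DG => ->.
exact: Eu.
Qed.

End Bundles.

Section Cones.
Variable R : realType.
Notation T := (torus R).
Variable m : T -> R.
Hypothesis m_le : forall p, `|m p| <= 1 / 20.

Lemma dirE_in_cone : in_cone (along 0 (line_bundle (dirE m))).
Proof.
move=> v w; rewrite /along /shifted addr0 => /vlineP[a ->]; exists a, (m (tproj v)); split => //.
by apply: plane_ext; rewrite /dirE /nuE /nuF !pE cTE sTE; ring.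
Qed.

(** At [sink_base] the frame has turned by a right angle: [nuF] becomes the opposite of the vector
    of angle [fr * t] and [nuE] the vector orthogonal to it, whence the two signs. *)
Lemma dirF_in_cone : in_cone (along (sink_base R) (line_bundle (dirF m))).
Proof.
move=> v w; rewrite /along /shifted => /vlineP[a ->].
set p := tproj _; exists (- a), (- m p); split; first by rewrite normrN.
have E : fr R * py (v + sink_base R) = fr R * py v + pi / 2.
  by rewrite pyD py_pt mulrDr fr_base.
by apply: plane_ext; rewrite /dirF /nuE /nuF !pE /p cTE sTE E sinDpihalf cosDpihalf; ring.
Qed.

End Cones.

Lemma close_bundles (R : realType) (g : diffeo R) : C1_close (e0 R) (fdiffeo R) g ->
  exists E F, [/\ dominated_splitting g E F, ~ integrable_bundle E, ~ integrable_bundle F,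
    ~ lipschitz_bundle E & ~ lipschitz_bundle F].
Proof.
move=> gf; have [mE [mF [[cE cF] bm iE iF]]] := graphs_exist gf.
exists (line_bundle (dirE mE)), (line_bundle (dirF mF)).
have ds := bundles_split gf cE cF bm iE iF.
have [[[dE _] [dF _]] _ [invE invF] _] := ds.
have coneE := dirE_in_cone (fun p => (bm p).1); have coneF := dirF_in_cone (fun p => (bm p).2).
have mgE := @source_merging R g gf _ coneE (@along_image R g _ invE gf).
have mgF := @sink_merging R g gf _ coneF (@along_preimage R g _ invF gf).
split => //.
- exact: merging_not_integrable coneE mgE.
- exact: merging_not_integrable coneF mgF.
- exact: merging_not_lipschitz coneE dE mgE.
- exact: merging_not_lipschitz coneF dF mgF.
Qed.

Theorem theorem1p5 (R : realType) :
  exists (f : diffeo R) (U : set (diffeo R)),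
    [/\ exists E F, dominated_splitting f E F,
        C1_open U,
        U f &
        forall g, U g -> exists E F,
          [/\ dominated_splitting g E F,
              ~ integrable_bundle E, ~ integrable_bundle F,
              ~ lipschitz_bundle E & ~ lipschitz_bundle F]].
Proof.
have e0p := e0_gt0 R; have ff e : 0 < e -> C1_close e (fdiffeo R) (fdiffeo R).
  by move=> ep p; rewrite tdistxx subrr normr0.
(* The bounds in [C1_close] are strict at each point, but not uniformly. A radius [e < e0 R] leaves
   a uniform margin, which makes the set open. *)
exists (fdiffeo R), [set g | exists2 e, e < e0 R & C1_close e (fdiffeo R) g]; split.
- by have [E [F [ds _ _ _ _]]] := close_bundles (ff _ e0p); exists E, F.
- move=> h [e ee0 hf]; exists ((e0 R - e) / 2); first by rewrite divr_gt0 // subr_gt0.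
  move=> g hg; exists (e + (e0 R - e) / 2); first by lra.
  move=> p; have [h1 h2] := hf p; have [h3 h4] := hg p; split.
    by apply: le_lt_trans (tdist_triangle _ (h p) _) _; exact: ltrD.
  have -> : diffeo_diff (fdiffeo R) p - diffeo_diff g p =
      (diffeo_diff (fdiffeo R) p - diffeo_diff h p) + (diffeo_diff h p - diffeo_diff g p).
    by rewrite addrA subrK.
  by apply: le_lt_trans (ler_normD _ _) _; exact: ltrD.
- by exists (e0 R / 2); [lra|apply: ff; lra].
- move=> g [e ee0 gf]; apply: close_bundles => p.
  by have [h1 h2] := gf p; split; apply: lt_trans ee0.
Qed.
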